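(* Let $\overline p(n)$ be the number of overpartitions of $n$. With $S=S(n):=\pi\sqrt n$, set $$A(n):=\frac{\pi^2}{2}\left(\frac{1}{S-1}-\frac{3}{S^2}\right),\qquad \delta(n):=\frac{\pi^2}{2}\left(\frac{1}{2S(S-1)^2}-\frac{3}{S^4}\right)^{1/2}.$$ Then for every degree $m\ge2$, the sequence $\overline p(n)$ is log-polynomial with data $\{A(n),-1,\delta(n)\}$. Consequently, $\overline p(n)$ is Hermite-Jensen of every positive integer degree with data $\{A(n),-1,\delta(n)\}$. It is also Hermite-Jensen of every positive integer degree with the data $\{A^*(n),-1,\delta^*(n)\}$, where $$A^*(n):=\frac{\pi}{2n^{1/2}},\qquad\delta^*(n):=\frac{\sqrt\pi}{8^{1/2}n^{3/4}}.$$
   Context: An overpartition of $n$ is a partition of $n$ in which the first occurrence of each part size may or may not be overlined. Equivalently, $\sum_n\overline p(n)q^n=\prod_{j\ge1}\frac{1+q^j}{1-q^j}$. Jensen polynomials: $J_\alpha^{d,n}(X)=\sum_{j=0}^d\binom{d}{j}\alpha(n+j)X^j$ and $K_\alpha^{d,n}(X)=X^dJ_\alpha^{d,n}(1/X)$. $H_d$ is the physicists' Hermite polynomial, $e^{2Xt-t^2}=\sum_d H_d(X)t^d/d!$. Log-polynomial: let $m\ge2$ be an integer and $\kappa\in\{1,-1\}$. A sequence of positive reals $\alpha(n)$ is log-polynomial of degree $m$ with data $\{A(n),\kappa,\delta(n)\}$ if there are real sequences $A(n),\delta(n),g_k(n)$ ($3\le k\le m$) such that $$\log\left(\frac{\alpha(n+j)}{\alpha(n)}\right)=A(n)j+\kappa\delta(n)^2j^2+\sum_{k=3}^m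 g_k(n)j^k+o(\delta(n)^{m+1})\quad(n\to\infty)$$ for $j=1,\dots,m+1$. In addition, $\delta(n)>0$, $\delta(n)\to0$ and $g_k(n)=o(\delta(n)^k)$. Hermite-Jensen: a sequence of positive reals $\alpha(n)$ is Hermite-Jensen of degree $d\ge1$ with data $\{A(n),\kappa,\delta(n)\}$ if, as $n\to\infty$, both $$\frac{\delta(n)^{-d}}{\alpha(n)}J_\alpha^{d,n}\!\left(\frac{\delta(n)X-1}{e^{A(n)}}\right)\quad\text{and}\quad\frac{(e^{A(n)}\delta(n))^{-d}}{\alpha(n)}K_\alpha^{d,n}\!\left(e^{A(n)}(\delta(n)X-1)\right)$$ converge coefficientwise to $H_d(X/2)$ if $\kappa=-1$, and to $i^{-d}H_d(iX/2)$ if $\kappa=1$. *)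

(* Defs.v *)
From HB Require Import structures.
From mathcomp Require Import all_boot all_order all_algebra.
From mathcomp Require Import all_classical all_reals all_analysis.
Set Implicit Arguments. Unset Strict Implicit. Unset Printing Implicit Defensive.
Import Order.TTheory GRing.Theory Num.Theory.
Import numFieldNormedType.Exports.
Local Open Scope classical_set_scope.
Local Open Scope ring_scope.

(* Number of overpartitions of n.  An overpartition of n is encoded by the
   multiplicity vector m (m i = multiplicity of the part size i.+1, i < n;
   multiplicities are <= n) together with the set o of part sizes whose
   first occurrence is overlined; only part sizes that actually occur may be
   overlined. *)
Definition overpartition_count (n : nat) : nat :=
  #|[set mo : {ffun 'I_n -> 'I_n.+1} * {ffun 'I_n -> bool} |
      ((\sum_(i < n) i.+1 * mo.1 i)%N == n) &&
      [forall i, mo.2 i ==> (0 < mo.1 i)%N]]|.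

Section Defs.
Variable R : realType.

(* Physicists' Hermite polynomial: coefficient of t^d/d! in
   e^{2Xt} e^{-t^2} (Cauchy product of the two exponential series). *)
Definition hermite (d : nat) : {poly R} :=
  \sum_(k < d./2.+1)
     ((-1) ^+ k * ((d`!)%:R / ((k`! * (d - 2 * k)`!)%:R)))
       *: (2%:R *: 'X) ^+ (d - 2 * k).

Definition hermite_half (d : nat) : {poly R} := hermite d \Po (2^-1 *: 'X).

(* i^{-d} H_d(i X / 2), which has real coefficients: substituting x = iX/2
   in the formula above, i^{-d} (iX)^{d-2k} = (-1)^k X^{d-2k}. *)
Definition hermite_i_half (d : nat) : {poly R} :=
  \sum_(k < d./2.+1)
     ((-1) ^+ k * (-1) ^+ k * ((d`!)%:R / ((k`! * (d - 2 * k)`!)%:R)))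
       *: 'X ^+ (d - 2 * k).

Definition jensenJ (alpha : nat -> R) (d n : nat) : {poly R} :=
  \sum_(j < d.+1) ('C(d, j)%:R * alpha (n + j)%N) *: 'X ^+ j.

(* K^{d,n}(X) = X^d J^{d,n}(1/X) *)
Definition jensenK (alpha : nat -> R) (d n : nat) : {poly R} :=
  \sum_(j < d.+1) ('C(d, j)%:R * alpha (n + j)%N) *: 'X ^+ (d - j).

(* Log-polynomial of degree m with data {A, kappa, delta}.  Little-o with
   respect to the (eventually positive) sequence delta^{m+1} is expressed
   as convergence of the quotient to 0. *)
Definition log_polynomial (m : nat) (alpha : nat -> R)
    (A : nat -> R) (kappa : R) (delta : nat -> R) : Prop :=
  (2 <= m)%N /\ (kappa = 1 \/ kappa = -1) /\
  (forall n, 0 < alpha n) /\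
  (\forall n \near \oo, 0 < delta n) /\
  (delta @ \oo --> 0) /\
  exists g : nat -> nat -> R,
    (forall k, (3 <= k <= m)%N ->
       (fun n => g k n / delta n ^+ k) @ \oo --> 0) /\
    (forall j, (1 <= j <= m.+1)%N ->
       (fun n => (ln (alpha (n + j)%N / alpha n)
                  - (A n * j%:R + kappa * delta n ^+ 2 * j%:R ^+ 2
                     + \sum_(3 <= k < m.+1) g k n * j%:R ^+ k))
                 / delta n ^+ m.+1) @ \oo --> 0).

Definition hermite_jensen (d : nat) (alpha : nat -> R)
    (A : nat -> R) (kappa : R) (delta : nat -> R) : Prop :=
  (1 <= d)%N /\ (kappa = 1 \/ kappa = -1) /\
  (forall n, 0 < alpha n) /\
  let H := if kappa == -1 then hermite_half d else hermite_i_half d in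
  forall i : nat,
    ((fun n => ((delta n ^- d / alpha n) *:
        (jensenJ alpha d n \Po ((expR (A n))^-1 *: (delta n *: 'X - 1))))`_i)
       @ \oo --> H`_i) /\
    ((fun n => (((expR (A n) * delta n) ^- d / alpha n) *:
        (jensenK alpha d n \Po (expR (A n) *: (delta n *: 'X - 1))))`_i)
       @ \oo --> H`_i).

End Defs.

Definition pbar {R : realType} (n : nat) : R := (overpartition_count n)%:R.
Definition S_ {R : realType} (n : nat) : R := pi * Num.sqrt (n%:R).
Definition A_op {R : realType} (n : nat) : R :=
  (pi ^+ 2 / 2) * ((S_ n - 1)^-1 - 3 / S_ n ^+ 2).
Definition delta_op {R : realType} (n : nat) : R :=
  (pi ^+ 2 / 2) *
  Num.sqrt ((2 * S_ n * (S_ n - 1) ^+ 2)^-1 - 3 / S_ n ^+ 4).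
Definition Astar_op {R : realType} (n : nat) : R :=
  pi / (2 * Num.sqrt (n%:R)).
Definition deltastar_op {R : realType} (n : nat) : R :=
  Num.sqrt pi / (Num.sqrt 8 * (n%:R `^ (3 / 4))).

(* Main.v *)
Require Import Defs.
From HB Require Import structures.
From mathcomp Require Import all_boot all_order all_algebra.
From mathcomp Require Import all_classical all_reals all_analysis.
From mathcomp Require Import zify ring lra.
Set Implicit Arguments. Unset Strict Implicit. Unset Printing Implicit Defensive.
Import Order.TTheory GRing.Theory Num.Theory.
Import numFieldNormedType.Exports.
Local Open Scope classical_set_scope.
Local Open Scope ring_scope.

(* Let [p(n)] count overpartitions.  Logarithmic differentiation of the
   generating function gives [n p(n) = sum_k c(k) p(n - k)] with
   [c(k) = 2 sum_(r odd, r | k) k / r].  The exponential moments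
   [sum_k c(k) k^i e^(-kz)] agree with explicit main terms up to [O(z^K)] for
   every [K]: the Lambert series of [c] is a sum over odd midpoints, and the
   midpoint rule is exact to all orders for the derivative of the logistic
   function.  Hence [F(n) = e^S (S - 1) / n^(3/2)], [S = pi sqrt n], satisfies
   the same recurrence with a relative error [O(n^-K)] for every [K].  The
   ratio [p / F] is thus, up to such errors, a weighted average of its earlier
   values; its oscillation contracts at scale [n^(3/4)], so that
   [p(a) / F(a) - p(b) / F(b) = O(n^-K)] for [a, b >= n].  Therefore
   [ln (p(n + j) / p(n))] has the Taylor expansion of [ln F], whose derivatives
   satisfy [(ln F)' = A], [(ln F)'' = - 2 delta^2] and
   [(ln F)^(k) = O(n^(1/2 - k))].  Finally, the coefficients of the rescaled
   Jensen polynomials are finite differences of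
   [e^(sum_k g_k j^k - delta^2 j^2)]; a difference of order [r] kills all powers
   of [j] below [r] and extracts the Hermite coefficient from [e^(-x^2)]. *)

(** * The recurrence [n p(n) = sum_k c(k) p(n - k)] *)

(** [F] is twice the derivative of [e^(pi sqrt x) / sqrt x], the leading term given by the circle
    method. Only ratios of values of [p] matter, so the limit of [p / F] is never identified and all
    estimates stay on the real line. In place of a modular transformation there is a dyadic descent:
    a duplication formula compares the Lambert series at [z] and [2 z] up to a midpoint sum, and
    [sum 1 / (2k + 1)^2 = pi^2 / 8] fixes the limit at 0. Errors [n^-K] for all [K] are forced by
    the target [o(delta^(m+1))], where [m] is arbitrary and [delta] has the size of [theta^3],
    [theta = n^(-1/4)]. The factor [e^(-k pi / (2 sqrt n))] confines the lags [k] to the scale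
    [sqrt n]: a power of [k] costs [theta^-2], a derivative of the tilted model brings [theta^3], so
    each Taylor order gains [theta]. At distance [n^(3/4)] the mass is of order [e^(-c n^(1/4))],
    beyond all powers, which fixes the window of the contraction. The gain per window is only
    [c / ln n], because [c(k)] is known up to a logarithm, but the window costs just [O(theta)].
    Finally [(ln F)^(k)] is [O(theta^(4k-2))], which is [o(delta^k)] exactly from [k = 3] on. *)

(* [2 * sum of k / r over the odd divisors r of k]; the outer index is [i.+1 = k / r]. *)
Definition twice_odd_codivisors (k : nat) : nat :=
  \sum_(i < k) \sum_(r < k.+1 | odd r && (i.+1 * r == k)%N) 2 * i.+1.

(** Power series enter as integer polynomials read up to degree [N], so that every product and
    derivative is finite. *)
Definition eq_upto (N : nat) (p q : {poly int}) :=
  forall l, (l <= N)%N -> p`_l = q`_l.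

Lemma eq_upto_mul N p p' q q' :
  eq_upto N p p' -> eq_upto N q q' -> eq_upto N (p * q) (p' * q').
Proof.
move=> hp hq l hl; rewrite !coefM; apply: eq_bigr => i _.
by rewrite hp ?hq //; have := ltn_ord i; lia.
Qed.

Lemma eq_upto_prod N (I : Type) (s : seq I) (f g : I -> {poly int}) :
  (forall i, eq_upto N (f i) (g i)) ->
  eq_upto N (\prod_(i <- s) f i) (\prod_(i <- s) g i).
Proof.
move=> h; elim: s => [|i s IH]; first by rewrite !big_nil.
by rewrite !big_cons; apply: eq_upto_mul.
Qed.

(** [X f' = f g] says, without division, that [g] is [X] times the logarithmic derivative of [f];
    such [g] add up under products by the Leibniz rule. *)
Lemma eq_upto_deriv_prod N (I : Type) (s : seq I) (f g : I -> {poly int}) :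
  (forall i, eq_upto N ('X * (f i)^`()) (f i * g i)) ->
  eq_upto N ('X * (\prod_(i <- s) f i)^`())
     ((\prod_(i <- s) f i) * \sum_(i <- s) g i).
Proof.
move=> h; elim: s => [|i s IH] l hl.
  by rewrite !big_nil derivC !mulr0.
rewrite !big_cons derivM mulrDr mulrDr coefD [RHS]coefD.
congr (_ + _).
  have -> : 'X * ((f i)^`() * \prod_(j <- s) f j) =
    ('X * (f i)^`()) * \prod_(j <- s) f j by ring.
  have -> : f i * (\prod_(j <- s) f j) * g i = (f i * g i) * \prod_(j <- s) f j.
    by ring.
  exact: (eq_upto_mul (h i) (fun _ _ => erefl)).
have -> : 'X * (f i * (\prod_(j <- s) f j)^`()) =
  f i * ('X * (\prod_(j <- s) f j)^`()) by ring.
rewrite -mulrA; exact: (@eq_upto_mul N (f i) (f i) _ _ (fun _ _ => erefl) IH).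
Qed.

(** Truncation of [(1 + x) / (1 - x)]: a part size that occurs has two forms, with and without
    overline. *)
Definition part_gf (N : nat) : {poly int} :=
  \poly_(m < N.+1) (if m == 0 then 1 else 2)%N%:R.

(** Truncation of [2 x / (1 - x^2)], which is [x] times the logarithmic derivative of
    [(1 + x) / (1 - x)]. *)
Definition odd_gf (N : nat) : {poly int} :=
  \poly_(r < N.+1) (2 * odd r)%:R.

Lemma part_gf_log_deriv N :
  eq_upto N ('X * (part_gf N)^`()) (part_gf N * odd_gf N).
Proof.
move=> [|l] hl; rewrite coefXM coefM /=.
  by rewrite big_ord_recl big_ord0 /= !coef_poly /= mulr0 addr0.
rewrite coef_deriv coef_poly ltnS hl /=.
rewrite big_ord_recl /= !coef_poly /= subn0 ltnS hl mul1r.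
(* The constant term of [part_gf] contributes [2] if [l.+1] is odd, the other terms [4] for each odd
   number up to [l]; the total is [2 * l.+1]. *)
transitivity ((2 * odd l.+1)%:R + \sum_(i < l.+1) (4 * odd (l.+1 - i.+1))%:R : int); last first.
  congr (_ + _).
  apply: eq_bigr => i _; have := ltn_ord i => hi; rewrite !coef_poly /bump /= add1n.
  rewrite (_ : (i.+1 < N.+1)%N); last lia.
  rewrite (_ : (l.+1 - i.+1 < N.+1)%N); last lia.
  by rewrite -natrM; case: (odd _).
rewrite -natr_sum -natrD -mulrnA -big_distrr /=.
congr (_ %:R).
have -> : (\sum_(i < l.+1) odd (l.+1 - i.+1))%N = (\sum_(i < l.+1) odd i)%N.
  rewrite [RHS](reindex_inj rev_ord_inj) /=; apply: eq_bigr => i _.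
  by congr (nat_of_bool (odd _)); lia.
have -> : (\sum_(i < l.+1) odd i)%N = (l.+1)./2.
  elim: l.+1 => [|k IH]; first by rewrite big_ord0.
  by rewrite big_ord_recr /= IH uphalf_half addnC.
rewrite -[in LHS](odd_double_half l.+1) -!mul2n; lia.
Qed.

Definition factor (N i : nat) : {poly int} := part_gf N \Po 'X^(i.+1).
(** Substituting [X^(i+1)] multiplies the operator [X d/dX] by [i.+1]; this factor becomes the
    codivisor in the recurrence. *)
Definition log_factor (N i : nat) : {poly int} :=
  i.+1%:R *: (odd_gf N \Po 'X^(i.+1)).

Lemma factor_log_deriv N i :
  eq_upto N ('X * (factor N i)^`()) (factor N i * log_factor N i).
Proof.
move=> l hl; rewrite /factor /log_factor deriv_comp derivXn /=.
have -> : 'X * (((part_gf N)^`() \Po 'X^(i.+1)) * ('X^i *+ i.+1)) =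
   i.+1%:R *: (('X * (part_gf N)^`()) \Po 'X^(i.+1)).
  rewrite comp_polyM comp_polyX -mulr_natr exprS scaler_nat -mulr_natr; ring.
rewrite -scalerAr -comp_polyM !coefZ !coef_comp_poly_Xn //.
case: ifP => // h; congr (_ * _); apply: part_gf_log_deriv.
by apply: leq_trans (leq_div _ _) hl.
Qed.

Definition overp_gf (N : nat) : {poly int} := \prod_(i < N) factor N i.

(** A part size above [n] has a factor [1 + O(X^(n+1))]. *)
Lemma overp_gf_stable n N : (n <= N)%N -> eq_upto n (overp_gf N) (overp_gf n).
Proof.
move=> hnN; rewrite /overp_gf.
have fE i M l : (factor M i)`_l =
   if (i.+1 %| l)%N && (l %/ i.+1 <= M)%N then (if l == 0 then 1 else 2)%N%:R else 0.
  rewrite /factor coef_comp_poly_Xn // coef_poly ltnS.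
  case: (boolP (i.+1 %| l)%N) => //= h; case: ifP => // _.
  by rewrite -(divnK h) muln_eq0 orbF mulnK.
rewrite -(subnKC hnN) big_split_ord /= -[X in eq_upto _ _ X]mulr1.
apply: eq_upto_mul.
  apply: eq_upto_prod => i l hl; rewrite !fE.
  have hd := leq_div l i.+1.
  by rewrite (leq_trans hd hl) (leq_trans (leq_trans hd hl)) // leq_addr.
rewrite [X in eq_upto _ _ X](_ : _ = \prod_(i < N - n) 1); last by rewrite big1.
apply: eq_upto_prod => i l hl; rewrite fE coefC.
case: l hl => [|l] hl /=; first by rewrite ?dvdn0 ?div0n.
by rewrite gtnNdvd //; lia.
Qed.

(** Distributing the product chooses a multiplicity for each part size. The coefficient [2] of a
    positive multiplicity is the number of booleans [b] with [b ==> (0 < m i)], so a second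
    distribution chooses the overlines. *)
Lemma overp_gf_coef n : (overp_gf n)`_n = (overpartition_count n)%:R.
Proof.
rewrite /overp_gf.
have fE (i : 'I_n) : factor n i =
   \sum_(m < n.+1) (if val m == 0 then 1 else 2)%N%:R *: 'X^(i.+1 * m).
  rewrite /factor /part_gf poly_def raddf_sum /=; apply: eq_bigr => m _.
  by rewrite comp_polyZ comp_Xn_poly -exprM.
rewrite (eq_bigr _ (fun i _ => fE i)) bigA_distr_bigA /= coef_sum.
rewrite /overpartition_count -sum1_card natr_sum.
pose F (m : {ffun 'I_n -> 'I_n.+1}) (o : {ffun 'I_n -> bool}) : int :=
  if (\sum_(i < n) i.+1 * m i == n)%N && [forall i, o i ==> (0 < m i)%N] then 1 else 0.
transitivity (\sum_m \sum_o F m o); last first.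
  rewrite pair_big /=; rewrite [RHS]big_mkcond /=; apply: eq_bigr => -[m o] _.
  (* The set counted by [overpartition_count] is a classical one, so its membership unfolds to an
     [asbool]. *)
  by rewrite -[X in _ = if X then _ else _]/(`[< _ >]) asboolb.
apply: eq_bigr => m _; rewrite /F.
transitivity (((\sum_(i < n) i.+1 * m i == n)%N : nat)%:R *
    \prod_(i < n) (\sum_(b : bool) (b ==> (0 < m i)%N : nat)%:R) : int).
  have -> : \prod_(i < n) ((if val (m i) == 0 then 1 else 2)%N%:R *: 'X^(i.+1 * m i)) =
      (\prod_(i < n) (if val (m i) == 0 then 1 else 2)%N%:R : int) *: 'X^(\sum_(i < n) i.+1 * m i) :> {poly int}.
    rewrite -prodrXr -scaler_prod //.
  rewrite coefZ coefXn mulrC eq_sym; congr (_ * _); apply: eq_bigr => i _.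
  by rewrite big_bool /= lt0n; case: (val (m i) == 0).
case: eqP => /= _; last by rewrite mul0r big1.
rewrite mul1r bigA_distr_bigA /=; apply: eq_bigr => o _.
case: (boolP [forall i, _]) => [/forallP h|].
  by rewrite big1 // => i _; rewrite h.
by rewrite negb_forall => /existsP[i hi]; rewrite (bigD1 i) //= (negbTE hi) mul0r.
Qed.

Lemma log_factor_sum N k : (k <= N)%N ->
  (\sum_(i < N) log_factor N i)`_k = (twice_odd_codivisors k)%:R.
Proof.
move=> hk; rewrite coef_sum.
transitivity (\sum_(i < N) (\sum_(r < k.+1 | odd r && (i.+1 * r == k)%N) 2 * i.+1)%N%:R : int).
  apply: eq_bigr => i _.
  rewrite /log_factor coefZ coef_comp_poly_Xn //.
  case: (boolP (i.+1 %| k)%N) => h; last first.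
    rewrite mulr0 big1 // => r /andP[_ /eqP e].
    by rewrite -e dvdn_mulr in h.
  rewrite coef_poly ltnS (leq_trans (leq_div _ _) hk).
  case: (boolP (odd (k %/ i.+1)%N)) => ho; last first.
    rewrite muln0 mulr0 big1 // => r /andP[hr /eqP e].
    by rewrite -e mulKn // hr in ho.
  have kE : (i.+1 * (k %/ i.+1) = k)%N by rewrite mulnC divnK.
  have lt_k : (k %/ i.+1 < k.+1)%N by rewrite ltnS leq_div.
  rewrite (bigD1 (Ordinal lt_k)) /=; last by rewrite ho kE eqxx.
  rewrite big1 ?addn0 ?muln1; first by rewrite -natrM mulnC.
  move=> r /andP[/andP[_ /eqP e] /eqP[]]; apply: val_inj => /=.
  by rewrite -[RHS](congr1 (divn^~ i.+1) e) mulKn.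
rewrite -natr_sum; congr (_ %:R); rewrite /twice_odd_codivisors.
(* Part sizes above [k] give no term: [r] is odd, hence positive, so the product exceeds [k]. *)
rewrite -(subnKC hk) big_split_ord /= [X in (_ + X)%N]big1 ?addn0 // => i _.
rewrite big1 // => r /andP[hr /eqP e].
have r0 : (0 < r)%N by case: (val r) hr.
by have := leq_pmulr (k + i).+1 r0; rewrite e; lia.
Qed.

Lemma overpartition_rec n : (n * overpartition_count n =
  \sum_(k < n.+1) twice_odd_codivisors k * overpartition_count (n - k))%N.
Proof.
have h := eq_upto_deriv_prod (index_enum 'I_n) (fun i : 'I_n => @factor_log_deriv n i).
have {h} := h n (leqnn n); rewrite -/(overp_gf n).
rewrite coefXM mulrC coefM.
have -> : (if n == 0%N then 0 else (overp_gf n)^`()`_n.-1) = (n * overpartition_count n)%:R :> int.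
  case: (n) => [|m]; first by rewrite mul0n.
  by rewrite coef_deriv /= overp_gf_coef -mulrnA mulnC.
under eq_bigr => k _ .
  have hk : (k <= n)%N by rewrite -ltnS.
  rewrite log_factor_sum //.
  rewrite (@overp_gf_stable (n - k) n) // ?leq_subr // overp_gf_coef -natrM.
  over.
by rewrite -natr_sum => /eqP; rewrite eqr_nat => /eqP.
Qed.

Lemma overpartition_count_gt0 n : (0 < overpartition_count n)%N.
Proof.
case: n => [|n]; rewrite /overpartition_count; apply/card_gt0P.
  exists ([ffun _ => ord0], [ffun _ => false]); apply/asboolP; apply/andP; split; rewrite ?big_ord0 ?eqxx //=.
  by apply/forallP => -[].
(* A single part of size [n.+1], not overlined. *)
exists ([ffun i : 'I_n.+1 => if i == ord_max then inord 1 else ord0], [ffun _ => false]).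
apply/asboolP => /=; apply/andP; split; last by apply/forallP => i; rewrite ffunE.
rewrite (bigD1 ord_max) //= ffunE eqxx inordK // muln1 big1 ?addn0 // => i /negbTE e.
by rewrite ffunE e muln0.
Qed.

(** * Taylor bounds and the Lambert series of [c] *)

Lemma derive_nonneg_le (R : realType) (f df : R -> R) (t : R) : 0 <= t ->
  (forall x : R, 0 <= x <= t -> is_derive x 1 f (df x)) ->
  (forall x : R, 0 <= x <= t -> 0 <= df x) -> f 0 <= f t.
Proof.
move=> t0 hd hp.
have [||c hc e] := @MVT_segment R f df 0 t t0.
- by move=> x hx; apply: hd; move: hx; rewrite in_itv /= => /andP[/ltW -> /ltW ->].
- apply: derivable_within_continuous => x hx.
  by move: hx; rewrite in_itv /= => /hd [].
rewrite -subr_ge0 e subr0 mulr_ge0 // hp //.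
Qed.

Lemma div_factS_muln (R : realType) (a : R) i :
  a / (i.+1)`!%:R *+ i.+1 = a / i`!%:R.
Proof.
rewrite factS natrM invfM -(mulr_natr (a * _)) -!mulrA; congr (_ * _).
by rewrite mulrCA mulVf ?mulr1 ?pnatr_eq0.
Qed.

(** The family [f] lists successive derivatives. By induction the remainder of [f 1] is at most the
    derivative of [p = B x^(L+1) / (L+1)!], so [p] plus or minus the remainder of [f 0] has a
    nonnegative derivative and vanishes at 0. *)
Lemma taylor_bound_right (R : realType) (L : nat) (f : nat -> R -> R) (t B : R) :
  0 <= t ->
  (forall i (x : R), (i < L)%N -> 0 <= x <= t -> is_derive x 1 (f i) (f i.+1 x)) ->
  (forall x : R, 0 <= x <= t -> `|f L x| <= B) ->
  `|f 0%N t - \sum_(i < L) f i 0 / i`!%:R * t ^+ i| <= B * t ^+ L / L`!%:R.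
Proof.
move=> t0 hd hB.
suff H (s : R) : 0 <= s <= t ->
  `|f 0%N s - \sum_(i < L) f i 0 / i`!%:R * s ^+ i| <= B * s ^+ L / L`!%:R.
  by apply: H; rewrite t0 lexx.
elim: L f hd hB s => [|L IH] f hd hB s hs.
  by rewrite big_ord0 subr0 expr0 mulr1 divr1; apply: hB.
have /andP[s0 st] := hs.
pose q : {poly R} := \poly_(i < L.+1) (f i 0 / i`!%:R).
pose p : {poly R} := (B / L.+1`!%:R) *: 'X^(L.+1).
have qE x : \sum_(i < L.+1) f i 0 / i`!%:R * x ^+ i = q.[x] by rewrite horner_poly.
have fact0 n : (n`!%:R : R) != 0 by rewrite pnatr_eq0 -lt0n fact_gt0.
have q'E x : q^`().[x] = \sum_(i < L) f i.+1 0 / i`!%:R * x ^+ i.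
  have -> : q^`() = \poly_(i < L) (f i.+1 0 / i`!%:R).
    apply/polyP => i; rewrite coef_deriv !coef_poly ltnS.
    case: ltnP => _; last by rewrite mul0rn.
    exact: div_factS_muln.
  by rewrite horner_poly.
have p'E x : p^`().[x] = B * x ^+ L / L`!%:R.
 by rewrite derivZ derivXn !hornerE hornerMn hornerXn mulrnAr -mulrnAl div_factS_muln mulrAC.
have IH' (x : R) : 0 <= x <= t -> `|f 1%N x - q^`().[x]| <= p^`().[x].
  move=> hx; rewrite q'E p'E; apply: (IH (fun i => f i.+1)) => //.
  by move=> i y hi hy; apply: hd.
have q0 : q.[0] = f 0%N 0 by rewrite -qE big_ord_recl /= expr0 divr1 mulr1 big1 ?addr0 // => i _; rewrite expr0n mulr0.
have p0 : p.[0] = 0 by rewrite !hornerE expr0n mulr0.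
have -> : B * s ^+ L.+1 / L.+1`!%:R = p.[s] by rewrite !hornerE mulrAC.
rewrite qE ler_norml.
have hsub (x : R) : 0 <= x <= s -> 0 <= x <= t by move=> /andP[-> /le_trans]; apply.
have D0 (x : R) : 0 <= x <= s -> is_derive x 1 (f 0%N) (f 1%N x) by move=> hx; apply: hd => //; apply: hsub.
apply/andP; split.
- have := @derive_nonneg_le R (horner p \+ (f 0%N \- horner q)) (fun x => p^`().[x] + (f 1%N x - q^`().[x])) s s0.
  rewrite /= p0 q0 subrr addr0 => h; rewrite -subr_ge0 opprK addrC; apply: h.
  + by move=> x /D0 D; apply: is_deriveD.
  + by move=> x /hsub /IH'; rewrite ler_norml => /andP[h _]; rewrite -lerBlDl sub0r.
- have := @derive_nonneg_le R (horner p \- (f 0%N \- horner q)) (fun x => p^`().[x] - (f 1%N x - q^`().[x])) s s0.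
  rewrite /= p0 q0 subrr subr0 => h; rewrite -subr_ge0; apply: h.
  + by move=> x /D0 D; apply: is_deriveB.
  + by move=> x /hsub /IH'; rewrite ler_norml subr_ge0 => /andP[_ h].
Qed.

Lemma is_derive_affine (R : realType) (a e x : R) :
  is_derive x 1 (fun y => a + e * y) e.
Proof.
have h : is_derive x 1 (cst a + e *: (id : R -> R)) (0 + e *: (1 : R)).
  by apply: is_deriveD.
by apply: (@is_derive_eq _ _ _ _ _ _ _ _ h); rewrite add0r; exact: mulr1.
Qed.

Lemma taylor_bound (R : realType) (L : nat) (f : nat -> R -> R) (a x B : R) :
  (forall i (y : R), (i < L)%N -> `|y - a| <= `|x| -> is_derive y 1 (f i) (f i.+1 y)) ->
  (forall y : R, `|y - a| <= `|x| -> `|f L y| <= B) ->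
  `|f 0%N (a + x) - \sum_(i < L) f i a / i`!%:R * x ^+ i| <= B * `|x| ^+ L / L`!%:R.
Proof.
move=> hd hB.
(* A negative increment is followed in the direction [e]; the derivative of order [i] then carries
   [e ^+ i]. *)
pose e : R := if 0 <= x then 1 else -1.
have ex : e * `|x| = x.
  by rewrite /e; case: ger0P => // _; rewrite ?mul1r ?mulN1r ?opprK.
have e1 : `|e| = 1 by rewrite /e; case: ifP => _; rewrite ?normrN normr1.
have := @taylor_bound_right R L (fun i s => e ^+ i * f i (a + e * s)) `|x| B (normr_ge0 _).
rewrite /= ex mulr0 addr0 expr0 mul1r.
have inr (s : R) : 0 <= s <= `|x| -> `|a + e * s - a| <= `|x|.
  by move=> /andP[s0 sx]; rewrite addrAC subrr add0r normrM e1 mul1r ger0_norm.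
under eq_bigr => i _.
  rewrite (_ : _ * _ = f i a / i`!%:R * x ^+ i); last by rewrite -[in RHS]ex exprMn; ring.
  over.
apply.
- move=> i s hi /inr hs.
  have D := hd i _ hi hs.
  rewrite exprSr -mulrA; apply: is_deriveZ.
  rewrite mulrC; apply: is_derive1_comp.
  exact: is_derive_affine.
- by move=> s /inr hs; rewrite normrM normrX e1 expr1n mul1r; apply: hB.
Qed.

(** * The midpoint rule for the derivative of the logistic function *)

Section Logistic.
Variable R : realType.
Implicit Types (x z : R) (k K L N : nat).

Definition logistic x : R := (1 + expR (- x))^-1.

(** Equal to [1 / (4 cosh^2 (x / 2))], see [dlogisticE]. *)
Definition dlogistic x : R := logistic x * (1 - logistic x).

Lemma one_plus_exp_gt0 x : 0 < 1 + expR x.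
Proof. by rewrite addr_gt0 // expR_gt0. Qed.

Lemma logistic_gt0 x : 0 < logistic x.
Proof. by rewrite invr_gt0 one_plus_exp_gt0. Qed.

Lemma logisticN x : logistic (- x) = 1 - logistic x.
Proof.
rewrite /logistic opprK expRN.
have h := one_plus_exp_gt0 x; have e := expR_gt0 x.
by field; rewrite !gt_eqF //= addrC.
Qed.

Lemma logistic_lt1 x : logistic x < 1.
Proof. by rewrite -subr_gt0 -logisticN logistic_gt0. Qed.

Lemma dlogisticN x : dlogistic (- x) = dlogistic x.
Proof. by rewrite /dlogistic logisticN; ring. Qed.

Lemma dlogistic_gt0 x : 0 < dlogistic x.
Proof. by rewrite mulr_gt0 ?logistic_gt0 // subr_gt0 logistic_lt1. Qed.

Lemma dlogistic_ge0 x : 0 <= dlogistic x.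
Proof. exact/ltW/dlogistic_gt0. Qed.

Lemma dlogisticE x : dlogistic x = (2 + expR x + expR (- x))^-1.
Proof.
rewrite /dlogistic /logistic expRN.
have h := one_plus_exp_gt0 x; have e := expR_gt0 x.
have h2 : 0 < 2 + expR x + (expR x)^-1 by rewrite !addr_gt0 ?invr_gt0.
by field; apply/and3P; split; rewrite gt_eqF // ?addr_gt0 ?mulr_gt0 ?addr_gt0.
Qed.

Lemma logistic_compl_le x : 1 - logistic x <= expR (- x).
Proof.
rewrite -logisticN /logistic opprK expRN lef_pV2 ?posrE ?expR_gt0 ?one_plus_exp_gt0 //.
by rewrite lerDr.
Qed.

Lemma dlogistic_le x : dlogistic x <= expR (- x).
Proof.
apply: le_trans (logistic_compl_le x); rewrite ler_piMl ?ltW ?logistic_lt1 //.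
by rewrite subr_gt0 logistic_lt1.
Qed.

(** A Harnack inequality: on a cell of bounded width all values are comparable with the one at the
    midpoint, so errors made on cells can be summed against a Riemann sum. *)
Lemma dlogistic_shift x y : dlogistic y <= expR `|y - x| * dlogistic x.
Proof.
rewrite !dlogisticE.
have p t : 0 < 2 + expR t + expR (- t) by rewrite !addr_gt0 ?expR_gt0.
rewrite ler_pdivlMr // mulrC ler_pdivrMr // mulrC.
have h1 : 1 <= expR `|y - x| by rewrite -expR0 ler_expR.
have h2 : expR x <= expR `|y - x| * expR y.
  by rewrite -expRD ler_expR -lerBlDr -normrN opprB ler_norm.
have h3 : expR (- x) <= expR `|y - x| * expR (- y).
  by rewrite -expRD ler_expR -lerBlDr opprK addrC ler_norm.
rewrite [X in _ <= X]mulrC !mulrDr; apply: lerD => //; apply: lerD => //; lra.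
Qed.

(** Since [s' = s - s^2] for the logistic function [s], each derivative is a polynomial in [s]. *)
Fixpoint logistic_poly k : {poly R} :=
  if k is k'.+1 then (logistic_poly k')^`() * ('X - 'X^2) else 'X.

Definition logistic_deriv k x : R := (logistic_poly k).[logistic x].

Lemma logistic_deriv0 x : logistic_deriv 0 x = logistic x.
Proof. by rewrite /logistic_deriv hornerX. Qed.

Lemma logistic_deriv1 x : logistic_deriv 1 x = dlogistic x.
Proof. by rewrite /logistic_deriv /= derivX !hornerE /dlogistic; ring. Qed.

Lemma is_derive_logistic x : is_derive x 1 logistic (dlogistic x).
Proof.
have h : is_derive x 1 (fun y => 1 + expR (- y)) (- expR (- x)).
  have h0 : is_derive x 1 (expR \o -%R) (expR (- x) * -1) by apply: is_derive1_comp.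
  have h1 : is_derive x 1 (cst 1 + (expR \o -%R)) (0 + (expR (- x) * -1)).
    by apply: is_deriveD.
  by apply: (is_derive_eq h1); ring.
have n0 : 1 + expR (- x) != 0 by rewrite gt_eqF ?one_plus_exp_gt0.
have h3 := @is_deriveV R (fun y => 1 + expR (- y)) x _ 1 n0 h.
apply: (@is_derive_eq _ _ _ logistic x 1 _ _ h3).
rewrite /dlogistic /logistic [_ *: _]mulrN mulNr opprK.
by field.
Qed.

Lemma is_derive_logistic_deriv k x :
  is_derive x 1 (logistic_deriv k) (logistic_deriv k.+1 x).
Proof.
have -> : logistic_deriv k.+1 x = (logistic_poly k)^`().[logistic x] * dlogistic x.
  rewrite /logistic_deriv /= hornerM; congr (_ * _).
  by rewrite !hornerE /dlogistic; ring.
have := is_derive_logistic x.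
by apply: (@is_derive1_comp _ (horner (logistic_poly k))).
Qed.

Lemma horner_bound (p : {poly R}) :
  exists2 C, 0 <= C & forall s, 0 <= s <= 1 -> `|p.[s]| <= C.
Proof.
exists (\sum_(i < size p) `|p`_i|); first exact: sumr_ge0.
move=> s /andP[s0 s1]; rewrite horner_coef; apply: le_trans (ler_norm_sum _ _ _) _.
apply: ler_sum => i _; rewrite normrM normrX ler_piMr //.
by rewrite exprn_ile1 // ger0_norm.
Qed.

(** From order one on, the polynomial has the factor [X - X^2], whose value at [logistic x] is
    [dlogistic x]. *)
Lemma logistic_deriv_bound k :
  exists2 C, 0 <= C & forall x, `|logistic_deriv k.+1 x| <= C * dlogistic x.
Proof.
have [C C0 hC] := horner_bound (logistic_poly k)^`().
exists C => // x; rewrite /logistic_deriv /= hornerM normrM.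
have -> : ('X - 'X^2).[logistic x] = dlogistic x.
  by rewrite !hornerE /dlogistic; ring.
rewrite (ger0_norm (ltW (dlogistic_gt0 x))) ler_pM2r ?dlogistic_gt0 //.
by apply: hC; rewrite !ltW ?logistic_gt0 ?logistic_lt1.
Qed.

(** Midpoints of the [2 N] cells of width [2 z] that tile [[-2 N z, 2 N z]]. *)
Definition midpoint z N (i : nat) : R := (2 * i%:R + 1 - 2 * N%:R) * z.

Definition midpoint_sum k z N : R :=
  2 * z * \sum_(i < 2 * N) logistic_deriv k.+1 (midpoint z N i).

(** The exact integral that [midpoint_sum k] approximates. *)
Definition boundary k z N : R :=
  logistic_deriv k (2 * N%:R * z) - logistic_deriv k (- (2 * N%:R * z)).

Lemma boundaryE k z N : boundary k z N =
  \sum_(i < 2 * N) (logistic_deriv k (midpoint z N i + z) - logistic_deriv k (midpoint z N i - z)).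
Proof.
pose g (i : nat) := logistic_deriv k ((2 * i%:R - 2 * N%:R) * z).
transitivity (\sum_(0 <= i < 2 * N) (g i.+1 - g i)).
  rewrite telescope_sumr // /g /boundary natrM mulr0 sub0r mulNr; congr (_ - _).
  by congr logistic_deriv; ring.
rewrite big_mkord; apply: eq_bigr => i _; rewrite /g /midpoint -natr1.
by congr (_ - _); congr logistic_deriv; ring.
Qed.

Lemma boundary_bound k :
  exists2 C, 0 <= C & forall z N, 0 < z ->
     `|boundary k.+1 z N| <= C * expR (- (2 * N%:R * z)).
Proof.
have [C C0 hC] := logistic_deriv_bound k.
exists (2 * C); first by rewrite mulr_ge0.
move=> z N z0; rewrite /boundary; apply: le_trans (ler_normB _ _) _.
set E := expR _; have -> : 2 * C * E = C * E + C * E by ring.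
apply: lerD; rewrite {}/E.
  by apply: le_trans (hC _) _; apply: ler_wpM2l => //; apply: dlogistic_le.
apply: le_trans (hC _) _; rewrite dlogisticN; apply: ler_wpM2l => //.
exact: dlogistic_le.
Qed.

(** By the mean value theorem and [dlogistic_shift], each midpoint term is at most [e] times the
    increment of the logistic function on its cell; the increments add up to less than 1. *)
Lemma midpoint_sum0_bound z N : 0 < z <= 1 -> midpoint_sum 0 z N <= expR 1.
Proof.
move=> /andP[z0 z1].
suff : midpoint_sum 0 z N <= expR 1 * boundary 0 z N.
  move=> /le_trans; apply; rewrite ler_piMr ?expR_ge0 // /boundary !logistic_deriv0.
  by rewrite lerBlDr (le_trans (ltW (logistic_lt1 _))) // lerDl ltW // logistic_gt0.
rewrite boundaryE /midpoint_sum !big_distrr /=; apply: ler_sum => i _.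
set c := midpoint z N i.
have hlt : c - z < c + z by lra.
have [] := @MVT R (logistic_deriv 0) (logistic_deriv 1) (c - z) (c + z) hlt.
- by move=> x _; apply: is_derive_logistic_deriv.
- apply: derivable_within_continuous => x _.
  by have [] := is_derive_logistic_deriv 0 x.
move=> xi; rewrite in_itv /= => /andP[x1 x2] ->; rewrite !logistic_deriv1.
have -> : c + z - (c - z) = 2 * z by ring.
rewrite mulrA [X in _ <= X]mulrC ler_pM2l ?mulr_gt0 //.
apply: le_trans (dlogistic_shift xi c) _.
rewrite ler_pM2r ?dlogistic_gt0 // ler_expR ler_norml; lra.
Qed.

Lemma midpoint_sum_bound k :
  exists2 C, 0 <= C & forall z N, 0 < z <= 1 -> `|midpoint_sum k z N| <= C.
Proof.
have [C C0 hC] := logistic_deriv_bound k.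
exists (C * expR 1); first by rewrite mulr_ge0 ?expR_ge0.
move=> z N hz; have /andP[z0 z1] := hz.
apply: le_trans (ler_wpM2l C0 (midpoint_sum0_bound N hz)).
rewrite /midpoint_sum normrM ger0_norm; last lra; rewrite mulrCA.
rewrite ler_pM2l ?mulr_gt0 // big_distrr /=.
apply: le_trans (ler_norm_sum _ _ _) _; apply: ler_sum => i _.
by rewrite logistic_deriv1.
Qed.

(** Both ends of each cell are expanded about its midpoint, so even orders cancel. The remainder on
    a cell is [O(z^(L+2))] times [dlogistic] at the midpoint; the sum over the cells costs one
    factor [z], by [midpoint_sum0_bound]. *)
Lemma midpoint_taylor k L :
  exists2 C, 0 <= C & forall z N, 0 < z <= 1 ->
   `|boundary k z N - \sum_(l < L.+2)
      (z ^+ l - (- z) ^+ l) / l`!%:R * \sum_(i < 2 * N) logistic_deriv (k + l) (midpoint z N i)|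
   <= C * z ^+ L.+1.
Proof.
have [C C0 hC] := logistic_deriv_bound (k + L.+1).
exists (C * expR 1 * expR 1); first by rewrite !mulr_ge0 ?expR_ge0.
move=> z N hz; have /andP[z0 z1] := hz.
have -> : \sum_(l < L.+2) (z ^+ l - (- z) ^+ l) / l`!%:R *
     (\sum_(i < 2 * N) logistic_deriv (k + l) (midpoint z N i)) =
  \sum_(i < 2 * N) \sum_(l < L.+2)
    logistic_deriv (k + l) (midpoint z N i) / l`!%:R * (z ^+ l - (- z) ^+ l).
  rewrite exchange_big /=; apply: eq_bigr => l _; rewrite big_distrr /=.
  by apply: eq_bigr => i _; ring.
rewrite boundaryE -sumrB.
apply: le_trans (ler_norm_sum _ _ _) _.
have bnd i : `|logistic_deriv k (midpoint z N i + z) - logistic_deriv k (midpoint z N i - z) -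
    \sum_(l < L.+2) logistic_deriv (k + l) (midpoint z N i) / l`!%:R * (z ^+ l - (- z) ^+ l)|
   <= 2 * z * dlogistic (midpoint z N i) * (C * expR 1 * z ^+ L.+1).
  set c := midpoint z N i.
  have T s : `|s| = z -> `|logistic_deriv k (c + s) -
     \sum_(l < L.+2) logistic_deriv (k + l) c / l`!%:R * s ^+ l| <=
     C * (expR 1 * dlogistic c) * z ^+ L.+2.
    move=> hs.
    have := @taylor_bound R L.+2 (fun l => logistic_deriv (k + l)) c s
         (C * (expR 1 * dlogistic c)).
    rewrite /= addn0 hs => h; apply: le_trans (h _ _) _.
    - by move=> l y _ _; rewrite addnS; apply: is_derive_logistic_deriv.
    - move=> y hy; rewrite addnS; apply: le_trans (hC _) _; apply: ler_wpM2l => //.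
      apply: le_trans (dlogistic_shift c y) _; rewrite (ler_wpM2r (ltW (dlogistic_gt0 c))) //.
      by rewrite ler_expR (le_trans hy).
    - rewrite ler_pdivrMr ?ltr0n ?fact_gt0 // ler_peMr //.
        apply: mulr_ge0; last exact/exprn_ge0/ltW.
        by apply: mulr_ge0 => //; apply: mulr_ge0; [exact: expR_ge0|exact: dlogistic_ge0].
      by rewrite ler1n fact_gt0.
  have -> : \sum_(l < L.+2) logistic_deriv (k + l) c / l`!%:R * (z ^+ l - (- z) ^+ l) =
     \sum_(l < L.+2) logistic_deriv (k + l) c / l`!%:R * z ^+ l -
     \sum_(l < L.+2) logistic_deriv (k + l) c / l`!%:R * (- z) ^+ l.
    by rewrite -sumrB; apply: eq_bigr => l _; rewrite mulrBr.
  have T1 := T z (ger0_norm (ltW z0)).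
  have T2 := T (- z) (etrans (normrN z) (ger0_norm (ltW z0))).
  have -> : 2 * z * dlogistic c * (C * expR 1 * z ^+ L.+1) =
    C * (expR 1 * dlogistic c) * z ^+ L.+2 + C * (expR 1 * dlogistic c) * z ^+ L.+2.
    by rewrite [z ^+ L.+2]exprS; ring.
  apply: le_trans (lerD T1 T2).
  by apply: le_trans (ler_normB _ _); rewrite le_eqVlt; apply/orP; left; apply/eqP; congr `|_|; ring.
apply: le_trans; first by apply: ler_sum => i _; exact: bnd.
rewrite -big_distrl /= -big_distrr /=.
have -> : 2 * z * (\sum_(i < 2 * N) dlogistic (midpoint z N i)) = midpoint_sum 0 z N.
  by rewrite /midpoint_sum; congr (_ * _); apply: eq_bigr => i _; rewrite logistic_deriv1.
rewrite mulrC [X in _ <= X]mulrAC; apply: ler_wpM2l; last exact: midpoint_sum0_bound.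
by rewrite !mulr_ge0 ?expR_ge0 ?exprn_ge0 // ltW.
Qed.

End Logistic.

Lemma sum_bound (R : realType) (T : Type) (D : T -> Prop) (f : nat -> T -> R)
    (g : T -> R) n :
  (forall l, (l < n)%N ->
     exists2 C : R, 0 <= C & forall t, D t -> `|f l t| <= C * g t) ->
  exists2 C : R, 0 <= C & forall t, D t -> `|\sum_(l < n) f l t| <= C * g t.
Proof.
elim: n => [|n IH] h.
  by exists 0 => // t _; rewrite big_ord0 normr0 mul0r.
have [C C0 hC] := IH (fun l hl => h l (leqW hl)).
have [C' C'0 hC'] := h n (leqnn _).
exists (C + C'); first exact: addr_ge0.
move=> t Dt; rewrite big_ord_recr /= mulrDl; apply: le_trans (ler_normD _ _) _.
by apply: lerD; [exact: hC | exact: hC'].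
Qed.

Section Midpoint.
Variable R : realType.
Implicit Types (x z : R) (k K L N : nat).

(** Euler-Maclaurin without its coefficients. In [midpoint_taylor] the order [l = 1] is the midpoint
    sum itself; an order [l >= 3] is [O(z^2)] times the midpoint sum of a higher derivative, which
    by induction is close to a boundary term of positive order, and these are exponentially
    small. *)
Lemma midpoint_sum_boundary K k :
  exists2 C : R, 0 <= C & forall z N, 0 < z <= 1 ->
     `|midpoint_sum k z N - boundary k z N| <= C * (z ^+ K + expR (- (2 * N%:R * z))).
Proof.
have bnd k' : exists2 C : R, 0 <= C & forall z N, 0 < z <= 1 -> `|boundary k' z N| <= C.
  case: k' => [|k'].
    exists 1 => // z N _; rewrite /boundary !logistic_deriv0.
    have h1 := logistic_gt0 (2 * N%:R * z); have h2 := logistic_lt1 (2 * N%:R * z).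
    have h3 := logistic_gt0 (- (2 * N%:R * z)); have h4 := logistic_lt1 (- (2 * N%:R * z)).
    rewrite ler_norml; lra.
  have [C C0 hC] := boundary_bound R k'; exists C => // z N /andP[z0 _].
  apply: le_trans (hC z N z0) _; rewrite ler_piMr // -expR0 ler_expR oppr_le0.
  by rewrite !mulr_ge0 // ltW.
elim: K k => [|K IH] k.
  have [C C0 hC] := midpoint_sum_bound R k; have [C' C'0 hC'] := bnd k.
  exists (C + C'); first exact: addr_ge0.
  move=> z N hz; apply: le_trans (ler_normB _ _) _; apply: le_trans (lerD (hC z N hz) (hC' z N hz)) _.
  by rewrite expr0 ler_peMr ?addr_ge0 // lerDl expR_ge0.
have [C C0 hC] := midpoint_taylor R k K.
(* Orders 0 and 1 are taken out of the error: the former cancels, the latter is the midpoint sum. *)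
pose term (l : nat) (t : R * nat) : R :=
  if (l < 2)%N then 0 else
  (t.1 ^+ l - (- t.1) ^+ l) / l`!%:R * \sum_(i < 2 * t.2) logistic_deriv (k + l) (midpoint t.1 t.2 i).
have [] := @sum_bound R (R * nat) (fun t => 0 < t.1 <= 1) term
   (fun t => t.1 ^+ K.+1 + expR (- (2 * t.2%:R * t.1))) K.+2.
  move=> l _; rewrite /term; case: ltnP => hl.
    by exists 0 => // t _; rewrite normr0 mul0r.
  move: hl; rewrite leq_eqVlt => /predU1P[<-|hl].
    by exists 0 => // t _; rewrite sqrrN subrr !mul0r normr0.
  have [C1 C10 h1] := IH (k + l.-1)%N.
  have [C2 C20 h2] := boundary_bound R (k + l.-2)%N.
  exists (C1 + C2); first exact: addr_ge0.
  move=> [z N] /= hz; have /andP[z0 z1] := hz.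
  set e := expR _; have e0 : 0 <= e by rewrite expR_ge0.
  have lE : (k + l = (k + l.-1).+1)%N by lia.
  have l2E : (k + l.-1 = (k + l.-2).+1)%N by lia.
  have zl : `|z ^+ l - (- z) ^+ l| <= 2 * z * z ^+ 2.
    apply: le_trans (ler_normB _ _) _; rewrite !normrX normrN (ger0_norm (ltW z0)).
    have -> : 2 * z * z ^+ 2 = z ^+ 3 + z ^+ 3 by rewrite [z ^+ 3]exprS; ring.
    by apply: lerD; apply: ler_wiXn2l => //; exact: ltW.
  have hM : 2 * z * `|\sum_(i < 2 * N) logistic_deriv (k + l) (midpoint z N i)| <= C1 * (z ^+ K + e) + C2 * e.
    have -> : 2 * z * `|\sum_(i < 2 * N) logistic_deriv (k + l) (midpoint z N i)| =
       `|midpoint_sum (k + l.-1) z N|.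
      rewrite /midpoint_sum normrM (ger0_norm (_ : 0 <= 2 * z)); last lra.
      by rewrite lE.
    rewrite -[midpoint_sum _ _ _](subrK (boundary (k + l.-1) z N)).
    apply: le_trans (ler_normD _ _) _; apply: lerD; first exact: h1.
    by rewrite l2E; apply: h2.
  rewrite !normrM.
  have f1 : `|(l`!%:R)^-1| <= 1 :> R.
    by rewrite ger0_norm ?invr_ge0 // invf_le1 ?ler1n ?ltr0n fact_gt0.
  apply: le_trans (_ : z ^+ 2 * (C1 * (z ^+ K + e) + C2 * e) <= _).
    apply: le_trans (ler_wpM2l (exprn_ge0 2 (ltW z0)) hM).
    rewrite mulrA; apply: ler_wpM2r => //.
    rewrite -[X in _ <= X]mulr1 [z ^+ 2 * _]mulrC; apply: ler_pM => //.
  have z2 : z ^+ 2 <= z by rewrite expr2 ler_piMl // ltW.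
  have z21 : z ^+ 2 <= 1 by apply: le_trans z2 z1.
  have zz : 0 <= z ^+ 2 by rewrite exprn_ge0 // ltW.
  have zK : 0 <= z ^+ K by rewrite exprn_ge0 // ltW.
  have i1 : z ^+ 2 * z ^+ K <= z ^+ K.+1 by rewrite [X in _ <= X]exprS ler_wpM2r.
  have i2 : z ^+ 2 * e <= e by rewrite ler_piMl.
  have i3 : 0 <= z ^+ K.+1 by rewrite exprn_ge0 // ltW.
  have -> : z ^+ 2 * (C1 * (z ^+ K + e) + C2 * e) =
     C1 * (z ^+ 2 * z ^+ K + z ^+ 2 * e) + C2 * (z ^+ 2 * e) by ring.
  rewrite mulrDl; apply: lerD; apply: ler_wpM2l => //; first exact: lerD.
  by apply: le_trans i2 _; rewrite lerDr.
move=> C' C'0 hC'; exists (C + C'); first exact: addr_ge0.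
move=> z N hz; have := hC z N hz; have := hC' (z, N) hz => /=.
set e := expR _; have e0 : 0 <= e by rewrite expR_ge0.
have /andP[z0 z1] := hz.
have -> : \sum_(l < K.+2) term l (z, N) =
  \sum_(l < K.+2) (z ^+ l - (- z) ^+ l) / l`!%:R * (\sum_(i < 2 * N) logistic_deriv (k + l) (midpoint z N i))
   - midpoint_sum k z N.
  apply/eqP; rewrite eq_sym subr_eq addrC -subr_eq -sumrB; apply/eqP.
  rewrite (bigD1 (Ordinal (isT : 1 < K.+2)%N)) //= [X in _ + X = _]big1 ?addr0.
    rewrite /term /= subr0 !expr1 opprK divr1 /midpoint_sum addn1 /=.
    by congr (_ * _); ring.
  move=> [[|[|l]] hl] // _; rewrite /term /=; last by rewrite subrr.
  by rewrite subrr !mul0r subrr.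
set A := \sum_(l < K.+2) _; set M := midpoint_sum _ _ _; set B := boundary _ _ _.
move=> hA hB; have -> : M - B = - ((A - M) + (B - A)) by ring.
rewrite normrN; apply: le_trans (ler_normD _ _) _.
rewrite mulrDl addrC; apply: lerD => //; apply: le_trans hB _.
by rewrite ler_wpM2l // lerDl.
Qed.

(** By evenness the positive midpoints carry half of the sum, and the logistic function increases by
    1 over the whole line. *)
Lemma midpoint_logistic K :
  exists2 C : R, 0 <= C & forall z N, 0 < z <= 1 ->
    `|4 * z * (\sum_(j < N) dlogistic ((2 * j%:R + 1) * z)) - 1|
      <= C * (z ^+ K + expR (- (2 * N%:R * z))).
Proof.
have [C C0 hC] := midpoint_sum_boundary K 0.
exists (C + 2); first exact: addr_ge0.
move=> z N hz; have /andP[z0 z1] := hz; have := hC z N hz.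
set e := expR _; have e0 : 0 <= e by rewrite expR_ge0.
have -> : midpoint_sum 0 z N = 4 * z * (\sum_(j < N) dlogistic ((2 * j%:R + 1) * z)).
  rewrite /midpoint_sum mul2n -addnn big_split_ord /=.
  have -> : \sum_(i < N) logistic_deriv 1 (midpoint z N i) =
     \sum_(i < N) dlogistic ((2 * i%:R + 1) * z).
    rewrite (reindex_inj rev_ord_inj) /=; apply: eq_bigr => i _.
    rewrite logistic_deriv1 -dlogisticN; congr dlogistic.
    by rewrite /midpoint natrB ?ltn_ord // -natr1; ring.
  have -> : \sum_(i < N) logistic_deriv 1 (midpoint z N (N + i)) =
     \sum_(i < N) dlogistic ((2 * i%:R + 1) * z).
    apply: eq_bigr => i _; rewrite logistic_deriv1; congr dlogistic.
    by rewrite /midpoint natrD; ring.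
  by ring.
have : `|boundary 0 z N - 1| <= 2 * e.
  rewrite /boundary !logistic_deriv0 logisticN.
  have h1 := logistic_compl_le (2 * N%:R * z); have h2 := logistic_lt1 (2 * N%:R * z).
  rewrite -/e in h1; rewrite ler_norml; lra.
set B := boundary _ _ _; set A := 4 * z * _; move=> h1 h2.
have -> : A - 1 = (A - B) + (B - 1) by ring.
apply: le_trans (ler_normD _ _) _; rewrite mulrDl; apply: lerD => //.
apply: le_trans h1 _; rewrite ler_wpM2l // lerDr exprn_ge0 // ltW //.
Qed.

End Midpoint.

(** * The sum of the inverse squares of the odd numbers *)

Section OddBasel.
Variable R : realType.
Implicit Types (x z : R) (n N : nat).

Lemma sin_le x : 0 <= x -> sin x <= x.
Proof.
move=> x0.
have := @derive_nonneg_le R (id \- sin) (fun t => 1 - cos t) x x0.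
rewrite /= sin0 subrr subr_ge0; apply.
- by move=> t _; rewrite subr_ge0 cos_le1.
Qed.

Lemma mulr_cos_le_sin x : 0 <= x <= pi / 2 -> x * cos x <= sin x.
Proof.
move=> /andP[x0 xpi].
have := @derive_nonneg_le R (fun t => sin t - t * cos t) (fun t => t * sin t) x x0.
rewrite /= sin0 mul0r subr0 subr_ge0; apply.
- move=> t _; apply: is_derive_eq; rewrite /GRing.scale /=; ring.
- move=> t /andP[t0 tx]; apply: mulr_ge0 => //; apply: sin_ge0_pi.
  rewrite t0 (le_trans tx) // (le_trans xpi) // ler_pdivrMr // ler_peMr ?pi_ge0 //.
  by rewrite ler1n.
Qed.

(* Repeated halving of the angle in [csc2_double] turns [1 / sin^2 (pi / 4) = 2]
   into a finite sum that brackets [sum 1 / (2k + 1)^2] (Hofbauer). *)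
Definition csc2 x : R := (sin x ^+ 2)^-1.

Lemma csc2_double x : 0 < x < pi / 2 ->
  4 * csc2 (2 * x) = csc2 x + csc2 (pi / 2 - x).
Proof.
move=> /andP[x0 xpi].
have s0 : 0 < sin x by rewrite sin_gt0_pihalf // x0.
have c0 : 0 < cos x.
  by rewrite cos_gt0_pihalf // xpi andbT (lt_trans _ x0) // oppr_lt0 divr_gt0 ?pi_gt0.
rewrite /csc2 (mulr_natl x 2) sin_mulr2n.
have -> : sin (pi / 2 - x) = cos x by rewrite sinB sin_pihalf cos_pihalf mul1r mul0r subr0.
have s2 := cos2Dsin2 x.
have -> : 4 * ((cos x * sin x *+ 2) ^+ 2)^-1 = (cos x ^+ 2 + sin x ^+ 2) * (cos x ^+ 2 * sin x ^+ 2)^-1.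
  rewrite s2 -mulr_natr; field.
  by rewrite !gt_eqF.
by field; rewrite !gt_eqF.
Qed.

Definition csc2_angle n (k : nat) : R := (2 * k%:R + 1) * (pi / 2 ^+ n.+2).

Lemma csc2_angle_bounds n k : (k < 2 ^ n)%N -> 0 < csc2_angle n k < pi / 2.
Proof.
move=> hk; have p0 := pi_gt0 R.
have q0 : (0 : R) < 2 ^+ n.+2 by rewrite exprn_gt0.
apply/andP; split; first by rewrite mulr_gt0 ?divr_gt0 // ltr_wpDl // mulr_ge0.
have -> : pi / 2 = (2 * (2 ^ n)%:R) * (pi / 2 ^+ n.+2) :> R.
  by rewrite natrX !exprS; field; rewrite gt_eqF // exprn_gt0.
rewrite ltr_pM2r ?divr_gt0 //.
have : (k%:R + 1 : R) <= (2 ^ n)%:R by rewrite natr1 ler_nat.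
lra.
Qed.

(** By [csc2_double] an angle of level [n] splits into its half [x] and [pi / 2 - x], two angles of
    level [n.+1], with indices [k] and [2^(n+1) - k - 1]. *)
Lemma sum_csc2 n : \sum_(k < 2 ^ n) csc2 (csc2_angle n k) = 2 * 4 ^+ n.
Proof.
elim: n => [|n IH].
  rewrite expn0 big_ord_recl big_ord0 /csc2_angle /csc2 addr0 mulr0 add0r mul1r expr0 mulr1.
  have h := @csc2_double (pi / 4).
  have p0 := pi_gt0 R.
  have := h; rewrite (_ : 2 * (pi / 4) = pi / 2); last by field.
  rewrite (_ : pi / 2 - pi / 4 = pi / 4); last by field.
  rewrite /csc2 sin_pihalf expr1n invr1 mulr1 (_ : 2 ^+ 2 = 4); last by ring.
  have hp : 0 < (pi / 4 : R) < pi / 2 by apply/andP; split; lra.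
  by move=> /(_ hp); lra.
rewrite exprS mulrCA -IH big_distrr /=.
rewrite expnS mul2n -addnn big_split_ord /=.
rewrite [X in _ + X](reindex_inj rev_ord_inj) /= -big_split /=.
apply: eq_bigr => k _.
have hk : (k < 2 ^ n.+1)%N by apply: leq_trans (ltn_ord k) _; rewrite leq_exp2l.
have := @csc2_double (csc2_angle n.+1 k) (csc2_angle_bounds hk).
have q0 m : (2 : R) ^+ m != 0 by rewrite gt_eqF // exprn_gt0.
rewrite (_ : 2 * csc2_angle n.+1 k = csc2_angle n k); last first.
  by rewrite /csc2_angle !exprS; field; exact: q0.
move=> ->; congr (_ + csc2 _).
have -> : (2 ^ n + (2 ^ n - k.+1) = 2 ^ n.+1 - k.+1)%N.
  by rewrite addnBA // addnn -mul2n -expnS.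
rewrite /csc2_angle natrB // natrX -natr1 !exprS; field.
exact: q0.
Qed.

Definition odd_basel N : R := \sum_(k < N) ((2 * k%:R + 1) ^+ 2)^-1.

(** On [(0, pi / 2)] the numbers [1 / x^2] and [1 / sin^2 x] differ by at most 1; summed over [2^n]
    angles and rescaled by [t^2], this is the error [pi^2 / (16 * 2^n)]. *)
Lemma odd_basel_pow2 n : pi ^+ 2 / 8 - pi ^+ 2 / (16 * 2 ^+ n) <= odd_basel (2 ^ n) <= pi ^+ 2 / 8.
Proof.
have p0 := pi_gt0 R.
have q0 m : 0 < (2 : R) ^+ m by rewrite exprn_gt0.
pose t : R := pi / 2 ^+ n.+2.
have t0 : 0 < t by rewrite divr_gt0.
have bE : odd_basel (2 ^ n) = t ^+ 2 * \sum_(k < 2 ^ n) (csc2_angle n k ^+ 2)^-1.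
  rewrite /odd_basel big_distrr /=; apply: eq_bigr => k _.
  rewrite /csc2_angle -/t; field; apply/andP; split; rewrite gt_eqF //.
have tE : t ^+ 2 * (2 * 4 ^+ n) = pi ^+ 2 / 8.
  rewrite /t (_ : 4 = 2 ^+ 2); last by ring.
  by rewrite -exprM mulnC exprM !exprS; field; rewrite gt_eqF.
have tE2 : t ^+ 2 * (2 ^ n)%:R = pi ^+ 2 / (16 * 2 ^+ n).
  by rewrite /t natrX !exprS; field; rewrite gt_eqF.
have s0 k : (k < 2 ^ n)%N -> 0 < sin (csc2_angle n k).
  by move=> hk; rewrite sin_gt0_pihalf // csc2_angle_bounds.
have a0 k : (k < 2 ^ n)%N -> 0 < csc2_angle n k.
  by move=> /csc2_angle_bounds /andP[].
apply/andP; split.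
  rewrite lerBlDr -tE -tE2 bE -mulrDr ler_pM2l ?exprn_gt0 // -sum_csc2.
  rewrite -[X in _ + X%:R]card_ord -sum1_card natr_sum -big_split /=.
  apply: ler_sum => k _; have sk := s0 k (ltn_ord k); have ak := a0 k (ltn_ord k).
  have /andP[_ ah] := csc2_angle_bounds (ltn_ord k).
  have h := mulr_cos_le_sin (_ : 0 <= csc2_angle n k <= pi / 2).
  have {}h : csc2_angle n k * cos (csc2_angle n k) <= sin (csc2_angle n k).
    by apply: h; rewrite !ltW.
  have c0 : 0 < cos (csc2_angle n k).
    by rewrite cos_gt0_pihalf // ah andbT (lt_trans _ ak) // oppr_lt0 divr_gt0.
  move: sk ak h c0; rewrite /csc2; move: (csc2_angle n k) => x sk ak h c0.
  have -> : (x ^+ 2)^-1 + 1%:R = (1 + x ^+ 2) / x ^+ 2 :> R by field; rewrite gt_eqF.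
  rewrite ler_pdivlMr ?exprn_gt0 // mulrC ler_pdivrMr ?exprn_gt0 //.
  have e := cos2Dsin2 x.
  (* The square of [x cos x <= sin x] reads [x^2 <= (1 + x^2) sin^2 x], that is
     [1 / sin^2 x <= 1 + 1 / x^2]. *)
  have h1 : (x * cos x) ^+ 2 <= sin x ^+ 2.
    by apply: lerXn2r; rewrite ?nnegrE ?mulr_ge0 // ltW.
  have -> : (1 + x ^+ 2) * sin x ^+ 2 = sin x ^+ 2 + x ^+ 2 - x ^+ 2 * (1 - sin x ^+ 2) by ring.
  by rewrite -e addrK -exprMn; lra.
rewrite -tE bE ler_pM2l ?exprn_gt0 // -sum_csc2; apply: ler_sum => k _.
have sk := s0 k (ltn_ord k); have ak := a0 k (ltn_ord k).
rewrite /csc2 lef_pV2 ?posrE ?exprn_gt0 //.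
by apply: lerXn2r; rewrite ?nnegrE ?(ltW sk) ?(ltW ak) // sin_le // ltW.
Qed.

Lemma odd_basel_mono N M : (N <= M)%N -> odd_basel N <= odd_basel M.
Proof.
move=> /subnKC <-; rewrite /odd_basel big_split_ord /= lerDl sumr_ge0 // => i _. 
Qed.

Lemma odd_basel_le N : odd_basel N <= pi ^+ 2 / 8.
Proof.
have /andP[_ h] := odd_basel_pow2 N; apply: le_trans h.
by apply: odd_basel_mono; apply/ltnW/ltn_expl.
Qed.

Lemma odd_basel_ge (e : R) : 0 < e -> exists N, pi ^+ 2 / 8 - e <= odd_basel N.
Proof.
move=> e0.
pose n := Num.trunc (pi ^+ 2 / e).
exists (2 ^ n.+1)%N; have /andP[h _] := odd_basel_pow2 n.+1; apply: le_trans h.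
rewrite lerD2l lerNr opprK.
have p0 : 0 < pi ^+ 2 :> R by rewrite exprn_gt0 // pi_gt0.
rewrite ler_pdivrMr; last by rewrite mulr_gt0 // exprn_gt0.
have h1 : pi ^+ 2 / e < n.+1%:R by rewrite truncnS_gt // ?divr_ge0 // ltW.
have h2 : (n.+1%:R : R) <= 2 ^+ n.+1 by rewrite -natrX ler_nat ltnW // ltn_expl.
have h3 : pi ^+ 2 <= 2 ^+ n.+1 * e by rewrite -ler_pdivrMr // (le_trans (ltW h1)).
by move: h3; move: (2 ^+ n.+1) => q; nra.
Qed.

End OddBasel.

Lemma le_lim_seq (R : realType) (u v : nat -> R) (l m : R) :
  u @ \oo --> l -> v @ \oo --> m -> (forall n, u n <= v n) -> l <= m.
Proof.
move=> cu cv h; apply: (ler_cvg_to cu cv); exact: nearW.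
Qed.

(** * A Lambert series over odd multiples, at small argument *)

Section OddLambert.
Variable R : realType.
Implicit Types (t z : R) (K N : nat).

(** Equal to [1 / (4 sinh^2 (t / 2))] and to the sum of [i e^(-i t)], the form in which it enters
    the Lambert series of [c]. *)
Definition csch2 t : R := (expR t + expR (- t) - 2)^-1.

Lemma cosh_ge t : 0 <= t -> t ^+ 2 <= expR t + expR (- t) - 2.
Proof.
move=> t0.
have h1 (s : R) : 0 <= s -> 2 * s <= expR s - expR (- s).
  move=> s0; have := @derive_nonneg_le R (fun s => expR s - expR (- s) - 2 * s) (fun s => expR s + expR (- s) - 2) s s0.
  rewrite oppr0 subrr mulr0 subrr subr_ge0; apply.
  - by move=> x _; apply: is_derive_eq; rewrite /GRing.scale /=; ring.
  - by move=> x _; have := expR_ge1Dx x; have := expR_ge1Dx (- x); lra.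
have := @derive_nonneg_le R (fun s => expR s + expR (- s) - 2 - s ^+ 2) (fun s => expR s - expR (- s) - 2 * s) t t0.
rewrite oppr0 expR0 expr0n subr0 (_ : 1 + 1 - 2 = 0); last by ring.
rewrite subr_ge0; apply.
- by move=> x _; apply: is_derive_eq; rewrite /GRing.scale /=; ring.
- by move=> x /andP[/h1 h _]; rewrite subr_ge0.
Qed.

Lemma csch2_ge0 t : 0 < t -> 0 <= csch2 t.
Proof.
move=> t0; rewrite invr_ge0; apply: le_trans (cosh_ge (ltW t0)).
by rewrite exprn_ge0 // ltW.
Qed.

Lemma csch2_le t : 0 < t -> csch2 t <= (t ^+ 2)^-1.
Proof.
move=> t0; have h := cosh_ge (ltW t0); have t2 : 0 < t ^+ 2 by rewrite exprn_gt0.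
by rewrite lef_pV2 ?posrE // (lt_le_trans t2 h).
Qed.

(** From [(e^t + e^(-t) - 2) e^(-t) = (1 - e^(-t))^2 <= t^2] and [e^(-t) >= 1 - t]. *)
Lemma csch2_ge t : 0 < t -> (1 - t) / t ^+ 2 <= csch2 t.
Proof.
move=> t0; have h := cosh_ge (ltW t0); have t2 : 0 < t ^+ 2 by rewrite exprn_gt0.
have d0 : 0 < expR t + expR (- t) - 2 by apply: lt_le_trans h.
rewrite /csch2 ler_pdivrMr // mulrC ler_pdivlMr //.
have e0 := expR_gt0 (- t).
have eE : expR t * expR (- t) = 1 by rewrite expRxMexpNx_1.
have h1 := expR_ge1Dx (- t).
have e1 : expR (- t) <= 1 by rewrite expR_le1; lra.
have sq : (1 - expR (- t)) ^+ 2 <= t ^+ 2.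
  by apply: lerXn2r; rewrite ?nnegrE; lra.
have : (expR t + expR (- t) - 2) * expR (- t) <= t ^+ 2.
  apply: le_trans sq; rewrite le_eqVlt; apply/orP; left; apply/eqP.
  by rewrite mulrBl mulrDl eE; ring.
apply: le_trans; rewrite mulrC; apply: ler_wpM2l; [exact: ltW | lra].
Qed.

(** This is [4 / sinh^2 (2 u) = 1 / sinh^2 u - 1 / cosh^2 u] with [u = t / 2]. Summed over odd
    multiples of [z], it relates the series at [2 z] and [z], and the last term becomes a midpoint
    sum. *)
Lemma csch2_double t : 0 < t -> 4 * csch2 (2 * t) = csch2 t - dlogistic t.
Proof.
move=> t0; rewrite dlogisticE /csch2 -mulrN !expRM_natl.
have d0 : 0 < expR t + expR (- t) - 2.
  by apply: lt_le_trans (cosh_ge (ltW t0)); rewrite exprn_gt0.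
have eE : expR t * expR (- t) = 1 by rewrite expRxMexpNx_1.
move: d0 eE (expR_gt0 t) (expR_gt0 (- t)).
move: (expR t) (expR (- t)) => u v d0 uv u0 v0.
have -> : u ^+ 2 + v ^+ 2 - 2 = (u + v - 2) * (2 + u + v).
  have -> : (u + v - 2) * (2 + u + v) = u ^+ 2 + v ^+ 2 + 2 * (u * v) - 4 by ring.
  by rewrite uv; ring.
by field; rewrite !gt_eqF // !addr_gt0.
Qed.

Definition odd_csch_sum z N : R := 2 * \sum_(j < N) csch2 ((2 * j%:R + 1) * z).

Lemma odd_gt0 (j : nat) : 0 < 2 * j%:R + 1 :> R.
Proof. by have h : 0 <= (j%:R : R) by []; lra. Qed.

Lemma odd_csch_sum_bound z N : 0 < z -> odd_csch_sum z N <= pi ^+ 2 / (4 * z ^+ 2).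
Proof.
move=> z0.
have h : odd_csch_sum z N <= 2 * (odd_basel R N / z ^+ 2).
  rewrite /odd_csch_sum ler_pM2l // /odd_basel big_distrl /=.
  apply: ler_sum => j _; rewrite -invfM -exprMn; apply: csch2_le.
  by rewrite mulr_gt0 ?odd_gt0.
apply: le_trans h _.
have -> : pi ^+ 2 / (4 * z ^+ 2) = 2 * ((pi ^+ 2 / 8) / z ^+ 2) by field; rewrite gt_eqF.
by rewrite ler_pM2l // ler_pM2r ?invr_gt0 ?exprn_gt0 // odd_basel_le.
Qed.

Lemma odd_csch_sum_nondecreasing z : 0 < z -> nondecreasing_seq (odd_csch_sum z).
Proof.
move=> z0 N M /subnKC <-; rewrite /odd_csch_sum ler_pM2l // big_split_ord /= lerDl.
by apply: sumr_ge0 => j _; apply: csch2_ge0; rewrite mulr_gt0 ?odd_gt0.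
Qed.

Definition odd_csch_series z : R := limn (odd_csch_sum z).

Lemma odd_csch_sum_cvg z : 0 < z -> odd_csch_sum z @ \oo --> odd_csch_series z.
Proof.
move=> z0; apply: nondecreasing_is_cvgn; first exact: odd_csch_sum_nondecreasing.
by exists (pi ^+ 2 / (4 * z ^+ 2)) => _ [N _ <-]; apply: odd_csch_sum_bound.
Qed.

Lemma odd_csch_sum_le z N : 0 < z -> odd_csch_sum z N <= odd_csch_series z.
Proof.
move=> z0; apply: nondecreasing_cvgn_le; first exact: odd_csch_sum_nondecreasing.
by apply/cvg_ex; exists (odd_csch_series z); apply: odd_csch_sum_cvg.
Qed.

Lemma odd_csch_series_le z : 0 < z -> odd_csch_series z <= pi ^+ 2 / (4 * z ^+ 2).
Proof.
move=> z0; apply: limr_le.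
  by apply/cvg_ex; exists (odd_csch_series z); apply: odd_csch_sum_cvg.
by near=> N; apply: odd_csch_sum_bound.
Unshelve. all: by end_near. Qed.

(** [z^2] times the error in [odd_csch_series z ~ pi^2 / (4 z^2) - 1 / (2 z)]. *)
Definition odd_csch_defect z : R := z ^+ 2 * odd_csch_series z + z / 2 - pi ^+ 2 / 4.

Lemma cvg_geometric_exp z : 0 < z -> (fun N => expR (- (2 * N%:R * z))) @ \oo --> (0 : R).
Proof.
move=> z0.
rewrite (_ : (fun N => _) = (fun N => expR (- (2 * z)) ^+ N)); last first.
  by apply/funext => N; rewrite -expRM_natl; congr expR; ring.
apply: cvg_expr; rewrite ger0_norm ?expR_ge0 // expR_lt1; lra.
Qed.

(** The summand [z / 2] of the defect cancels the integral in [midpoint_logistic]: the difference of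
    the defects is [- z / 2] times the error of the midpoint rule. *)
Lemma odd_csch_defect_double K :
  exists2 C, 0 <= C & forall z, 0 < z <= 1 ->
    `|odd_csch_defect (2 * z) - odd_csch_defect z| <= C * z ^+ K.
Proof.
have [C C0 hC] := midpoint_logistic R K.
exists C => // z hz; have /andP[z0 z1] := hz.
have z20 : 0 < 2 * z by rewrite mulr_gt0.
pose u N := 4 * z ^+ 2 * odd_csch_sum (2 * z) N - z ^+ 2 * odd_csch_sum z N + z / 2.
have cu : u @ \oo --> odd_csch_defect (2 * z) - odd_csch_defect z.
  have -> : odd_csch_defect (2 * z) - odd_csch_defect z =
    4 * z ^+ 2 * odd_csch_series (2 * z) - z ^+ 2 * odd_csch_series z + z / 2.
    by rewrite /odd_csch_defect; field.
  apply: cvgD; last exact: cvg_cst.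
  by apply: cvgB; apply: cvgMr; apply: odd_csch_sum_cvg.
have uE N : u N = - (z / 2 * (4 * z * (\sum_(j < N) dlogistic ((2 * j%:R + 1) * z)) - 1)).
  have e : 4 * odd_csch_sum (2 * z) N = odd_csch_sum z N - 2 * \sum_(j < N) dlogistic ((2 * j%:R + 1) * z).
    rewrite /odd_csch_sum mulrCA -mulrBr -sumrB; congr (_ * _); rewrite big_distrr /=.
    apply: eq_bigr => j _; rewrite -csch2_double ?mulr_gt0 ?odd_gt0 //.
    by congr (_ * csch2 _); ring.
  have -> : u N = z ^+ 2 * (4 * odd_csch_sum (2 * z) N) - z ^+ 2 * odd_csch_sum z N + z / 2 by rewrite /u; ring.
  by rewrite e; field.
apply: (@le_lim_seq _ (fun N => `|u N|) (fun N => C * (z ^+ K + expR (- (2 * N%:R * z))))).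
- exact: cvg_norm.
- rewrite -[X in _ --> C * X]addr0; apply: cvgMr; apply: cvgD; first exact: cvg_cst.
  exact: cvg_geometric_exp.
- move=> N; rewrite uE normrN normrM ger0_norm; last lra.
  apply: le_trans (hC z N hz); rewrite ler_piMl //; lra.
Qed.

(** Here [pi^2 / 8] fixes the constant: finitely many terms capture almost all of it, and for small
    [z] these terms are close to [1 / ((2j + 1) z)^2]. *)
Lemma odd_csch_defect_cvg0 (e : R) : 0 < e ->
  exists2 h, 0 < h & forall z, 0 < z <= h -> `|odd_csch_defect z| <= e.
Proof.
move=> e0; have e4 : 0 < e / 4 by rewrite divr_gt0.
have [N hN] := odd_basel_ge e4.
have d0 : 0 < 4 * (N.+1%:R : R) by rewrite mulr_gt0.
exists (e / (4 * N.+1%:R)); first by rewrite divr_gt0.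
move=> z /andP[z0 zh].
have hz : 4 * N.+1%:R * z <= e by rewrite mulrC -ler_pdivlMr.
have Nz : 0 <= N%:R * z by rewrite mulr_ge0 // ltW.
have hz' : 4 * (N%:R * z) + 4 * z <= e.
  by apply: le_trans hz; rewrite -natr1; lra.
have z20 : 0 < z ^+ 2 by rewrite exprn_gt0.
have up : z ^+ 2 * odd_csch_series z <= pi ^+ 2 / 4.
  have := odd_csch_series_le z0; rewrite invfM mulrA ler_pdivlMr //; lra.
(* A term loses at most [z / (2j + 1) <= z] against [1 / (2j + 1)^2], hence [N z] in total. *)
have lo : 2 * (odd_basel R N - N%:R * z) <= z ^+ 2 * odd_csch_series z.
  apply: le_trans (ler_wpM2l (ltW z20) (odd_csch_sum_le N z0)).
  rewrite /odd_csch_sum mulrCA ler_pM2l // big_distrr /= /odd_basel.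
  have -> : N%:R * z = \sum_(j < N) z by rewrite sumr_const card_ord mulr_natl.
  rewrite -sumrB; apply: ler_sum => j _.
  have oj := odd_gt0 j.
  apply: le_trans (ler_wpM2l (ltW z20) (csch2_ge (mulr_gt0 oj z0))).
  have -> : z ^+ 2 * ((1 - (2 * j%:R + 1) * z) / ((2 * j%:R + 1) * z) ^+ 2) =
     (2 * j%:R + 1) ^- 2 - z / (2 * j%:R + 1).
    by field; rewrite !gt_eqF.
  rewrite lerD2l lerN2 ler_pdivrMr // ler_peMr ?(ltW z0) //.
  by have : 0 <= (j%:R : R) by []; lra.
rewrite /odd_csch_defect ler_norml; lra.
Qed.

(** Along [z / 2^n] the defect tends to 0 with increments [O(z^K / 2^n)]: the additional power of
    [z] in the duplication estimate pays for the geometric series. *)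
Lemma odd_csch_defect_small K :
  exists2 C, 0 <= C & forall z, 0 < z <= 1 -> `|odd_csch_defect z| <= C * z ^+ K.
Proof.
have [C C0 hC] := odd_csch_defect_double K.+1.
exists C => // z /andP[z0 z1].
have zn n : 0 < z / 2 ^+ n by rewrite divr_gt0 // exprn_gt0.
have zn1 n : z / 2 ^+ n <= 1.
  rewrite ler_pdivrMr ?exprn_gt0 // mul1r (le_trans z1) // exprn_ege1 //; lra.
have zK : 0 <= z ^+ K by rewrite exprn_ge0 // ltW.
have step n : `|odd_csch_defect z| <= `|odd_csch_defect (z / 2 ^+ n)| + C * z ^+ K * (1 - (2 ^+ n)^-1).
  elim: n => [|n IH]; first by rewrite expr0 divr1 invr1 subrr mulr0 addr0.
  apply: le_trans IH _.
  set y := z / 2 ^+ n.+1.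
  have yE : z / 2 ^+ n = 2 * y by rewrite /y exprS; field; rewrite gt_eqF // exprn_gt0.
  have y0 : 0 < y := zn n.+1.
  have := hC y; rewrite y0 zn1 => /(_ isT) h.
  have h2 : `|odd_csch_defect (2 * y)| <= `|odd_csch_defect y| + C * y ^+ K.+1.
    rewrite -[odd_csch_defect (2 * y)](subrK (odd_csch_defect y)) addrC.
    by apply: le_trans (ler_normD _ _) _; rewrite lerD2l.
  have h3 : y ^+ K.+1 <= z ^+ K * (2 ^+ n.+1)^-1.
    rewrite exprS mulrC; apply: ler_pM => //; rewrite ?exprn_ge0 // ?(ltW y0) //.
      apply: lerXn2r; rewrite ?nnegrE ?(ltW y0) ?(ltW z0) //.
      rewrite ler_pdivrMr ?exprn_gt0 // ler_peMr ?(ltW z0) // exprn_ege1 //; lra.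
    by rewrite /y ler_piMl // invr_ge0 exprn_ge0.
  have h4 : C * y ^+ K.+1 <= C * (z ^+ K * (2 ^+ n.+1)^-1) by apply: ler_wpM2l.
  rewrite yE; apply: le_trans (lerD h2 (lexx _)) _.
  rewrite -addrA lerD2l; apply: le_trans (lerD h4 (lexx _)) _.
  have -> : (2 ^+ n : R)^-1 = 2 * (2 ^+ n.+1)^-1 by rewrite exprS; field; rewrite gt_eqF // exprn_gt0.
  lra.
apply/ler_addgt0Pr => e e0; have [h h0 hh] := odd_csch_defect_cvg0 e0.
pose n := Num.trunc (z / h).
have hn : z / h < n.+1%:R by rewrite truncnS_gt // divr_ge0 // ltW.
apply: le_trans (step n.+1) _; rewrite addrC; apply: lerD.
  rewrite ler_piMr ?mulr_ge0 // gerBl invr_ge0 exprn_ge0 //.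
apply: hh; rewrite zn ler_pdivrMr ?exprn_gt0 // -ler_pdivrMl // mulrC.
by rewrite (le_trans (ltW hn)) // -natrX ler_nat ltnW // ltn_expl.
Qed.

Lemma odd_csch_series_asymp K :
  exists2 C, 0 <= C & forall z, 0 < z <= 1 ->
    `|odd_csch_series z - (pi ^+ 2 / (4 * z ^+ 2) - (2 * z)^-1)| <= C * z ^+ K.
Proof.
have [C C0 hC] := odd_csch_defect_small K.+2.
exists C => // z hz; have /andP[z0 z1] := hz; have z20 : 0 < z ^+ 2 by rewrite exprn_gt0.
have -> : odd_csch_series z - (pi ^+ 2 / (4 * z ^+ 2) - (2 * z)^-1) = odd_csch_defect z / z ^+ 2.
  by rewrite /odd_csch_defect; field; rewrite gt_eqF.
rewrite normrM normfV (ger0_norm (ltW z20)) ler_pdivrMr // -mulrA -exprD addn2.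
exact: hC.
Qed.

End OddLambert.

(** * Exponential moments of [c] *)

(** Ranges independent of [k] allow the sums to be exchanged; [j] encodes the odd divisor
    [2 j + 1]. *)
Lemma twice_odd_codivisorsE X k : (k <= X)%N ->
  twice_odd_codivisors k =
  (\sum_(i < X) \sum_(j < X) if (i.+1 * (2 * j).+1 == k)%N then 2 * i.+1 else 0)%N.
Proof.
move=> hk.
have inner i : (\sum_(r < k.+1 | odd r && (i.+1 * r == k)%N) 2 * i.+1 =
   \sum_(j < X) if (i.+1 * (2 * j).+1 == k)%N then 2 * i.+1 else 0)%N.
  have [/existsP[j0 /eqP hj0]|/existsPn hn] := boolP [exists j : 'I_X, (i.+1 * (2 * j).+1 == k)%N].
    have hr : ((2 * j0).+1 < k.+1)%N by rewrite ltnS -hj0 leq_pmull.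
    rewrite (bigD1 (Ordinal hr)) /=; last by rewrite hj0 eqxx andbT mul2n /= odd_double.
    rewrite big1 ?addn0.
      rewrite (bigD1 j0) //= hj0 eqxx big1 ?addn0 // => j hj.
      case: eqP => // e; case/eqP: hj; apply: val_inj => /=.
      by move: e; rewrite -hj0 => /eqP; rewrite eqn_pmul2l // => /eqP; lia.
    move=> r /andP[/andP[_ /eqP e] /eqP[]]; apply: val_inj => /=.
    by move: (etrans e (esym hj0)) => /eqP; rewrite eqn_pmul2l // => /eqP.
  rewrite [RHS]big1; last by move=> j _; rewrite (negbTE (hn j)).
  rewrite big1 // => r /andP[hr /eqP e].
  have hj : (r./2 < X)%N by have := odd_double_half r; rewrite hr -mul2n; nia.
  case/negP: (hn (Ordinal hj)) => /=; rewrite mul2n.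
  by have := odd_double_half r; rewrite hr add1n => ->; apply/eqP.
rewrite /twice_odd_codivisors; under eq_bigr do rewrite inner.
rewrite -(subnKC hk) [RHS]big_split_ord /= [X in (_ = _ + X)%N]big1 ?addn0 // => i _.
rewrite big1 // => j _; case: eqP => // e.
by exfalso; move: e; nia.
Qed.

Lemma twice_odd_codivisors_ge k : (2 * k <= twice_odd_codivisors k)%N.
Proof.
case: k => [|k]; first by rewrite muln0.
(* The retained term belongs to the divisor 1, with codivisor [k.+1]. *)
rewrite (@twice_odd_codivisorsE k.+1) // (bigD1 ord_max) //= (bigD1 ord0) //=.
by rewrite muln0 muln1 eqxx -addnA leq_addr.
Qed.

Lemma lim_seq_le_cst (R : realType) (u : nat -> R) (l c : R) :
  u @ \oo --> l -> (forall n, u n <= c) -> l <= c.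
Proof. by move=> cu; apply: (le_lim_seq cu); exact: cvg_cst. Qed.

Section Moments.
Variable R : realType.
Implicit Types (t z : R) (i p K N X : nat).

Definition codiv (k : nat) : R := (twice_odd_codivisors k)%:R.

Lemma codiv_ge0 k : 0 <= codiv k. Proof. by []. Qed.

Lemma codiv_ge k : 2 * k%:R <= codiv k.
Proof. by rewrite -natrM ler_nat twice_odd_codivisors_ge. Qed.

Definition harmonic_sum X : R := \sum_(r < X) r.+1%:R^-1.

(** An odd divisor [2 j + 1 >= j + 1] contributes at most [2 k / (j + 1)]. Together with [codiv_ge]
    this determines [c(k)] up to a logarithm, which sets the gain of the averaging step. *)
Lemma codiv_le_harmonic k : codiv k <= 2 * k%:R * harmonic_sum k.
Proof.
rewrite /codiv (@twice_odd_codivisorsE k k) // exchange_big /= natr_sum.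
rewrite /harmonic_sum big_distrr /=; apply: ler_sum => j _.
have [/existsP[i0 /eqP hi0]|/existsPn hn] := boolP [exists i : 'I_k, (i.+1 * (2 * j).+1 == k)%N].
  rewrite (bigD1 i0) //= hi0 eqxx big1 ?addn0; last first.
    move=> i hi; case: eqP => // e; case/eqP: hi; apply: val_inj => /=.
    by move: (etrans e (esym hi0)) => /eqP; rewrite eqn_pmul2r // => /eqP [].
  by rewrite ler_pdivlMr // -natrM -natrM ler_nat; move: hi0; nia.
rewrite big1; last by move=> i _; rewrite (negbTE (hn i)).
by rewrite mulr_ge0 ?mulr_ge0 // invr_ge0.
Qed.

Lemma harmonic_sum_le X : harmonic_sum X <= X%:R.
Proof.
apply: le_trans (_ : \sum_(r < X) 1 <= _).
  by apply: ler_sum => r _; rewrite invf_le1 // ler1n.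
by rewrite sumr_const card_ord.
Qed.

Lemma codiv_le k : codiv k <= 2 * k%:R ^+ 2.
Proof.
apply: le_trans (codiv_le_harmonic k) _; rewrite expr2 mulrA ler_wpM2l //.
exact: harmonic_sum_le.
Qed.

Lemma pow_le_exp p t : 0 <= t -> t ^+ p <= p`!%:R * expR t.
Proof.
case: p => [|p] t0.
  by rewrite expr0 mul1r -expR0 ler_expR.
have := expR_ge1Dxn p t0.
have f0 : 0 < (p.+1)`!%:R :> R by rewrite ltr0n fact_gt0.
move=> h; rewrite mulrC -ler_pdivrMr //; apply: le_trans h.
by rewrite lerDr.
Qed.

Lemma geometric_exp_sum z X : 0 < z -> \sum_(k < X) expR (- (k%:R * z)) <= 1 + z^-1.
Proof.
move=> z0.
have q0 := expR_gt0 (- z).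
have q1 : expR (- z) <= (1 + z)^-1.
  by rewrite expRN lef_pV2 ?posrE ?expR_gt0 ?addr_gt0 // expR_ge1Dx.
have hz : (1 + z)^-1 * (1 + z) = 1 by rewrite mulVf // gt_eqF // addr_gt0.
have q2 : z * (1 + z)^-1 <= 1 - expR (- z).
  have : z * (1 + z)^-1 = 1 - (1 + z)^-1 by field; rewrite gt_eqF // addr_gt0.
  lra.
have zz : 0 < z * (1 + z)^-1 by rewrite mulr_gt0 // invr_gt0 addr_gt0.
have -> : 1 + z^-1 = (z * (1 + z)^-1)^-1 by field; rewrite !gt_eqF // addr_gt0.
have g : (1 - expR (- z)) * \sum_(k < X) expR (- (k%:R * z)) <= 1.
  rewrite (eq_bigr (fun k : 'I_X => expR (- z) ^+ k)); last first.
    by move=> k _; rewrite -expRM_natl mulrN.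
  by rewrite -opprB mulNr -subrX1 opprB gerBl exprn_ge0 // ltW.
rewrite -[X in X <= _](mulKf (lt0r_neq0 zz)) ler_piMr ?invr_ge0 ?(ltW zz) //.
apply: le_trans g; apply: ler_wpM2r => //.
by apply: sumr_ge0 => k _; exact: expR_ge0.
Qed.

(** Half of the exponential absorbs [k^p], by [pow_le_exp]; the other half is summed as a geometric
    series. *)
Lemma exp_moment_bound p :
  exists2 C, 0 <= C & forall z X, 0 < z <= 1 ->
    \sum_(k < X) k%:R ^+ p * expR (- (k%:R * z)) <= C / z ^+ p.+1.
Proof.
exists (p`!%:R * 2 ^+ p * 3) => [|z X /andP[z0 z1]]; first by rewrite !mulr_ge0 ?exprn_ge0.
have h0 : 0 < z / 2 by lra.
apply: le_trans (_ : \sum_(k < X) p`!%:R * 2 ^+ p / z ^+ p * expR (- (k%:R * (z / 2))) <= _).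
  apply: ler_sum => k _.
  have kz : 0 <= k%:R * (z / 2) by rewrite mulr_ge0 // ltW.
  have -> : (k%:R : R) ^+ p = (2 ^+ p / z ^+ p) * (k%:R * (z / 2)) ^+ p.
    rewrite !exprMn exprVn; field; rewrite !gt_eqF // exprn_gt0 //.
  have -> : p`!%:R * 2 ^+ p / z ^+ p * expR (- (k%:R * (z / 2))) =
     (2 ^+ p / z ^+ p) * (p`!%:R * expR (k%:R * (z / 2))) * expR (- (k%:R * z)).
    have -> : expR (- (k%:R * (z / 2))) = expR (k%:R * (z / 2)) * expR (- (k%:R * z)).
      by rewrite -expRD; congr expR; field.
    ring.
  apply: ler_wpM2r; first exact: expR_ge0.
  apply: ler_wpM2l; last exact: pow_le_exp.
  by rewrite divr_ge0 ?exprn_ge0 // ltW.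
have c0 : 0 <= p`!%:R * 2 ^+ p / z ^+ p.
  by rewrite divr_ge0 ?mulr_ge0 ?exprn_ge0 // ltW.
have hb : \sum_(k < X) expR (- (k%:R * (z / 2))) <= 3 / z.
  apply: le_trans (geometric_exp_sum X h0) _.
  have -> : (z / 2)^-1 = 2 / z by field; rewrite gt_eqF.
  have : 1 <= z^-1 by rewrite invf_ge1.
  lra.
rewrite -big_distrr /=; apply: le_trans (ler_wpM2l c0 hb) _.
by rewrite le_eqVlt; apply/orP; left; apply/eqP; rewrite exprSr invfM; ring.
Qed.

Definition codiv_moment_sum p z X : R :=
  \sum_(k < X) codiv k * k%:R ^+ p * expR (- (k%:R * z)).

Definition codiv_moment p z : R := limn (codiv_moment_sum p z).

Lemma codiv_term_ge0 p z k : 0 <= codiv k * k%:R ^+ p * expR (- (k%:R * z)).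
Proof. by rewrite mulr_ge0 ?expR_ge0 // mulr_ge0 ?codiv_ge0 // exprn_ge0. Qed.

(** The true order is [z^-(p+2)]; [codiv_le] loses one power, harmless where errors are small to
    every order. *)
Lemma codiv_moment_sum_bound p :
  exists2 C, 0 <= C & forall z X, 0 < z <= 1 -> codiv_moment_sum p z X <= C / z ^+ p.+3.
Proof.
have [C C0 hC] := exp_moment_bound p.+2.
exists (2 * C); first exact: mulr_ge0.
move=> z X hz; rewrite -mulrA; apply: le_trans (ler_wpM2l _ (hC z X hz)) => //.
rewrite big_distrr /=; apply: ler_sum => k _; rewrite mulrA.
apply: ler_wpM2r; first exact: expR_ge0.
have -> : 2 * (k%:R : R) ^+ p.+2 = 2 * k%:R ^+ 2 * k%:R ^+ p by rewrite -mulrA -exprD.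
by apply: ler_wpM2r; [exact: exprn_ge0 | exact: codiv_le].
Qed.

Lemma codiv_moment_sum_nondecreasing p z : nondecreasing_seq (codiv_moment_sum p z).
Proof.
move=> X Y /subnKC <-; rewrite /codiv_moment_sum big_split_ord /= lerDl.
by apply: sumr_ge0 => j _; exact: codiv_term_ge0.
Qed.

Lemma codiv_moment_cvg p z : 0 < z <= 1 -> codiv_moment_sum p z @ \oo --> codiv_moment p z.
Proof.
move=> hz; apply: nondecreasing_is_cvgn; first exact: codiv_moment_sum_nondecreasing.
have [C C0 hC] := codiv_moment_sum_bound p.
by exists (C / z ^+ p.+3) => _ [N _ <-]; apply: hC.
Qed.

Lemma codiv_moment_sum_le p z X : 0 < z <= 1 -> codiv_moment_sum p z X <= codiv_moment p z.
Proof.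
move=> hz; apply: nondecreasing_cvgn_le; first exact: codiv_moment_sum_nondecreasing.
by apply/cvg_ex; exists (codiv_moment p z); apply: codiv_moment_cvg.
Qed.

Lemma codiv_moment_ge0 p z : 0 < z <= 1 -> 0 <= codiv_moment p z.
Proof.
by move=> hz; apply: le_trans (codiv_moment_sum_le p 0 hz); rewrite /codiv_moment_sum big_ord0.
Qed.

Lemma codiv_moment_bound p :
  exists2 C, 0 <= C & forall z, 0 < z <= 1 -> codiv_moment p z <= C / z ^+ p.+3.
Proof.
have [C C0 hC] := codiv_moment_sum_bound p.
exists C => // z hz; apply: (lim_seq_le_cst (codiv_moment_cvg hz)).
by move=> X; apply: hC.
Qed.

(** The tail of [sum_i i q^i = q / (1 - q)^2] in closed form, with [q = e^(-t)]. *)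
Lemma csch2_partial t N : 0 < t ->
  csch2 t - \sum_(i < N) i.+1%:R * expR (- (i.+1%:R * t)) =
  expR (- (N%:R * t)) * (N.+1%:R - N%:R * expR (- t)) * csch2 t.
Proof.
move=> t0; pose q := expR (- t).
have q0 : 0 < q := expR_gt0 _.
have q1 : q < 1 by rewrite expR_lt1; lra.
have -> : csch2 t = q / (1 - q) ^+ 2.
  rewrite /csch2 -[in expR t](opprK t) (expRN (- t)) -/q.
  field; rewrite !gt_eqF //= ?andbT ?subr_gt0 //.
  have h : 0 < (1 - q) * (1 - q) by rewrite mulr_gt0 // subr_gt0.
  lra.
have qE n : expR (- (n%:R * t)) = q ^+ n by rewrite -mulrN expRM_natl.
have d0 : 1 - q != 0 by rewrite gt_eqF // subr_gt0.
have S : (1 - q) ^+ 2 * \sum_(i < N) i.+1%:R * q ^+ i.+1 =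
    q - q ^+ N.+1 * (N.+1%:R - N%:R * q).
  elim: (N) => [|n IH]; first by rewrite big_ord0 expr1; ring.
  by rewrite big_ord_recr /= mulrDr IH !exprS -!natr1; ring.
rewrite (eq_bigr (fun i : 'I_N => i.+1%:R * q ^+ i.+1)); last by move=> i _; rewrite qE.
rewrite qE -[\sum_(i < N) _](mulKf (expf_neq0 2 d0)) S -/q (exprS q N).
by field.
Qed.

Lemma codiv_moment_sum0E z X : codiv_moment_sum 0 z X =
  \sum_(j < X) 2 * \sum_(i < X) if (i.+1 * (2 * j).+1 < X)%N
     then i.+1%:R * expR (- (i.+1%:R * ((2 * j%:R + 1) * z))) else 0.
Proof.
transitivity (\sum_(k < X) \sum_(j < X) \sum_(i < X)
   if (i.+1 * (2 * j).+1 == k)%N then 2 * i.+1%:R * expR (- (k%:R * z)) else 0).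
  apply: eq_bigr => k _; rewrite expr0 mulr1 /codiv.
  rewrite (@twice_odd_codivisorsE X k (ltnW (ltn_ord k))) exchange_big /= natr_sum big_distrl /=.
  apply: eq_bigr => j _; rewrite natr_sum big_distrl /=; apply: eq_bigr => i _.
  by case: eqP => _; rewrite ?mul0r // natrM.
rewrite exchange_big /=; apply: eq_bigr => j _; rewrite exchange_big /= big_distrr /=.
apply: eq_bigr => i _; case: ltnP => h.
  rewrite (bigD1 (Ordinal h)) //= eqxx big1 ?addr0.
    by rewrite natrM -[(2 * j).+1%:R]natr1 natrM !mulrA.
  move=> k hk; case: eqP => // e; case/eqP: hk; exact: val_inj.
rewrite mulr0 big1 // => k _; case: eqP => // e.
by move: h; rewrite e leqNgt ltn_ord.
Qed.

(** The partial sum over [k < X] covers the pairs with [(i+1) (2j+1) < X]: they lie in the strip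
    [j < X], and they include any given rectangle once [X] is large. *)
Lemma codiv_moment0E z : 0 < z <= 1 -> codiv_moment 0 z = odd_csch_series z.
Proof.
move=> hz; have /andP[z0 z1] := hz.
have t0 j : 0 < (2 * j%:R + 1) * z by rewrite mulr_gt0 ?odd_gt0.
have part_le j N : \sum_(i < N) i.+1%:R * expR (- (i.+1%:R * ((2 * j%:R + 1) * z))) <= csch2 ((2 * j%:R + 1) * z).
  rewrite -subr_ge0 csch2_partial // mulr_ge0 ?csch2_ge0 // mulr_ge0 ?expR_ge0 //.
  rewrite subr_ge0 -[X in _ <= X]mulr1; apply: ler_pM; rewrite ?expR_ge0 ?ler_nat //.
  by rewrite expR_le1 oppr_le0 ltW.
apply/eqP; rewrite eq_le; apply/andP; split.
  apply: (le_lim_seq (codiv_moment_cvg hz) (odd_csch_sum_cvg z0)) => X.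
  rewrite codiv_moment_sum0E /odd_csch_sum big_distrr /=; apply: ler_sum => j _.
  rewrite ler_pM2l //; apply: le_trans (part_le j X); apply: ler_sum => i _.
  by case: ifP => // _; rewrite mulr_ge0 // expR_ge0.
apply: (lim_seq_le_cst (odd_csch_sum_cvg z0)) => N.
(* Chosen so that cutting the series of [csch2] after [M.+1] terms costs at most [D / M.+1] over all
   [j < N]; it comes from [e^(-s) <= 2 / s^2]. *)
pose D : R := \sum_(j < N) 2 * (2 * csch2 ((2 * j%:R + 1) * z) / ((2 * j%:R + 1) * z) ^+ 2 * 2).
apply: (@le_lim_seq _ (fun=> odd_csch_sum z N) (fun M => codiv_moment 0 z + D * harmonic M)).
- exact: cvg_cst.
- rewrite -[X in _ --> X]addr0; apply: cvgD; first exact: cvg_cst.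
  by rewrite -[X in _ --> X](mulr0 D); apply: cvgMr; apply: cvg_harmonic.
move=> M.
(* Large enough for the rectangle [i <= M], [j < N] to lie in the region. *)
pose X := (M.+1 * (2 * N).+1 + N + M.+1)%N.
apply: le_trans (lerD (codiv_moment_sum_le 0 X hz) (lexx _)).
rewrite codiv_moment_sum0E.
have NX : (N <= X)%N by rewrite /X; lia.
have MX : (M.+1 <= X)%N by rewrite /X; lia.
have inner0 j i Y : 0 <= if (i.+1 * (2 * j).+1 < Y)%N
     then i.+1%:R * expR (- (i.+1%:R * ((2 * j%:R + 1) * z))) else 0.
  by case: ifP => // _; rewrite mulr_ge0 // expR_ge0.
apply: le_trans (_ : \sum_(j < N) 2 * (\sum_(i < M.+1) i.+1%:R * expR (- (i.+1%:R * ((2 * j%:R + 1) * z)))) + D * harmonic M <= _); last first.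
  rewrite lerD2r -[in X in _ <= X](subnKC NX) big_split_ord /=.
  rewrite -[X in X <= _]addr0; apply: lerD; last first.
    by apply: sumr_ge0 => j _; rewrite mulr_ge0 // sumr_ge0.
  apply: ler_sum => j _; rewrite ler_pM2l // subnKC //.
  rewrite -[in X in _ <= X](subnKC MX) big_split_ord /=.
  rewrite -[X in X <= _]addr0; apply: lerD; last by apply: sumr_ge0.
  apply: ler_sum => i _; rewrite subnKC // ifT // /X.
  have := ltn_ord i; have := ltn_ord j; nia.
rewrite /odd_csch_sum /D big_distrr big_distrl /= -big_split /=.
apply: ler_sum => j _; rewrite -mulrA -mulrDr ler_pM2l //.
set t := (2 * j%:R + 1) * z; have t1 : 0 < t := t0 j.
rewrite addrC -lerBlDr csch2_partial // /harmonic /=.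
have c0 := csch2_ge0 t1.
have m0 : 0 < (M.+1%:R : R) by [].
have e1 : expR (- (M.+1%:R * t)) <= 2 / (M.+1%:R * t) ^+ 2.
  rewrite expRN -[_ / _]invrK invf_div lef_pV2 ?posrE ?expR_gt0 ?divr_gt0 ?exprn_gt0 ?mulr_gt0 //.
  have := @pow_le_exp 2 (M.+1%:R * t); rewrite (_ : 2`!%:R = 2) // => h.
  rewrite ler_pdivrMr // [X in _ <= X]mulrC; apply: h; by rewrite mulr_ge0 // ltW.
apply: le_trans (_ : 2 / (M.+1%:R * t) ^+ 2 * (2 * M.+1%:R) * csch2 t <= _).
  apply: ler_wpM2r => //; apply: ler_pM => //.
    rewrite subr_ge0 -[X in _ <= X]mulr1; apply: ler_pM; rewrite ?expR_ge0 ?ler_nat //.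
    by rewrite expR_le1 oppr_le0 ltW.
  apply: le_trans (_ : M.+2%:R <= _); last by rewrite -natrM ler_nat; lia.
  by rewrite gerBl mulr_ge0 // expR_ge0.
rewrite le_eqVlt; apply/orP; left; apply/eqP; field.
by rewrite !gt_eqF.
Qed.

End Moments.

(** * Asymptotics of the moments by differentiation in [z] *)

Section MomentAsymp.
Variable R : realType.
Implicit Types (z h x : R) (i n K X : nat).

Lemma inv_pow_taylor n :
  exists2 C : R, 0 <= C & forall x, 0 <= x <= 2^-1 ->
    `|(1 - x) ^- n - 1 - n%:R * x| <= C * x ^+ 2.
Proof.
elim: n => [|n [C C0 hC]].
  by exists 0 => // x _; rewrite expr0 invr1 subrr mul0r subrr normr0 mul0r.
exists (2 * (C + n.+1%:R)); first by rewrite mulr_ge0 // addr_ge0.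
move=> x hx; have := hC x hx; have /andP[x0 x1] := hx.
have y0 : 0 < 1 - x by lra.
have yn : (1 - x) ^+ n != 0 by rewrite gt_eqF // exprn_gt0.
set A := (1 - x) ^- n => hA.
have -> : (1 - x) ^- n.+1 - 1 - n.+1%:R * x =
   (A - 1 - n%:R * x + n.+1%:R * x ^+ 2) / (1 - x).
  by rewrite /A exprS -!natr1; field; rewrite yn gt_eqF.
rewrite normrM normfV (ger0_norm (ltW y0)) ler_pdivrMr //.
apply: le_trans (ler_normD _ _) _.
have x20 : 0 <= x ^+ 2 by rewrite exprn_ge0.
have n0 : 0 <= n.+1%:R * x ^+ 2 by rewrite mulr_ge0.
rewrite (ger0_norm n0).
have Cx : 0 <= C * x ^+ 2 by rewrite mulr_ge0.
apply: le_trans (lerD hA (lexx _)) _.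
have -> : 2 * (C + n.+1%:R) * x ^+ 2 * (1 - x) = (C * x ^+ 2 + n.+1%:R * x ^+ 2) * (2 * (1 - x)) by ring.
rewrite ler_peMr ?addr_ge0 //; lra.
Qed.

Lemma inv_pow_backward n :
  exists2 C : R, 0 <= C & forall z h, 0 < z -> 0 <= h <= z / 2 ->
    `|(z - h) ^- n - z ^- n - h * (n%:R * z ^- n.+1)| <= C * h ^+ 2 / z ^+ n.+2.
Proof.
have [C C0 hC] := inv_pow_taylor n.
exists C => // z h z0 /andP[h0 h1].
have zn m : z ^+ m != 0 by rewrite gt_eqF // exprn_gt0.
have hx : 0 <= h / z <= 2^-1.
  by rewrite divr_ge0 ?(ltW z0) //= ler_pdivrMr // mulrC.
have zh : 0 < z - h by lra.
have -> : (z - h) ^- n - z ^- n - h * (n%:R * z ^- n.+1) =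
    ((1 - h / z) ^- n - 1 - n%:R * (h / z)) / z ^+ n.
  have -> : 1 - h / z = (z - h) / z by field; rewrite gt_eqF.
  rewrite exprMn exprVn [z ^+ n.+1]exprS; field.
  by rewrite zn !gt_eqF // exprn_gt0.
rewrite normrM normfV (ger0_norm (exprn_ge0 n (ltW z0))) ler_pdivrMr ?exprn_gt0 //.
apply: le_trans (hC _ hx) _.
rewrite le_eqVlt; apply/orP; left; apply/eqP.
by rewrite (exprS z n.+1) (exprS z n); field; rewrite zn gt_eqF.
Qed.

(** The operator [(- d/dz)^i] applied to [pi^2 / (4 z^2) - 1 / (2 z)]. *)
Definition moment_main i z : R :=
  pi ^+ 2 / 4 * (i.+1)`!%:R / z ^+ i.+2 - i`!%:R / (2 * z ^+ i.+1).

Lemma moment_main_backward i :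
  exists2 C : R, 0 <= C & forall z h, 0 < z <= 1 -> 0 <= h <= z / 2 ->
    `|moment_main i (z - h) - moment_main i z - h * moment_main i.+1 z| <= C * h ^+ 2 / z ^+ i.+4.
Proof.
have [C C0 hC] := inv_pow_backward i.+2; have [D D0 hD] := inv_pow_backward i.+1.
have p0 : 0 <= pi ^+ 2 / 4 * (i.+1)`!%:R :> R.
  by rewrite mulr_ge0 // divr_ge0 // exprn_ge0 // pi_ge0.
have q0 : 0 <= i`!%:R / 2 :> R by rewrite divr_ge0.
exists (pi ^+ 2 / 4 * (i.+1)`!%:R * C + i`!%:R / 2 * D); first by rewrite addr_ge0 // mulr_ge0.
move=> z h /andP[z0 z1] hh; have /andP[h0 h1] := hh; have zh : 0 < z - h by lra.
have zn m : z ^+ m != 0 by rewrite gt_eqF // exprn_gt0.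
have hn m : (z - h) ^+ m != 0 by rewrite gt_eqF // exprn_gt0.
have -> : moment_main i (z - h) - moment_main i z - h * moment_main i.+1 z =
  pi ^+ 2 / 4 * (i.+1)`!%:R * ((z - h) ^- i.+2 - z ^- i.+2 - h * (i.+2%:R * z ^- i.+3))
  - i`!%:R / 2 * ((z - h) ^- i.+1 - z ^- i.+1 - h * (i.+1%:R * z ^- i.+2)).
  rewrite /moment_main (factS i.+1) natrM (factS i) natrM; field.
  by rewrite !zn !hn.
apply: le_trans (ler_normB _ _) _; rewrite (normrM (i`!%:R / 2)) (normrM (_ * (i.+1)`!%:R)) (ger0_norm q0) (ger0_norm p0).
have h2 : 0 <= h ^+ 2 by rewrite exprn_ge0.
have r1 : D * h ^+ 2 / z ^+ i.+3 <= D * h ^+ 2 / z ^+ i.+4.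
  apply: ler_wpM2l; first by rewrite mulr_ge0.
  by rewrite lef_pV2 ?posrE ?exprn_gt0 // [X in X <= _]exprS ler_piMl // exprn_ge0 // ltW.
have a1 := ler_wpM2l p0 (hC z h z0 hh).
have a2 := ler_wpM2l q0 (le_trans (hD z h z0 hh) r1).
by apply: le_trans (lerD a1 a2) _; rewrite le_eqVlt; apply/orP; left; apply/eqP; ring.
Qed.

Lemma exp_second_order x : 0 <= x -> 0 <= expR x - 1 - x <= x ^+ 2 * expR x.
Proof.
move=> x0; have h1 := expR_ge1Dx x; have h2 := expR_ge1Dx (- x).
have e0 := expR_gt0 x; have e1 : expR x * expR (- x) = 1 by rewrite expRxMexpNx_1.
apply/andP; split; first by lra.
have h3 : expR x - 1 <= x * expR x.
  have := ler_wpM2l (ltW e0) h2; rewrite e1; lra.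
have : x * (expR x - 1) <= x * (x * expR x) by apply: ler_wpM2l.
by rewrite expr2; lra.
Qed.

(** [codiv_moment i.+1] is minus the derivative of [codiv_moment i]; in each term the second-order
    remainder is at most [(k h)^2 e^(k h)], which moves the argument from [z] to [z - h]. *)
Lemma codiv_moment_backward i z h : 0 < z <= 1 -> 0 <= h <= z / 2 ->
  `|codiv_moment i (z - h) - codiv_moment i z - h * codiv_moment i.+1 z|
    <= h ^+ 2 * codiv_moment i.+2 (z - h).
Proof.
move=> hz hh; have /andP[z0 z1] := hz; have /andP[h0 h1] := hh.
have hzh : 0 < z - h <= 1 by apply/andP; split; lra.
pose u X := codiv_moment_sum i (z - h) X - codiv_moment_sum i z X - h * codiv_moment_sum i.+1 z X.
have cu : u @ \oo --> codiv_moment i (z - h) - codiv_moment i z - h * codiv_moment i.+1 z.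
  apply: cvgB; first by apply: cvgB; exact: codiv_moment_cvg.
  by apply: cvgMr; exact: codiv_moment_cvg.
apply: (lim_seq_le_cst (u := fun X => `|u X|)); first exact: cvg_norm.
move=> X; have -> : u X = \sum_(k < X) codiv R k * k%:R ^+ i * expR (- (k%:R * z)) *
    (expR (k%:R * h) - 1 - k%:R * h).
  rewrite /u /codiv_moment_sum big_distrr /= -!sumrB; apply: eq_bigr => k _.
  have -> : expR (- (k%:R * (z - h))) = expR (- (k%:R * z)) * expR (k%:R * h).
    by rewrite -expRD; congr expR; ring.
  rewrite exprS; ring.
have kh k : 0 <= k%:R * h by rewrite mulr_ge0.
rewrite ger0_norm; last first.
  apply: sumr_ge0 => k _; rewrite mulr_ge0 ?codiv_term_ge0 //.
  by have /andP[] := exp_second_order (kh k).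
apply: le_trans (ler_wpM2l _ (codiv_moment_sum_le i.+2 X hzh)); last by rewrite exprn_ge0.
rewrite /codiv_moment_sum big_distrr /=; apply: ler_sum => k _.
have /andP[_ e2] := exp_second_order (kh k).
apply: le_trans (ler_wpM2l (@codiv_term_ge0 R i z k) e2) _.
have -> : expR (- (k%:R * (z - h))) = expR (- (k%:R * z)) * expR (k%:R * h).
  by rewrite -expRD; congr expR; ring.
by rewrite le_eqVlt; apply/orP; left; apply/eqP; rewrite !exprS; ring.
Qed.

(* Landau's trick: a backward difference with a step of size [z ^ M] transfers
   smallness of the defect of one moment to the next one, the second-order
   error being controlled by a crude polynomial bound. *)
Lemma codiv_moment_asymp i K :
  exists2 C : R, 0 <= C & forall z, 0 < z <= 1 ->
    `|codiv_moment i z - moment_main i z| <= C * z ^+ K.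
Proof.
elim: i K => [|i IH] K.
  have [C C0 hC] := odd_csch_series_asymp R K; exists C => // z hz.
  rewrite codiv_moment0E // /moment_main.
  have /andP[z0 _] := hz.
  have -> : pi ^+ 2 / 4 * 1`!%:R / z ^+ 2 - 0`!%:R / (2 * z ^+ 1) = pi ^+ 2 / (4 * z ^+ 2) - (2 * z)^-1.
    by rewrite !fact0 (_ : 1`! = 1%N) // expr1; field; rewrite gt_eqF.
  exact: hC.
(* With [h = z^M / 2], the division by [h] costs [z^-M] in the defects of moment [i], repaid by the
   induction hypothesis at order [K + M]; second-order terms keep a factor [h / z^(i+5) <= z^K]. *)
have [M ME] : {M : nat | M = (K + i.+2.+3)%N} by exists (K + i.+2.+3)%N.
have [C1 C10 h1] := IH (K + M)%N.
have [C2 C20 h2] := moment_main_backward i.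
have [C3 C30 h3] := codiv_moment_bound R i.+2.
exists (4 * C1 + (C3 * 2 ^+ i.+2.+3 + C2)).
  by rewrite !addr_ge0 // mulr_ge0 // exprn_ge0.
move=> z hz; have /andP[z0 z1] := hz.
pose h := z ^+ M / 2.
have zM0 : 0 < z ^+ M by rewrite exprn_gt0.
have h0 : 0 < h by rewrite divr_gt0.
have zMz : z ^+ M <= z by rewrite ME addnS exprS ler_piMr ?(ltW z0) // exprn_ile1 // ltW.
have hh : 0 <= h <= z / 2 by rewrite (ltW h0) /= /h ler_pM2r.
have /andP[_ hz2] := hh.
have hzh : 0 < z - h <= 1 by apply/andP; split; lra.
have A1 := h1 z hz.
have A2 := h1 (z - h) hzh.
have A3 := codiv_moment_backward i hz hh.
have A4 := h2 z h hz hh.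
have A5 := h3 (z - h) hzh.
set G := codiv_moment i.+1 z; set m := moment_main i.+1 z.
have zKM : (z - h) ^+ (K + M) <= z ^+ (K + M).
  by apply: lerXn2r; rewrite ?nnegrE; lra.
have zz : z ^- i.+2.+3 * z ^+ M = z ^+ K.
  by rewrite ME (exprD z K) mulrCA mulVf ?mulr1 // gt_eqF // exprn_gt0.
have B1 : h ^+ 2 * codiv_moment i.+2 (z - h) <= h * (C3 * 2 ^+ i.+2.+3 * z ^+ K).
  rewrite expr2 -mulrA; apply: ler_wpM2l; first exact: ltW.
  apply: le_trans (ler_wpM2l (ltW h0) A5) _.
  have q : (z - h) ^- i.+2.+3 <= 2 ^+ i.+2.+3 / z ^+ i.+2.+3.
    have -> : 2 ^+ i.+2.+3 / z ^+ i.+2.+3 = (z / 2) ^- i.+2.+3.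
      by rewrite expr_div_n invf_div.
    have p1 : 0 < z / 2 by lra.
    have p2 : 0 < z - h by lra.
    rewrite lef_pV2 ?posrE; [|exact: exprn_gt0|exact: exprn_gt0].
    by apply: lerXn2r; rewrite ?nnegrE; lra.
  have -> : C3 * 2 ^+ i.+2.+3 * z ^+ K = z ^+ M * (C3 * (2 ^+ i.+2.+3 / z ^+ i.+2.+3)).
    by rewrite -zz; ring.
  apply: ler_pM; rewrite ?(ltW h0) //.
  - by rewrite mulr_ge0 // invr_ge0 exprn_ge0 //; lra.
  - by rewrite /h; lra.
  - exact: ler_wpM2l.
have B2 : C2 * h ^+ 2 / z ^+ i.+4 <= h * (C2 * z ^+ K).
  have -> : C2 * h ^+ 2 / z ^+ i.+4 = h * (C2 * (h / z ^+ i.+4)).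
    by rewrite expr2; ring.
  apply: ler_wpM2l; first exact: ltW.
  apply: ler_wpM2l => //; rewrite -zz mulrC; apply: ler_pM.
  - by rewrite invr_ge0 exprn_ge0 // ltW.
  - exact: ltW.
  - by rewrite lef_pV2 ?posrE ?exprn_gt0 // [X in X <= _]exprS ler_piMl // exprn_ge0 // ltW.
  - by rewrite /h; lra.
have B0 : C1 * z ^+ (K + M) = h * (2 * C1 * z ^+ K).
  by rewrite exprD /h; field.
have B0' : C1 * (z - h) ^+ (K + M) <= h * (2 * C1 * z ^+ K).
  by rewrite -B0; apply: ler_wpM2l.
rewrite B0 in A1.
have {}A2 := le_trans A2 B0'; have {}A3 := le_trans A3 B1; have {}A4 := le_trans A4 B2.
rewrite -(ler_pM2l h0) -[h in X in X <= _](ger0_norm (ltW h0)) -normrM.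
move: A1 A2 A3 A4; rewrite -/G -/m.
set a := codiv_moment i z - _; set b := codiv_moment i _ - _.
set c := _ - h * G; set d := _ - h * m => A1 A2 A3 A4.
have -> : h * (G - m) = b - a - c + d by rewrite /a /b /c /d; ring.
apply: le_trans (ler_normD _ _) _; apply: le_trans (lerD (ler_normB _ _) (lexx _)) _.
apply: le_trans (lerD (lerD (ler_normB _ _) (lexx _)) (lexx _)) _.
apply: le_trans (lerD (lerD (lerD A2 A1) A3) A4) _.
by rewrite le_eqVlt; apply/orP; left; apply/eqP; ring.
Qed.

End MomentAsymp.

(** * The model satisfies the recurrence to all orders *)

Section ScaledDerivation.
Variable R : realType.
Implicit Types (th w z a : R) (p q : {poly R}) (P : {poly {poly R}}) (i L N : nat).

(* With [th = n^(-1/4)] and [w = ((n - t)^(-1/2) - th^2) / th^3], differentiating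
   [e^(pi t / (2 sqrt n) + pi sqrt (n - t)) p(w)] in [t] replaces [p] by
   [th^3 / 2] times [scaled_deriv th p].  The polynomial [th^4 main_poly]
   represents the model [F] and [dual_poly] represents [x F(x)]; the identity
   [coef_ode] below is the differential equation [(x F)'' = pi^2 / 4 F - F' / 2]. *)
Definition scaled_deriv th p : {poly R} :=
  - pi%:P * 'X * p + (1 + th%:P * 'X) ^+ 3 * p^`().

Definition dual_poly th : {poly R} := pi%:P - th%:P ^+ 2 * (1 + th%:P * 'X).

Definition main_poly th : {poly R} := (1 + th%:P * 'X) ^+ 2 * dual_poly th.

Lemma scaled_derivD th p q : scaled_deriv th (p + q) = scaled_deriv th p + scaled_deriv th q.
Proof. by rewrite /scaled_deriv derivD; ring. Qed.

Lemma scaled_derivZ th a p : scaled_deriv th (a%:P * p) = a%:P * scaled_deriv th p.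
Proof. by rewrite /scaled_deriv derivM derivC; ring. Qed.

Lemma scaled_poly_ode th :
  let T := scaled_deriv th in
  pi%:P ^+ 2 * th%:P ^+ 4 * dual_poly th - 2 * pi%:P * th%:P ^+ 5 * T (dual_poly th)
   + th%:P ^+ 6 * T (T (dual_poly th)) =
  th%:P ^+ 4 * ((pi%:P ^+ 2 - pi%:P * th%:P ^+ 2) * main_poly th + th%:P ^+ 3 * T (main_poly th)).
Proof.
rewrite /= /scaled_deriv /main_poly /dual_poly.
have := derivC (pi : R); have := derivC th.
move: (pi%:P) (th%:P) => p t dt dp.
have d1 : (1 : {poly R})^`() = 0 by rewrite -polyC1 derivC.
rewrite !(derivCE, dt, dp, d1) /=.
ring.
Qed.

(** [w = 0] means [t = 0]: up to scaling, these are the derivatives there of the tilted [x F(x)]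
    and, in [main_coef], of the tilted [F]. *)
Definition dual_coef th i : R := (iter i (scaled_deriv th) (dual_poly th)).[0].
Definition main_coef th i : R := (iter i (scaled_deriv th) (main_poly th)).[0].

(** [scaled_deriv th] is linear over constants, so its iterates can be applied to [scaled_poly_ode]
    before evaluation at 0. *)
Lemma coef_ode th i :
  pi ^+ 2 * th ^+ 4 * dual_coef th i - 2 * pi * th ^+ 5 * dual_coef th i.+1
   + th ^+ 6 * dual_coef th i.+2 =
  th ^+ 4 * ((pi ^+ 2 - pi * th ^+ 2) * main_coef th i + th ^+ 3 * main_coef th i.+1).
Proof.
set T := scaled_deriv th.
have iterC (c : R) j q : iter j T (c%:P * q) = c%:P * iter j T q.
  by elim: j => //= j ->; rewrite /T scaled_derivZ.
have iterD j p q : iter j T (p + q) = iter j T p + iter j T q.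
  by elim: j => //= j ->; rewrite /T scaled_derivD.
have := congr1 (fun q => (iter i T q).[0]) (scaled_poly_ode th).
rewrite /= -/T.
set c1 := pi ^+ 2 * th ^+ 4; set c2 := - (2 * pi * th ^+ 5).
have -> : pi%:P ^+ 2 * th%:P ^+ 4 * dual_poly th - 2 * pi%:P * th%:P ^+ 5 * T (dual_poly th) +
   th%:P ^+ 6 * T (T (dual_poly th)) = c1%:P * dual_poly th + c2%:P * T (dual_poly th) + (th ^+ 6)%:P * T (T (dual_poly th)).
  by rewrite /c1 /c2 !(rmorphM, rmorphN, rmorphXn) /= [2%:P]rmorph_nat; ring.
have -> : th%:P ^+ 4 * ((pi%:P ^+ 2 - pi%:P * th%:P ^+ 2) * main_poly th + th%:P ^+ 3 * T (main_poly th)) =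
  (th ^+ 4 * (pi ^+ 2 - pi * th ^+ 2))%:P * main_poly th + (th ^+ 7)%:P * T (main_poly th).
  by rewrite !(rmorphM, rmorphB, rmorphXn) /=; ring.
rewrite !iterD !iterC -!iterSr /dual_coef /main_coef -/T !iterS.
move: (iter i T (dual_poly th)) (T (iter i T (dual_poly th))) (T (T (iter i T (dual_poly th)))).
move: (iter i T (main_poly th)) (T (iter i T (main_poly th))) => P0 P1 Q0 Q1 Q2.
rewrite !(hornerD, hornerM, hornerC) /c1 /c2 => h.
have -> : th ^+ 4 * ((pi ^+ 2 - pi * th ^+ 2) * P0.[0] + th ^+ 3 * P1.[0]) =
   th ^+ 4 * (pi ^+ 2 - pi * th ^+ 2) * P0.[0] + th ^+ 7 * P1.[0] by ring.
by rewrite -h; ring.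
Qed.

(** Formally [k = (a (z - D)^-2 - (z - D)^-1 / 2) h] with the shift [D] sending [h i] to [h i.+1];
    expansion in powers of [D / z] gives the sum on the left, whose coefficients are those of
    [moment_main] divided by [i!]. The hypothesis is this relation multiplied by [(z - D)^2], and it
    makes the partial sums explicit. *)
Lemma neumann_identity (z a : R) (k h : nat -> R) : z != 0 ->
  (forall i, z ^+ 2 * k i - 2 * z * k i.+1 + k i.+2 = a * h i - (z * h i - h i.+1) / 2) ->
  forall L, \sum_(i < L) h i * (a * i.+1%:R / z ^+ i.+2 - (2 * z ^+ i.+1)^-1) =
    k 0%N - L.+1%:R * k L / z ^+ L + L%:R * k L.+1 / z ^+ L.+1
     - L%:R * h L / (2 * z ^+ L.+1).
Proof.
move=> z0 ode; elim=> [|L IH].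
  by rewrite big_ord0 expr0; field.
rewrite big_ord_recr /= IH.
have e : k L.+2 = a * h L - (z * h L - h L.+1) / 2 - z ^+ 2 * k L + 2 * z * k L.+1.
  by rewrite -ode; ring.
rewrite e !exprS -!natr1; field.
by rewrite z0 expf_neq0.
Qed.

(** The parameter [th] becomes a variable of the coefficient ring, so that bounds for [th] in
    [[0, 1]] are uniform. *)
Definition eval_param th P : {poly R} := map_poly (horner_eval th) P.

Lemma iter_scaled_deriv_param (P0 : {poly {poly R}}) i :
  exists P, forall th, iter i (scaled_deriv th) (eval_param th P0) = eval_param th P.
Proof.
elim: i => [|i [P hP]]; first by exists P0.
exists (- (pi%:P)%:P * 'X * P + (1 + 'X%:P * 'X) ^+ 3 * P^`()) => th.
rewrite iterS hP /scaled_deriv /eval_param deriv_map; move: (pi : R) => c.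
rewrite !(rmorphD, rmorphM, rmorphN, rmorphXn, rmorph1) /= !map_polyX !map_polyC /=.
by rewrite /horner_eval hornerC hornerX.
Qed.

Lemma eval_param_bound P : exists2 C : R, 0 <= C & exists N,
  forall th w, 0 <= th <= 1 -> 0 <= w -> `|(eval_param th P).[w]| <= C * (1 + w) ^+ N.
Proof.
elim/poly_ind: P => [|P c [C C0 [N hN]]].
  by exists 0 => //; exists 0%N => th w _ _; rewrite /eval_param rmorph0 horner0 normr0 mul0r.
have [D D0 hD] := horner_bound c.
exists (C + D); first exact: addr_ge0.
exists N.+1 => th w hth w0.
rewrite /eval_param rmorphD rmorphM /= map_polyX map_polyC /= hornerD hornerMX hornerC.
have w1 : 1 <= 1 + w by lra.
have p1 : 1 <= (1 + w) ^+ N.+1 by rewrite exprn_ege1.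
apply: le_trans (ler_normD _ _) _; rewrite mulrDl; apply: lerD; last first.
  by apply: le_trans (hD th hth) _; rewrite ler_peMr.
rewrite normrM (ger0_norm w0) exprSr mulrA; apply: ler_pM => //; last lra.
exact: hN.
Qed.

Lemma scaled_poly_bound i :
  exists2 C : R, 0 <= C & exists N, forall th w, 0 <= th <= 1 -> 0 <= w ->
    `|(iter i (scaled_deriv th) (main_poly th)).[w]| <= C * (1 + w) ^+ N /\
    `|(iter i (scaled_deriv th) (dual_poly th)).[w]| <= C * (1 + w) ^+ N.
Proof.
pose Q0 : {poly {poly R}} := (pi%:P)%:P - ('X ^+ 2)%:P * (1 + 'X%:P * 'X).
pose P0 : {poly {poly R}} := (1 + 'X%:P * 'X) ^+ 2 * Q0.
have Q0E th : dual_poly th = eval_param th Q0.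
  rewrite /dual_poly /eval_param /Q0; move: (pi : R) => c.
  rewrite !(rmorphB, rmorphD, rmorphM, rmorphXn, rmorph1) /= !map_polyX !map_polyC /=.
  by rewrite /horner_eval hornerC hornerX expr2.
have P0E th : main_poly th = eval_param th P0.
  rewrite /main_poly Q0E /eval_param /P0.
  rewrite [RHS]rmorphM /=; congr (_ * _); rewrite rmorphXn; congr (_ ^+ 2).
  rewrite rmorphD rmorph1 rmorphM /= map_polyX map_polyC /=.
  by rewrite /horner_eval hornerX.
have [P hP] := iter_scaled_deriv_param P0 i.
have [Q hQ] := iter_scaled_deriv_param Q0 i.
have [C C0 [N hN]] := eval_param_bound P.
have [D D0 [M hM]] := eval_param_bound Q.
exists (C + D); first exact: addr_ge0.
exists (maxn N M) => th w hth w0.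
have w1 : 1 <= 1 + w by lra.
have pn : 0 <= (1 + w) ^+ N by rewrite exprn_ge0 //; lra.
have pm : 0 <= (1 + w) ^+ M by rewrite exprn_ge0 //; lra.
rewrite P0E Q0E hP hQ; split.
  apply: le_trans (hN th w hth w0) _; apply: ler_pM => //; first by rewrite lerDl.
  by rewrite ler_weXn2l // leq_maxl.
apply: le_trans (hM th w hth w0) _; apply: ler_pM => //; first by rewrite lerDr.
by rewrite ler_weXn2l // leq_maxr.
Qed.

End ScaledDerivation.

(** * The model and its exponential tilt *)

Section Model.
Variable R : realType.
Implicit Types (t : R) (p : {poly R}) (n k i L N K : nat).

(* [theta n = n^(-1/4)] is the scale in which all errors are expanded, and
   [rate n] is the derivative of [pi sqrt x] at [n]. *)
Definition rt n : R := Num.sqrt n%:R.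
Definition theta n : R := (Num.sqrt (rt n))^-1.
Definition rate n : R := pi / 2 * theta n ^+ 2.
Definition growth n : R := expR (pi * rt n).

Lemma rt_sqr n : rt n ^+ 2 = n%:R.
Proof. by rewrite sqr_sqrtr. Qed.

Lemma rt_ge1 n : (0 < n)%N -> 1 <= rt n.
Proof. by move=> n0; rewrite -[X in X <= _]sqrtr1 ler_sqrt // ler1n. Qed.

Lemma rt_gt0 n : (0 < n)%N -> 0 < rt n.
Proof. by move=> /rt_ge1; lra. Qed.

Lemma theta_gt0 n : (0 < n)%N -> 0 < theta n.
Proof. by move=> n0; rewrite invr_gt0 sqrtr_gt0 rt_gt0. Qed.

Lemma theta_sqr n : theta n ^+ 2 = (rt n)^-1.
Proof. by rewrite exprVn sqr_sqrtr // sqrtr_ge0. Qed.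

Lemma theta_pow4 n : theta n ^+ 4 = n%:R^-1.
Proof. by rewrite (exprM (theta n) 2 2) theta_sqr exprVn rt_sqr. Qed.

Lemma theta_le1 n : (0 < n)%N -> theta n <= 1.
Proof.
move=> n0; have r1 := rt_ge1 n0; have r0 := rt_gt0 n0.
rewrite invf_le1; last by rewrite sqrtr_gt0.
by rewrite -[X in X <= _]sqrtr1 ler_sqrt // ltW.
Qed.

Lemma rate_gt0 n : (0 < n)%N -> 0 < rate n.
Proof. by move=> n0; rewrite mulr_gt0 ?exprn_gt0 ?theta_gt0 // divr_gt0 // pi_gt0. Qed.

Lemma theta_le_rate n : theta n ^+ 2 <= rate n.
Proof. by rewrite ler_peMl ?exprn_even_ge0 // pihalf_ge1. Qed.

Lemma rate_le1 n : (3 < n)%N -> rate n <= 1.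
Proof.
move=> n3; have h2 : 2 <= rt n.
  rewrite -[X in X <= _](@ger0_norm R) // -sqrtr_sqr ler_sqrt // -natrX ler_nat //.
have := @pihalf_lt2 R; rewrite /rate theta_sqr => hp.
have hp0 : 0 < pi / 2 :> R by rewrite divr_gt0 // pi_gt0.
rewrite ler_pdivrMr ?mul1r; last lra.
lra.
Qed.

Lemma rate_bounds n : (3 < n)%N -> 0 < rate n <= 1.
Proof. by move=> n3; rewrite rate_gt0 ?rate_le1 //; lia. Qed.

Lemma growth_gt0 n : 0 < growth n. Proof. exact: expR_gt0. Qed.

Lemma growth0 : growth 0 = 1.
Proof. by rewrite /growth /rt sqrtr0 mulr0 expR0. Qed.

Lemma theta_exp_small (a : R) K : 0 < a ->
  exists2 C, 0 <= C & forall n, (0 < n)%N -> expR (- (a * rt n)) <= C * theta n ^+ K.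
Proof.
move=> a0; have aK : 0 < a ^+ K by rewrite exprn_gt0.
exists (K`!%:R / a ^+ K); first by rewrite divr_ge0 // ltW.
move=> n n0; have r0 := rt_gt0 n0; have t0 := theta_gt0 n0; have t1 := theta_le1 n0.
have h := @pow_le_exp R K (a * rt n) (mulr_ge0 (ltW a0) (ltW r0)).
have : expR (- (a * rt n)) <= K`!%:R / (a * rt n) ^+ K.
  rewrite expRN ler_pdivlMr ?exprn_gt0 ?mulr_gt0 // mulrC ler_pdivrMr ?expR_gt0 //.
move=> /le_trans; apply; rewrite exprMn invfM mulrA ler_wpM2l ?divr_ge0 ?(ltW aK) //.
rewrite -exprVn -theta_sqr -exprM mulnC exprM expr2 ler_piMr ?exprn_ge0 ?(ltW t0) //.
by rewrite exprn_ile1 // ltW.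
Qed.

Definition inv_root n t : R := (Num.sqrt (n%:R - t))^-1.
(** The variable [w] of [scaled_deriv], as an affine function of [inv_root]. *)
Definition offset n t : R := - (theta n)^-1 + (theta n ^+ 3)^-1 * inv_root n t.
(** The tilt [rate n * t] cancels the first-order decay of [growth], so the derivative is
    proportional to [offset] and vanishes at [t = 0]. *)
Definition phase n t : R := rate n * t + pi * Num.sqrt (n%:R - t).

Lemma is_derive_root n t : t < n%:R ->
  is_derive t 1 (fun u => Num.sqrt (n%:R - u)) (- (2 * Num.sqrt (n%:R - t))^-1).
Proof.
move=> h; have h0 : 0 < n%:R - t by rewrite subr_gt0.
have d1 : is_derive t 1 (fun u : R => n%:R - u) (-1).
  rewrite (_ : (fun u : R => _) = (fun u => n%:R + (-1) * u)); first exact: is_derive_affine.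
  by apply/funext => u; rewrite mulN1r.
have := is_derive1_sqrt h0 => d2.
have := @is_derive1_comp R Num.sqrt (fun u : R => n%:R - u) t _ _ d2 d1.
by rewrite mulrN1.
Qed.

Lemma is_derive_inv_root n t : t < n%:R ->
  is_derive t 1 (inv_root n) (inv_root n t ^+ 3 / 2).
Proof.
move=> h; have h0 : 0 < Num.sqrt (n%:R - t) by rewrite sqrtr_gt0 subr_gt0.
have d := is_derive_root h.
have d2 := @is_deriveV R (fun u => Num.sqrt (n%:R - u)) t _ 1 (lt0r_neq0 h0) d.
apply: (@is_derive_eq _ _ _ (inv_root n) t 1 _ _ d2).
rewrite /inv_root /GRing.scale /=; field; exact: lt0r_neq0.
Qed.

Lemma offsetE n t : (0 < n)%N -> inv_root n t = theta n ^+ 2 * (1 + theta n * offset n t).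
Proof.
by move=> n0; rewrite /offset; field; rewrite gt_eqF // theta_gt0.
Qed.

Lemma is_derive_offset n t : (0 < n)%N -> t < n%:R ->
  is_derive t 1 (offset n) (theta n ^+ 3 / 2 * (1 + theta n * offset n t) ^+ 3).
Proof.
move=> n0 h.
have d := @is_derive1_comp R (fun v => - (theta n)^-1 + (theta n ^+ 3)^-1 * v) (inv_root n) t _ _
  (is_derive_affine _ _ _) (is_derive_inv_root h).
apply: (is_derive_eq d).
by rewrite offsetE //; field; rewrite gt_eqF // theta_gt0.
Qed.

Lemma is_derive_phase n t : (0 < n)%N -> t < n%:R ->
  is_derive t 1 (phase n) (- (pi / 2 * theta n ^+ 3 * offset n t)).
Proof.
move=> n0 h.
have d1 := is_derive_affine (0 : R) (rate n) t.
have d2 := @is_derive1_comp R (fun v => 0 + pi * v) (fun u => Num.sqrt (n%:R - u)) t _ _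
  (is_derive_affine _ _ _) (is_derive_root h).
have d3 := @is_deriveD _ _ _ _ _ t 1 _ _ d1 d2.
have e : phase n = (fun y => 0 + rate n * y) + ((fun v => 0 + pi * v) \o (fun u => Num.sqrt (n%:R - u))).
  by apply/funext => u; rewrite -[RHS]/((0 + rate n * u) + (0 + pi * Num.sqrt (n%:R - u))) !add0r.
rewrite e; apply: (is_derive_eq d3).
have -> : - (2 * Num.sqrt (n%:R - t))^-1 = - (inv_root n t / 2) by rewrite invfM mulrC.
by rewrite offsetE // /rate; ring.
Qed.

Definition model_fun n p t : R := expR (phase n t) * p.[offset n t].

(** A derivative brings [theta^3], whereas a power of [k] costs [theta^-2] in the moments at
    [rate n]: each order of the Taylor expansion gains [theta]. *)
Lemma is_derive_model_fun n p t : (0 < n)%N -> t < n%:R ->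
  is_derive t 1 (model_fun n p) (theta n ^+ 3 / 2 * model_fun n (scaled_deriv (theta n) p) t).
Proof.
move=> n0 h.
have d1 := @is_derive1_comp R expR (phase n) t _ _ (is_derive_expR _) (is_derive_phase n0 h).
have d2 := @is_derive1_comp R (horner p) (offset n) t _ _ (is_derive_poly _ _) (is_derive_offset n0 h).
have d3 := @is_deriveM _ _ _ _ t 1 _ _ d1 d2.
apply: (@is_derive_eq _ _ _ (model_fun n p) t 1 _ _ d3).
rewrite /model_fun /scaled_deriv /GRing.scale /= .
rewrite !(horner_exp, hornerD, hornerN, hornerC, hornerX, hornerM).
by field.
Qed.

Definition model_deriv n i t : R :=
  (theta n ^+ 3 / 2) ^+ i * theta n ^+ 4 *
    model_fun n (iter i (scaled_deriv (theta n)) (main_poly (theta n))) t.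

Lemma is_derive_model_deriv n i t : (0 < n)%N -> t < n%:R ->
  is_derive t 1 (model_deriv n i) (model_deriv n i.+1 t).
Proof.
move=> n0 h; rewrite /model_deriv iterS.
have d := is_derive_model_fun (iter i (scaled_deriv (theta n)) (main_poly (theta n))) n0 h.
have d2 := @is_derive1_comp R (fun v => 0 + ((theta n ^+ 3 / 2) ^+ i * theta n ^+ 4) * v) _ t _ _ (is_derive_affine _ _ _) d.
set g := (fun t0 : R => _).
have -> : g = (fun v => 0 + ((theta n ^+ 3 / 2) ^+ i * theta n ^+ 4) * v) \o
   model_fun n (iter i (scaled_deriv (theta n)) (main_poly (theta n))).
  by apply/funext => u; rewrite /g /= add0r.
by apply: (is_derive_eq d2); rewrite (exprS (theta n ^+ 3 / 2) i) ; move: (model_fun _ _ t) => m; ring.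
Qed.

(* The formula is [0] at [n = 0]; the value [1] keeps the model positive. *)
Definition model n : R :=
  if n == 0%N then 1 else growth n * (pi * theta n ^+ 4 - theta n ^+ 6).

(** What remains of [c(k) F(n - k)] once [c(k) e^(-k rate)] is set apart for the moments. *)
Lemma model_deriv0 n k : (k < n)%N ->
  model_deriv n 0 k%:R = expR (k%:R * rate n) * model (n - k).
Proof.
move=> kn; have n0 : (0 < n)%N by lia.
rewrite /model_deriv expr0 mul1r /= /model_fun /phase expRD mulrCA [rate n * _]mulrC -mulrA.
have nk0 : (0 < n - k)%N by lia.
have nkE : (n%:R - k%:R : R) = (n - k)%:R by rewrite natrB // ltnW.
congr (_ * _); rewrite /model gtn_eqF // nkE -/(rt _) -/(growth _); congr (_ * _).
have yE : theta (n - k) ^+ 2 = theta n ^+ 2 * (1 + theta n * offset n k%:R).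
  by rewrite -offsetE // theta_sqr /inv_root nkE.
rewrite /main_poly /dual_poly.
rewrite !(horner_exp, hornerD, hornerN, hornerC, hornerX, hornerM).
have -> : theta (n - k) ^+ 4 = (theta (n - k) ^+ 2) ^+ 2 by rewrite -exprM.
have -> : theta (n - k) ^+ 6 = (theta (n - k) ^+ 2) ^+ 3 by rewrite -exprM.
by rewrite yE; ring.
Qed.

Lemma offset0 n : (0 < n)%N -> offset n 0 = 0.
Proof.
move=> n0; rewrite /offset /inv_root subr0 -/(rt n) -theta_sqr.
by field; rewrite gt_eqF // theta_gt0.
Qed.

Lemma model_deriv_at0 n i : (0 < n)%N -> model_deriv n i 0 =
  growth n * ((theta n ^+ 3 / 2) ^+ i * theta n ^+ 4 * main_coef (theta n) i).
Proof.
move=> n0; rewrite /model_deriv /model_fun offset0 // /phase mulr0 add0r subr0.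
by rewrite -/(rt n) -/(growth n) /main_coef; ring.
Qed.

(** Concavity: the square root lies below its tangent at [n]. *)
Lemma phase_le n t : (0 < n)%N -> 0 <= t <= n%:R -> phase n t <= pi * rt n.
Proof.
move=> n0 /andP[t0 tn]; rewrite /phase /rate theta_sqr.
have r0 := rt_gt0 n0.
have -> : pi / 2 * (rt n)^-1 * t = pi * (t / (2 * rt n)) by field; rewrite gt_eqF.
rewrite -mulrDr ler_pM2l ?pi_gt0 // -lerBrDl.
have tr : t / (2 * rt n) <= rt n.
  rewrite ler_pdivrMr ?mulr_gt0 // (_ : rt n * (2 * rt n) = 2 * rt n ^+ 2); last ring.
  rewrite rt_sqr; have : 0 <= (n%:R : R) by []; lra.
rewrite -[X in _ <= X]ger0_norm; last lra.
rewrite -sqrtr_sqr ler_sqrt; last exact: exprn_even_ge0.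
have -> : (rt n - t / (2 * rt n)) ^+ 2 = rt n ^+ 2 - t + (t / (2 * rt n)) ^+ 2.
  by field; rewrite gt_eqF.
by rewrite rt_sqr lerDl exprn_even_ge0.
Qed.

Lemma offset_bounds n t : (0 < n)%N -> 0 <= t <= n%:R / 2 ->
  0 <= offset n t <= theta n ^+ 3 * t.
Proof.
move=> n0 /andP[t0 tn]; have th0 := theta_gt0 n0.
have nn : 0 < (n%:R : R) by rewrite ltr0n.
have d0 : 0 < n%:R - t by lra.
have y0 : 0 < inv_root n t by rewrite invr_gt0 sqrtr_gt0.
have y2 : inv_root n t ^+ 2 = (n%:R - t)^-1 by rewrite exprVn sqr_sqrtr // ltW.
have lo : theta n ^+ 2 <= inv_root n t.
  rewrite theta_sqr lef_pV2 ?posrE ?sqrtr_gt0 ?rt_gt0 //.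
  by rewrite ler_sqrt //; lra.
have hi : inv_root n t <= theta n ^+ 2 + theta n ^+ 6 * t.
  have B0 : 0 <= theta n ^+ 2 + theta n ^+ 6 * t by rewrite addr_ge0 ?mulr_ge0 ?exprn_ge0 // ltW.
  rewrite -(@ler_pXn2r _ 2) ?nnegrE // ?(ltW y0) //.
  rewrite y2 -[_^-1]mul1r ler_pdivrMr //.
  have nE : theta n ^+ 4 * n%:R = 1 by rewrite theta_pow4 mulVf ?gt_eqF.
  have -> : (theta n ^+ 2 + theta n ^+ 6 * t) ^+ 2 * (n%:R - t) =
    (theta n ^+ 4 * n%:R - theta n ^+ 4 * t) * (1 + theta n ^+ 4 * t) ^+ 2 by ring.
  (* The claim becomes [(1 - x) (1 + x)^2 >= 1], true on [[0, 1/2]]; the range of [x] comes from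
     [t <= n / 2]. *)
  rewrite nE; set x := theta n ^+ 4 * t.
  have x0 : 0 <= x by rewrite mulr_ge0 // exprn_ge0 // ltW.
  have x1 : x <= 1 / 2.
    have : x <= theta n ^+ 4 * (n%:R / 2) by rewrite ler_wpM2l // exprn_ge0 // ltW.
    by rewrite mulrA nE.
  nra.
have th3 : 0 < theta n ^+ 3 by rewrite exprn_gt0.
have -> : offset n t = (inv_root n t - theta n ^+ 2) / theta n ^+ 3.
  by rewrite /offset; field; rewrite gt_eqF.
rewrite divr_ge0 ?(ltW th3) ?subr_ge0 //= ler_pdivrMr //.
have -> : theta n ^+ 3 * t * theta n ^+ 3 = theta n ^+ 6 * t by ring.
by rewrite lerBlDl.
Qed.

Lemma model_deriv_bound i :
  exists2 C, 0 <= C & exists N, forall n t, (0 < n)%N -> 0 <= t <= n%:R / 2 ->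
   `|model_deriv n i t| <= C * growth n * theta n ^+ (3 * i + 4) * (1 + theta n ^+ 3 * t) ^+ N.
Proof.
have [C C0 [N hN]] := scaled_poly_bound R i; exists C => //; exists N => n t n0 ht.
have th0 := theta_gt0 n0; have th1 := theta_le1 n0.
have /andP[u0 u1] := offset_bounds n0 ht.
have hth : 0 <= theta n <= 1 by rewrite (ltW th0).
have [hP _] := hN _ _ hth u0.
have /andP[t0 tn] := ht; have nn : 0 <= (n%:R : R) by [].
have hph : phase n t <= pi * rt n by apply: phase_le => //; apply/andP; split; lra.
have d0 : 0 <= theta n ^+ 3 / 2 by rewrite divr_ge0 // exprn_ge0 // ltW.
have t40 : 0 <= theta n ^+ 4 by rewrite exprn_ge0 // ltW.
rewrite /model_deriv /model_fun (normrM (_ ^+ i * _)) (normrM (expR _)) (ger0_norm (expR_ge0 _)).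
rewrite (ger0_norm (mulr_ge0 (exprn_ge0 i d0) t40)).
have -> : C * growth n * theta n ^+ (3 * i + 4) * (1 + theta n ^+ 3 * t) ^+ N =
  (theta n ^+ 3) ^+ i * theta n ^+ 4 * (growth n * (C * (1 + theta n ^+ 3 * t) ^+ N)).
  by rewrite exprD exprM; ring.
apply: ler_pM; [by rewrite mulr_ge0 // exprn_ge0|by rewrite mulr_ge0 ?normr_ge0 ?expR_ge0| |].
  apply: ler_wpM2r => //; apply: lerXn2r; rewrite ?nnegrE //; lra.
apply: ler_pM; rewrite ?expR_ge0 ?normr_ge0 //; first by rewrite ler_expR.
apply: le_trans hP _; rewrite ler_wpM2l //; apply: lerXn2r; rewrite ?nnegrE; lra.
Qed.

End Model.

Lemma half_mul2_le k n : (k <= n./2)%N -> (k * 2 <= n)%N.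
Proof. by have := odd_double_half n; rewrite -addnn; lia. Qed.

Lemma lt_mul2_half_succ n : (n < n./2.+1 * 2)%N.
Proof. by have := odd_double_half n; rewrite -addnn; case: (odd n); lia. Qed.

(** * Expansion of the sum over the lags up to [n / 2] *)

Section ApproxRecurrence.
Variable R : realType.
Implicit Types (n k i L N K : nat).
Local Notation theta := (theta R).
Local Notation rt := (rt R).
Local Notation rate := (rate R).
Local Notation growth := (growth R).
Local Notation model := (model R).

Lemma inv_rate_pow_le n p : (0 < n)%N -> (rate n ^+ p)^-1 <= (theta n ^+ (2 * p))^-1.
Proof.
move=> n0; have t0 := theta_gt0 R n0; have z0 := rate_gt0 R n0.
rewrite lef_pV2 ?posrE ?exprn_gt0 // exprM; apply: lerXn2r; rewrite ?nnegrE ?(ltW z0) //.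
  by rewrite exprn_ge0 // ltW.
exact: theta_le_rate.
Qed.

Lemma rate_le_theta n : rate n <= 2 * theta n ^+ 2.
Proof.
by rewrite /rate ler_wpM2r ?exprn_even_ge0 // ltW // pihalf_lt2.
Qed.

Lemma taylor_model n k L (B : R) : (k <= n./2)%N -> (0 < n)%N ->
  (forall t, 0 <= t <= k%:R -> `|model_deriv n L t| <= B) ->
  `|expR (k%:R * rate n) * model (n - k) - \sum_(i < L) model_deriv n i (0 : R) / i`!%:R * k%:R ^+ i|
    <= B * k%:R ^+ L.
Proof.
move=> kn n0 hB; have kn2 : (k < n)%N by have := half_mul2_le kn; lia.
have kn3 : (k%:R : R) < n%:R by rewrite ltr_nat.
have := @taylor_bound_right R L (model_deriv n) k%:R B (ler0n _ _).
rewrite model_deriv0 // => h; apply: le_trans (h _ hB) _.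
  move=> i x _ /andP[_ xk]; apply: is_derive_model_deriv => //.
  exact: le_lt_trans kn3.
rewrite ler_pdivrMr ?ltr0n ?fact_gt0 // ler_peMr ?ler1n ?fact_gt0 //.
rewrite mulr_ge0 ?exprn_ge0 //; apply: le_trans (hB 0 _) => //.
by rewrite lexx /=.
Qed.

Lemma one_plus_pow_le (x : R) N : 0 <= x -> (1 + x) ^+ N <= 2 ^+ N * (1 + x ^+ N).
Proof.
move=> x0; have xN : 0 <= x ^+ N by rewrite exprn_ge0.
case: (lerP x 1) => hx.
  apply: le_trans (_ : 2 ^+ N <= _).
    by apply: lerXn2r; rewrite ?nnegrE; lra.
  by rewrite ler_peMr ?exprn_ge0 // lerDl.
apply: le_trans (_ : (2 * x) ^+ N <= _).
  by apply: lerXn2r; rewrite ?nnegrE; lra.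
by rewrite exprMn ler_wpM2l ?exprn_ge0 // lerDr.
Qed.

Lemma head_remainder K :
  exists2 C, 0 <= C & forall n, (3 < n)%N ->
   `|\sum_(k < n./2.+1) codiv R k * expR (- (k%:R * rate n)) *
      (expR (k%:R * rate n) * model (n - k)
        - \sum_(i < K.+2) model_deriv n i (0 : R) / i`!%:R * k%:R ^+ i)|
   <= C * growth n * theta n ^+ K.
Proof.
have [C C0 [N hN]] := model_deriv_bound R K.+2.
(* The remainder of order [K.+2] carries [theta^(3 (K+2) + 4)] and the crude moment costs
   [theta^(-2 (K+5))], which leaves [theta^K]. [x2] is the same count in the presence of
   [(theta^3 k)^N]. *)
have x1 : (3 * K.+2 + 4 = K + 2 * K.+2.+3)%N by lia.
have x2 : (3 * K.+2 + 4 + 3 * N = (K + N) + 2 * (K.+2 + N).+3)%N by lia.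
have [D D0 hD] := codiv_moment_sum_bound R K.+2.
have [E E0 hE] := codiv_moment_sum_bound R (K.+2 + N).
exists (C * 2 ^+ N * (D + E)); first by rewrite !mulr_ge0 ?exprn_ge0 ?addr_ge0.
move=> n n3; have n0 : (0 < n)%N by apply: ltn_trans n3.
have t0 := theta_gt0 R n0; have t1 := theta_le1 R n0; have tt0 := ltW t0.
have hz := rate_bounds R n3; have g0 := growth_gt0 R n.
apply: le_trans (ler_norm_sum _ _ _) _.
pose c : R := C * growth n * theta n ^+ (3 * K.+2 + 4) * 2 ^+ N.
have tp p : 0 <= theta n ^+ p by rewrite exprn_ge0.
have gg := ltW g0; have p2 : 0 <= (2 : R) ^+ N by rewrite exprn_ge0.
have Cg : 0 <= C * growth n by rewrite mulr_ge0.
have Cg2 : 0 <= C * growth n * theta n ^+ (3 * K.+2 + 4) by rewrite (mulr_ge0 Cg).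
have c0 : 0 <= c by rewrite (mulr_ge0 Cg2).
apply: le_trans (_ : \sum_(k < n./2.+1) c * (codiv R k * k%:R ^+ K.+2 * expR (- (k%:R * rate n))
    + theta n ^+ (3 * N) * (codiv R k * k%:R ^+ (K.+2 + N) * expR (- (k%:R * rate n)))) <= _).
  apply: ler_sum => k _; have kn : (k <= n./2)%N by rewrite -ltnS.
  have kn2 : (k%:R : R) <= n%:R / 2.
    by rewrite ler_pdivlMr // -natrM ler_nat half_mul2_le.
  have w0 : 0 <= 1 + theta n ^+ 3 * k%:R by rewrite addr_ge0 ?mulr_ge0 ?exprn_ge0.
  have T := @taylor_model n k K.+2 (c * (1 + (theta n ^+ 3 * k%:R) ^+ N)) kn n0.
  rewrite normrM ger0_norm ?mulr_ge0 ?expR_ge0 ?codiv_ge0 //.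
  have {}T := T _.
  apply: le_trans (ler_wpM2l _ (T _)) _; first by rewrite mulr_ge0 ?expR_ge0 ?codiv_ge0.
    move=> t /andP[ht0 htk].
    have ht : 0 <= t <= n%:R / 2 by rewrite ht0 (le_trans htk).
    apply: le_trans (hN n t n0 ht) _.
    rewrite /c -[X in _ <= X]mulrA; apply: ler_wpM2l => //.
    apply: le_trans (one_plus_pow_le N _); last by rewrite mulr_ge0 ?exprn_ge0.
    apply: lerXn2r; rewrite ?nnegrE //; last by rewrite lerD2l ler_wpM2l ?exprn_ge0.
    by rewrite addr_ge0 ?mulr_ge0 ?exprn_ge0.
  rewrite le_eqVlt; apply/orP; left; apply/eqP.
  by rewrite exprMn -exprM (exprD _ K.+2 N); ring.
rewrite -big_distrr /= big_split /= -big_distrr /=.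
have S1 := hD (rate n) (n./2.+1) hz; have S2 := hE (rate n) (n./2.+1) hz.
rewrite /codiv_moment_sum in S1 S2.
have q p : theta n ^+ p != 0 by rewrite gt_eqF // exprn_gt0.
have B1 := le_trans S1 (ler_wpM2l D0 (inv_rate_pow_le _ n0)).
have B2 := ler_wpM2l (tp (3 * N)%N) (le_trans S2 (ler_wpM2l E0 (inv_rate_pow_le _ n0))).
apply: le_trans (ler_wpM2l c0 (lerD B1 B2)) _.
rewrite /c.
have e1 : theta n ^+ (3 * K.+2 + 4) / theta n ^+ (2 * K.+2.+3) = theta n ^+ K.
  by rewrite x1 exprD mulfK.
have e2 : theta n ^+ (3 * K.+2 + 4) * (theta n ^+ (3 * N) / theta n ^+ (2 * (K.+2 + N).+3)) <= theta n ^+ K.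
  have -> : theta n ^+ (3 * K.+2 + 4) * (theta n ^+ (3 * N) / theta n ^+ (2 * (K.+2 + N).+3)) = theta n ^+ (K + N).
    by rewrite mulrA -exprD x2 exprD mulfK.
  by rewrite exprD ler_piMr // exprn_ile1.
have -> : C * growth n * theta n ^+ (3 * K.+2 + 4) * 2 ^+ N *
   (D / theta n ^+ (2 * K.+2.+3) + theta n ^+ (3 * N) * (E / theta n ^+ (2 * (K.+2 + N).+3))) =
   C * growth n * 2 ^+ N * (D * (theta n ^+ (3 * K.+2 + 4) / theta n ^+ (2 * K.+2.+3)) +
    E * (theta n ^+ (3 * K.+2 + 4) * (theta n ^+ (3 * N) / theta n ^+ (2 * (K.+2 + N).+3)))) by ring.
rewrite e1.
have -> : C * 2 ^+ N * (D + E) * growth n * theta n ^+ K =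
  C * growth n * 2 ^+ N * (D * theta n ^+ K + E * theta n ^+ K) by ring.
apply: ler_wpM2l; first by rewrite (mulr_ge0 Cg).
by rewrite lerD2l ler_wpM2l.
Qed.

(** For [k >= X] one has [e^(-k z) <= e^(-X z / 2) e^(-k z / 2)]. *)
Lemma moment_tail i (z : R) X : 0 < z <= 1 ->
  codiv_moment i z - codiv_moment_sum i z X <= expR (- (X%:R * (z / 2))) * codiv_moment i (z / 2).
Proof.
move=> hz; have /andP[z0 z1] := hz.
have hz2 : 0 < z / 2 <= 1 by apply/andP; split; lra.
rewrite lerBlDl; apply: (lim_seq_le_cst (codiv_moment_cvg hz)) => Y.
rewrite -lerBlDl.
have [YX|XY] := leqP Y X.
  apply: le_trans (_ : 0 <= _).
    by rewrite subr_le0; apply: codiv_moment_sum_nondecreasing.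
  by rewrite mulr_ge0 ?expR_ge0 ?codiv_moment_ge0.
apply: le_trans (ler_wpM2l (expR_ge0 _) (codiv_moment_sum_le i Y hz2)).
rewrite /codiv_moment_sum -(subnKC (ltnW XY)) !big_split_ord /= addrAC subrr add0r.
rewrite mulrDr; apply: ler_wpDl.
  by rewrite mulr_ge0 ?expR_ge0 // sumr_ge0 // => k _; exact: codiv_term_ge0.
rewrite big_distrr /=; apply: ler_sum => k _.
rewrite mulrCA; apply: ler_wpM2l.
  by rewrite mulr_ge0 ?codiv_ge0 // exprn_ge0.
rewrite -expRD ler_expR natrD.
have : 0 <= (k%:R : R) * z by rewrite mulr_ge0 // ltW.
lra.
Qed.

Lemma moment_sum_asymp i K :
  exists2 C, 0 <= C & forall n, (3 < n)%N ->
   `|codiv_moment_sum i (rate n) (n./2.+1) - moment_main i (rate n)| <= C * theta n ^+ K.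
Proof.
have [C C0 hC] := codiv_moment_asymp R i K.
have [D D0 hD] := codiv_moment_bound R i.
(* From [(n / 2) (rate n / 2) = pi sqrt n / 8]; the [2 * i.+3] orders in the next line repay the
   crude moment bound. *)
have a0 : 0 < pi / 8 :> R by rewrite divr_gt0 // pi_gt0.
have [E E0 hE] := theta_exp_small (K + 2 * i.+3) a0.
exists (2 ^+ K * C + E * (D * 2 ^+ i.+3)).
  have p2 p : 0 <= (2 : R) ^+ p by rewrite exprn_ge0.
  by rewrite addr_ge0 // mulr_ge0 // mulr_ge0.
move=> n n3; have n0 : (0 < n)%N by apply: ltn_trans n3.
have t0 := theta_gt0 R n0; have t1 := theta_le1 R n0; have tt0 := ltW t0.
have hz := rate_bounds R n3; have /andP[z0 z1] := hz.
have hz2 : 0 < rate n / 2 <= 1 by apply/andP; split; lra.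
have T := moment_tail i (n./2.+1) hz.
have P := codiv_moment_sum_le i (n./2.+1) hz.
have A := hC _ hz.
have zK : rate n ^+ K <= 2 ^+ K * theta n ^+ K.
  apply: le_trans (_ : (2 * theta n ^+ 2) ^+ K <= _).
    by apply: lerXn2r; rewrite ?nnegrE ?(ltW z0) ?mulr_ge0 ?exprn_ge0 // rate_le_theta.
  rewrite exprMn ler_wpM2l ?exprn_ge0 // -exprM mulnC exprM expr2 ler_piMr ?exprn_ge0 //.
  by rewrite exprn_ile1.
have B : expR (- (n./2.+1%:R * (rate n / 2))) * codiv_moment i (rate n / 2)
    <= E * (D * 2 ^+ i.+3) * theta n ^+ K.
  apply: le_trans (_ : (E * theta n ^+ (K + 2 * i.+3)) * (D * 2 ^+ i.+3 / theta n ^+ (2 * i.+3)) <= _).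
    apply: ler_pM; rewrite ?expR_ge0 ?codiv_moment_ge0 //.
      apply: le_trans (hE n n0); rewrite ler_expR lerN2.
      rewrite /rate theta_sqr.
      have r0 := rt_gt0 R n0.
      have -> : n./2.+1%:R * (pi / 2 / rt n / 2) = pi / 8 * (2 * n./2.+1%:R / rt n) by field; rewrite gt_eqF.
      rewrite ler_pM2l // ler_pdivlMr // -expr2 rt_sqr -natrM ler_nat.
      by rewrite mulnC ltnW // lt_mul2_half_succ.
    apply: le_trans (hD _ hz2) _.
    rewrite expr_div_n invf_div -mulrA; apply: ler_wpM2l => //.
    by apply: ler_wpM2l; [rewrite exprn_ge0 | exact: inv_rate_pow_le].
  rewrite exprD le_eqVlt; apply/orP; left; apply/eqP; field.
  by rewrite gt_eqF // exprn_gt0.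
set Gs := codiv_moment_sum _ _ _ in T P *; set G := codiv_moment i (rate n) in T P A.
set m := moment_main _ _ in A *.
have -> : Gs - m = (G - m) - (G - Gs) by ring.
apply: le_trans (ler_normB _ _) _; rewrite mulrDl; apply: lerD.
  by apply: le_trans A _; rewrite -mulrA mulrCA; apply: ler_wpM2l.
by rewrite ger0_norm ?subr_ge0 //; apply: le_trans T B.
Qed.

(** [neumann_identity] for the derivatives of the tilted [F] and [x F(x)]: its term [k 0] is
    [n F(n)], the others are boundary terms of order [theta^L]. *)
Lemma head_main L :
  exists2 C, 0 <= C & forall n, (3 < n)%N ->
   `|\sum_(i < L) model_deriv n i (0 : R) / i`!%:R * moment_main i (rate n) - n%:R * model n|
     <= C * growth n * theta n ^+ L.
Proof.
have [C C0 [N hN]] := scaled_poly_bound R L.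
have [D D0 [M hM]] := scaled_poly_bound R L.+1.
exists (L.+1%:R * C + L%:R * D + L%:R * C); first by rewrite !addr_ge0 ?mulr_ge0.
move=> n n3; have n0 : (0 < n)%N by apply: ltn_trans n3.
have t0 := theta_gt0 R n0; have t1 := theta_le1 R n0; have tt0 := ltW t0.
have /andP[z0 z1] := rate_bounds R n3; have g0 := growth_gt0 R n.
have ht : 0 <= theta n <= 1 by rewrite tt0.
have [hm hd] := hN _ 0 ht (lexx 0); have [_ hd'] := hM _ 0 ht (lexx 0).
rewrite addr0 expr1n mulr1 in hm hd; rewrite addr0 expr1n mulr1 in hd'.
rewrite -/(main_coef _ _) in hm; rewrite -/(dual_coef _ _) in hd; rewrite -/(dual_coef _ _) in hd'.
pose d : R := theta n ^+ 3 / 2.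
pose kk i := growth n * (d ^+ i * dual_coef (theta n) i).
have ode i : rate n ^+ 2 * kk i - 2 * rate n * kk i.+1 + kk i.+2 =
    pi ^+ 2 / 4 * model_deriv n i 0 - (rate n * model_deriv n i 0 - model_deriv n i.+1 0) / 2.
  rewrite !model_deriv_at0 // /kk -/d.
  have := coef_ode (theta n) i.
  rewrite (exprS d i.+1) (exprS d i).
  move: (dual_coef _ i) (dual_coef _ i.+1) (dual_coef _ i.+2) (main_coef _ i) (main_coef _ i.+1).
  move: (d ^+ i) => di a0 a1 a2 b0 b1 h.
  transitivity (growth n * di / 4 * (pi ^+ 2 * theta n ^+ 4 * a0 - 2 * pi * theta n ^+ 5 * a1 + theta n ^+ 6 * a2)).
    by rewrite /rate /d; field.
  by rewrite h /rate /d; field.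
have I := @neumann_identity R (rate n) (pi ^+ 2 / 4) kk (fun i => model_deriv n i 0) (lt0r_neq0 z0) ode L.
have -> : \sum_(i < L) model_deriv n i 0 / i`!%:R * moment_main i (rate n) =
   \sum_(i < L) model_deriv n i 0 * (pi ^+ 2 / 4 * i.+1%:R / rate n ^+ i.+2 - (2 * rate n ^+ i.+1)^-1).
  apply: eq_bigr => i _; rewrite /moment_main -mulrA; congr (_ * _).
  rewrite (factS i) natrM; field.
  by rewrite !expf_neq0 ?lt0r_neq0 //= ltr0n fact_gt0.
have k0E : kk 0%N = n%:R * model n.
  have nE : n%:R * theta n ^+ 4 = 1 by rewrite theta_pow4 mulfV // pnatr_eq0 -lt0n.
  have -> : n%:R * model n = growth n * (pi * (n%:R * theta n ^+ 4) - n%:R * theta n ^+ 4 * theta n ^+ 2).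
    by rewrite /model gtn_eqF //; ring.
  rewrite nE /kk expr0 /dual_coef /= /dual_poly.
  by rewrite !(horner_exp, hornerD, hornerN, hornerC, hornerX, hornerM); ring.
rewrite I k0E.
have zi p : (rate n ^+ p)^-1 <= (theta n ^+ (2 * p))^-1 by apply: inv_rate_pow_le.
have dp p : 0 <= d ^+ p by rewrite exprn_ge0 // divr_ge0 // exprn_ge0.
(* The derivative scale [d = theta^3 / 2] against [rate >= theta^2] leaves at most [theta] per
   order. *)
have dz p : d ^+ p / rate n ^+ p <= theta n ^+ p.
  apply: le_trans (_ : theta n ^+ (3 * p) / theta n ^+ (2 * p) <= _).
    apply: ler_pM => //; first by rewrite invr_ge0 exprn_ge0 // ltW.
    rewrite exprM; apply: lerXn2r; rewrite ?nnegrE ?exprn_ge0 ?divr_ge0 ?exprn_ge0 //.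
    by rewrite /d ler_pdivrMr // ler_peMr ?exprn_ge0 //; lra.
  by rewrite (mulSn 2 p) exprD mulfK // expf_neq0 // lt0r_neq0.
have tL : 0 <= theta n ^+ L by rewrite exprn_ge0.
have zinv p : 0 <= (rate n ^+ p)^-1 by rewrite invr_ge0 exprn_ge0 // ltW.
have t1L : theta n ^+ L.+1 <= theta n ^+ L by rewrite exprS ler_piMl.
have R1 : `|L.+1%:R * kk L / rate n ^+ L| <= L.+1%:R * C * growth n * theta n ^+ L.
  have -> : L.+1%:R * kk L / rate n ^+ L = (L.+1%:R * growth n) * (d ^+ L / rate n ^+ L) * dual_coef (theta n) L.
    by rewrite /kk; ring.
  rewrite normrM ger0_norm; last by rewrite !mulr_ge0 // ltW.
  have -> : L.+1%:R * C * growth n * theta n ^+ L = (L.+1%:R * growth n) * theta n ^+ L * C by ring.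
  apply: ler_pM => //; first by rewrite !mulr_ge0 // ltW.
  by apply: ler_wpM2l => //; rewrite mulr_ge0 // ltW.
have R2 : `|L%:R * kk L.+1 / rate n ^+ L.+1| <= L%:R * D * growth n * theta n ^+ L.
  have -> : L%:R * kk L.+1 / rate n ^+ L.+1 = (L%:R * growth n) * (d ^+ L.+1 / rate n ^+ L.+1) * dual_coef (theta n) L.+1.
    by rewrite /kk; ring.
  rewrite normrM ger0_norm; last by rewrite !mulr_ge0 // ltW.
  have -> : L%:R * D * growth n * theta n ^+ L = (L%:R * growth n) * theta n ^+ L * D by ring.
  apply: ler_pM => //; first by rewrite !mulr_ge0 // ltW.
  by apply: ler_wpM2l; [rewrite mulr_ge0 // ltW | exact: le_trans (dz _) t1L].
have R3 : `|L%:R * model_deriv n L 0 / (2 * rate n ^+ L.+1)| <= L%:R * C * growth n * theta n ^+ L.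
  have -> : L%:R * model_deriv n L 0 / (2 * rate n ^+ L.+1) =
     (L%:R * growth n) * (d ^+ L / rate n ^+ L * (theta n ^+ 4 / (2 * rate n))) * main_coef (theta n) L.
    by rewrite model_deriv_at0 // -/d (exprS (rate n) L) !invfM; ring.
  have q0 : 0 <= theta n ^+ 4 / (2 * rate n) by rewrite divr_ge0 ?exprn_ge0 // mulr_ge0 // ltW.
  have q1 : theta n ^+ 4 / (2 * rate n) <= 1.
    have rr : 0 < 2 * rate n by rewrite mulr_gt0.
    rewrite (ler_pdivrMr _ _ rr) mul1r.
    apply: le_trans (_ : theta n ^+ 2 <= _).
      by rewrite (exprM (theta n) 2 2) expr2 ler_piMl ?exprn_ge0 // exprn_ile1.
    by have := theta_le_rate R n; lra.
  move: (theta n ^+ 4 / (2 * rate n)) q0 q1 => e q0 q1.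
  rewrite normrM ger0_norm; last by rewrite !mulr_ge0 // ltW.
  have -> : L%:R * C * growth n * theta n ^+ L = (L%:R * growth n) * theta n ^+ L * C by ring.
  apply: ler_pM => //; first by rewrite !mulr_ge0 // ltW.
  apply: ler_wpM2l; first by rewrite mulr_ge0 // ltW.
  by rewrite -[X in _ <= X]mulr1; apply: ler_pM => //; rewrite mulr_ge0.
set x1 := L.+1%:R * _ / _ in R1 *; set x2 := L%:R * kk _ / _ in R2 *; set x3 := L%:R * model_deriv _ _ _ / _ in R3 *.
have -> : n%:R * model n - x1 + x2 - x3 - n%:R * model n = - x1 + x2 - x3 by ring.
apply: le_trans (ler_normB _ _) _; apply: le_trans (lerD (ler_normD _ _) (lexx _)) _.
rewrite normrN; apply: le_trans (lerD (lerD R1 R2) R3) _.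
by rewrite le_eqVlt; apply/orP; left; apply/eqP; ring.
Qed.

End ApproxRecurrence.

(** * The approximate recurrence of the model *)

Section ModelRecurrence.
Variable R : realType.
Implicit Types (n k i L N K : nat).
Local Notation theta := (theta R).
Local Notation rt := (rt R).
Local Notation rate := (rate R).
Local Notation growth := (growth R).
Local Notation model := (model R).

Lemma mul_model n : (0 < n)%N -> n%:R * model n = growth n * (pi - theta n ^+ 2).
Proof.
move=> n0; have nE : n%:R * theta n ^+ 4 = 1 by rewrite theta_pow4 mulfV // pnatr_eq0 -lt0n.
have -> : growth n * (pi - theta n ^+ 2) = growth n * (pi * (n%:R * theta n ^+ 4) - n%:R * theta n ^+ 4 * theta n ^+ 2).
  by rewrite nE; ring.
by rewrite /model gtn_eqF //; ring.
Qed.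

Lemma growth_le_mul_model n : (0 < n)%N -> growth n <= n%:R * model n.
Proof.
move=> n0; rewrite mul_model // ler_peMr ?(ltW (growth_gt0 _ _)) //.
have t0 := theta_gt0 R n0; have t1 := theta_le1 R n0; have := pi_ge2 R.
have : theta n ^+ 2 <= 1 by rewrite exprn_ile1 // ltW.
lra.
Qed.

Lemma model_gt0 n : 0 < model n.
Proof.
case: (posnP n) => [->|n0]; first by rewrite /model eqxx.
have := lt_le_trans (growth_gt0 R n) (growth_le_mul_model n0).
by rewrite pmulr_rgt0 // ltr0n.
Qed.

Lemma model_le n : model n <= pi * growth n.
Proof.
case: (posnP n) => [->|n0].
  rewrite /model eqxx growth0 mulr1.
  by have := pi_ge2 R; lra.
rewrite /model gtn_eqF // mulrC ler_wpM2r ?(ltW (growth_gt0 _ _)) //.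
have t0 := theta_gt0 R n0; have t1 := theta_le1 R n0.
have t6 : 0 <= theta n ^+ 6 by rewrite exprn_ge0 // ltW.
have : pi * theta n ^+ 4 <= pi by rewrite ler_piMr ?pi_ge0 // exprn_ile1 // ltW.
lra.
Qed.

Lemma growth_decay n k : (0 < n)%N -> (k <= n)%N ->
  growth (n - k) <= growth n * expR (- (k%:R * rate n)).
Proof.
move=> n0 kn; rewrite /growth -expRD ler_expR.
have hk : 0 <= (k%:R : R) <= n%:R by rewrite ler0n ler_nat.
have := phase_le n0 hk; rewrite /phase -natrB // -/(rt _).
have -> : rate n * k%:R = k%:R * rate n by rewrite mulrC.
lra.
Qed.

Lemma model_decay n k : (0 < n)%N -> (k <= n)%N ->
  model (n - k) <= pi * (growth n * expR (- (k%:R * rate n))).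
Proof.
move=> n0 kn; apply: le_trans (model_le _) _; apply: ler_wpM2l; first exact: pi_ge0.
exact: growth_decay.
Qed.

Lemma rate_pow_le n K : (0 < n)%N -> rate n ^+ K <= 2 ^+ K * theta n ^+ K.
Proof.
move=> n0; have t0 := theta_gt0 R n0; have t1 := theta_le1 R n0; have tt0 := ltW t0.
apply: le_trans (_ : (2 * theta n ^+ 2) ^+ K <= _).
  apply: lerXn2r; rewrite ?nnegrE ?(ltW (rate_gt0 _ _)) ?rate_le_theta //.
  by rewrite mulr_ge0 // exprn_ge0.
rewrite exprMn ler_wpM2l ?exprn_ge0 // -exprM mulnC exprM expr2 ler_piMr ?exprn_ge0 //.
by rewrite exprn_ile1.
Qed.

Lemma moment_gap K :
  exists2 C, 0 <= C & forall n, (3 < n)%N ->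
   codiv_moment 0 (rate n) - codiv_moment_sum 0 (rate n) (n./2.+1) <= C * theta n ^+ K.
Proof.
have [C C0 hC] := codiv_moment_asymp R 0 K; have [D D0 hD] := moment_sum_asymp R 0 K.
exists (C * 2 ^+ K + D); first by rewrite addr_ge0 // mulr_ge0 // exprn_ge0.
move=> n n3; have n0 : (0 < n)%N by apply: ltn_trans n3.
have A := hC _ (rate_bounds R n3); have B := hD n n3.
rewrite mulrDl -mulrA.
have A' := le_trans A (ler_wpM2l C0 (rate_pow_le K n0)).
apply: le_trans (lerD A' B).
set G := codiv_moment _ _; set S := codiv_moment_sum _ _ _; set m := moment_main _ _.
have -> : G - S = (G - m) - (S - m) by ring.
by apply: le_trans (ler_norm _) _; apply: ler_normB.
Qed.

(** Past [n / 2] nothing is expanded: the terms are dominated by those of the moment of order 0,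
    whose tail is small to every order. *)
Lemma tail_bound K :
  exists2 C, 0 <= C & forall n, (3 < n)%N ->
   `|\sum_(n./2.+1 <= k < n.+1) codiv R k * model (n - k)| <= C * (growth n * theta n ^+ K).
Proof.
have [C C0 hC] := moment_gap K.
exists (pi * C); first by rewrite mulr_ge0 // pi_ge0.
move=> n n3; have n0 : (0 < n)%N by apply: ltn_trans n3.
have hX : (n./2.+1 <= n.+1)%N by rewrite ltnS; have := half_mul2_le (leqnn n./2); lia.
have g0 := growth_gt0 R n.
rewrite ger0_norm; last first.
  by apply: sumr_ge0 => k _; rewrite mulr_ge0 ?codiv_ge0 // ltW // model_gt0.
apply: le_trans (_ : pi * growth n * (codiv_moment 0 (rate n) - codiv_moment_sum 0 (rate n) (n./2.+1)) <= _); last first.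
  have -> : pi * C * (growth n * theta n ^+ K) = pi * growth n * (C * theta n ^+ K) by ring.
  by apply: ler_wpM2l; [rewrite mulr_ge0 ?pi_ge0 // ltW | exact: hC].
have P := codiv_moment_sum_le 0 n.+1 (rate_bounds R n3).
apply: le_trans (_ : pi * growth n * (codiv_moment_sum 0 (rate n) n.+1 - codiv_moment_sum 0 (rate n) (n./2.+1)) <= _); last first.
  by apply: ler_wpM2l; [rewrite mulr_ge0 ?pi_ge0 // ltW | rewrite lerD2r].
rewrite /codiv_moment_sum -(big_mkord xpredT (fun k => codiv R k * k%:R ^+ 0 * expR (- (k%:R * rate n)))).
rewrite -(big_mkord xpredT (fun k => codiv R k * k%:R ^+ 0 * expR (- (k%:R * rate n)))).
rewrite (@big_cat_nat _ _ _ n./2.+1 0 n.+1) //= addrAC subrr add0r big_distrr /=.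
rewrite !big_nat; apply: ler_sum => k /andP[_ kn]; rewrite ltnS in kn.
have := model_decay n0 kn => h; apply: le_trans (ler_wpM2l (codiv_ge0 _ _) h) _.
by rewrite expr0 le_eqVlt; apply/orP; left; apply/eqP; ring.
Qed.

Lemma head_moments L K :
  exists2 C, 0 <= C & forall n, (3 < n)%N ->
   `|\sum_(i < L) model_deriv n i (0 : R) / i`!%:R *
      (codiv_moment_sum i (rate n) (n./2.+1) - moment_main i (rate n))|
   <= C * (growth n * theta n ^+ K).
Proof.
apply: (@sum_bound R nat (fun n => (3 < n)%N) (fun i n => model_deriv n i (0 : R) / i`!%:R *
      (codiv_moment_sum i (rate n) (n./2.+1) - moment_main i (rate n)))) => i _.
have [C C0 [N hN]] := model_deriv_bound R i; have [D D0 hD] := moment_sum_asymp R i K.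
exists (C * D); first exact: mulr_ge0.
move=> n n3; have n0 : (0 < n)%N by apply: ltn_trans n3.
have g0 := growth_gt0 R n; have t0 := theta_gt0 R n0; have t1 := theta_le1 R n0.
have hn : 0 <= (0 : R) <= n%:R / 2 by rewrite lexx /= divr_ge0.
have := hN n 0 n0 hn; rewrite mulr0 addr0 expr1n mulr1 => h.
rewrite normrM.
have -> : C * D * (growth n * theta n ^+ K) = (C * growth n) * (D * theta n ^+ K) by ring.
apply: ler_pM; rewrite ?normr_ge0 //; last exact: hD.
rewrite normrM normfV normr_nat ler_pdivrMr ?ltr0n ?fact_gt0 //.
apply: le_trans h _; apply: ler_pM.
- by rewrite mulr_ge0 // ltW.
- by rewrite exprn_ge0 // ltW.
- by [].
- apply: le_trans (_ : 1 <= _); first by rewrite exprn_ile1 // ltW.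
  by rewrite ler1n fact_gt0.
Qed.

(** The sum is cut at [n / 2]: [T] is the tail, [Rm] collects the Taylor remainders, [Mm] the errors
    of replacing truncated moments by main terms, and [Mn] is the main sum. *)
Lemma model_recurrence K :
  exists2 C, 0 <= C & forall n, (3 < n)%N ->
   `|\sum_(k < n.+1) codiv R k * model (n - k) - n%:R * model n|
     <= C * theta n ^+ K * (n%:R * model n).
Proof.
have [C1 C10 h1] := tail_bound K; have [C2 C20 h2] := head_remainder R K.
have [C3 C30 h3] := head_moments K.+2 K; have [C4 C40 h4] := head_main R K.+2.
exists (C1 + C2 + C3 + C4); first by rewrite !addr_ge0.
move=> n n3; have n0 : (0 < n)%N by apply: ltn_trans n3.
have hX : (n./2.+1 <= n.+1)%N by rewrite ltnS; have := half_mul2_le (leqnn n./2); lia.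
have g0 := growth_gt0 R n; have t0 := theta_gt0 R n0; have t1 := theta_le1 R n0.
have tK : 0 <= theta n ^+ K by rewrite exprn_ge0 // ltW.
apply: le_trans (_ : (C1 + C2 + C3 + C4) * theta n ^+ K * growth n <= _); last first.
  apply: ler_wpM2l; last exact: growth_le_mul_model.
  by rewrite mulr_ge0 // !addr_ge0.
have A1 := h1 n n3; have A2 := h2 n n3; have A3 := h3 n n3.
have A4 : `|\sum_(i < K.+2) model_deriv n i (0 : R) / i`!%:R * moment_main i (rate n) - n%:R * model n|
     <= C4 * growth n * theta n ^+ K.
  apply: le_trans (h4 n n3) _; apply: ler_wpM2l; first by rewrite mulr_ge0 // ltW.
  by rewrite -addn2 exprD ler_piMr // exprn_ile1 // ltW.
have -> : \sum_(k < n.+1) codiv R k * model (n - k) =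
  \sum_(k < n./2.+1) codiv R k * model (n - k) + \sum_(n./2.+1 <= k < n.+1) codiv R k * model (n - k).
  rewrite -(big_mkord xpredT (fun k => codiv R k * model (n - k))) (@big_cat_nat _ _ _ n./2.+1 0 n.+1) //=.
  by rewrite big_mkord.
set T := \sum_(n./2.+1 <= k < n.+1) _ in A1 *.
set Rm := \sum_(k < n./2.+1) _ in A2.
set Mm := \sum_(i < K.+2) _ in A3.
set Mn := \sum_(i < K.+2) _ in A4.
have -> : \sum_(k < n./2.+1) codiv R k * model (n - k) = Rm + Mm + Mn.
  rewrite /Rm /Mm /Mn -addrA -big_split /=.
  have -> : \sum_(i < K.+2) (model_deriv n i 0 / i`!%:R *
     (codiv_moment_sum i (rate n) n./2.+1 - moment_main i (rate n)) +
      model_deriv n i 0 / i`!%:R * moment_main i (rate n)) =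
    \sum_(k < n./2.+1) codiv R k * expR (- (k%:R * rate n)) *
       \sum_(i < K.+2) model_deriv n i 0 / i`!%:R * k%:R ^+ i.
    under eq_bigr do rewrite -mulrDr subrK /codiv_moment_sum big_distrr /=.
    rewrite exchange_big /=; apply: eq_bigr => k _; rewrite big_distrr /=.
    by apply: eq_bigr => i _; ring.
  rewrite -big_split /=; apply: eq_bigr => k _.
  rewrite -mulrDr subrK -mulrA (mulrA (expR _)) -expRD addNr expR0 mul1r //.
have -> : Rm + Mm + Mn + T - n%:R * model n = T + Rm + Mm + (Mn - n%:R * model n) by ring.
apply: le_trans (ler_normD _ _) _; apply: le_trans (lerD (ler_normD _ _) (lexx _)) _.
apply: le_trans (lerD (lerD (ler_normD _ _) (lexx _)) (lexx _)) _.
apply: le_trans (lerD (lerD (lerD A1 A2) A3) A4) _.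
by rewrite le_eqVlt; apply/orP; left; apply/eqP; ring.
Qed.

End ModelRecurrence.

(** * The ratio to the model converges faster than any power *)

Section Averaging.
Variable R : realType.
Implicit Types (u : nat -> R) (v : nat -> nat -> R).

Lemma inv_succ_gap (b : nat) : (0 < b)%N ->
  (b%:R : R)^-1 - b.+1%:R^-1 = (b%:R * b.+1%:R)^-1.
Proof.
move=> b0; rewrite -natr1; field.
by rewrite pnatr_eq0 -lt0n b0 natr1 pnatr_eq0.
Qed.

(* An average whose weights dominate [beta w / r] on a block of [r] indices is
   pulled towards the mean over that block. *)
Lemma landing_bound u v (N N1 r b : nat) (beta M Mx : R) :
  (0 < r)%N -> (N1 <= N - 2 * r)%N -> (2 * r <= N)%N -> 0 <= beta ->
  (forall l, 0 <= v b l) -> (forall l, `|u l| <= M) -> `|Mx| <= M ->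
  (forall l, (N1 <= l < N)%N -> u l <= Mx) ->
  (forall l, (N - 2 * r <= l < N - r)%N ->
     beta * (\sum_(0 <= k < N) v b k) <= r%:R * v b l) ->
  \sum_(0 <= l < N) v b l * u l <=
    (\sum_(0 <= l < N) v b l) *
      (beta * ((\sum_(N - 2 * r <= l < N - r) u l) / r%:R) + (1 - beta) * Mx)
    + 2 * M * \sum_(0 <= l < N1) v b l.
Proof.
move=> r0 hN1 hr beta0 v0 hM hMx hw hmin.
have rr : 0 < (r%:R : R) by rewrite ltr0n.
have c1 : (N - 2 * r <= N - r)%N by lia.
have c2 : (N - r <= N)%N by lia.
have c3 : (N1 <= N)%N by lia.
have c4 : (N1 <= N - r)%N by lia.
have card : (N - r - (N - 2 * r) = r)%N by lia.
set om := \sum_(0 <= k < N) v b k in hmin *.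
set A := \sum_(N - 2 * r <= l < N - r) u l.
set t := \sum_(0 <= l < N1) v b l.
(* The weight guaranteed to each index of the block. This part is paired with the block mean, all
   the rest with [Mx]. *)
pose m : R := beta * om / r%:R.
have split (f : nat -> R) : \sum_(0 <= l < N) f l = \sum_(0 <= l < N1) f l +
   (\sum_(N1 <= l < N - 2 * r) f l + (\sum_(N - 2 * r <= l < N - r) f l + \sum_(N - r <= l < N) f l)).
  rewrite (@big_cat_nat _ _ _ N1) //=; congr (_ + _).
  rewrite (@big_cat_nat _ _ _ (N - 2 * r) N1) //=; last exact: leq_trans c1 c2.
  by congr (_ + _); rewrite (@big_cat_nat _ _ _ (N - r)).
have M0 : 0 <= M by apply: le_trans (normr_ge0 _) hMx.
have b1 : \sum_(0 <= l < N1) v b l * u l <= M * t.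
  rewrite /t big_distrr /=; apply: ler_sum => l _; rewrite mulrC ler_wpM2r //.
  by apply: le_trans (ler_norm _) (hM l).
have b2 : \sum_(N1 <= l < N - 2 * r) v b l * u l <= Mx * \sum_(N1 <= l < N - 2 * r) v b l.
  rewrite big_distrr /= !big_nat; apply: ler_sum => l /andP[l1 l2]; rewrite mulrC ler_wpM2r //.
  by apply: hw; rewrite l1 (leq_trans l2) // (leq_trans c1 c2).
have b4 : \sum_(N - r <= l < N) v b l * u l <= Mx * \sum_(N - r <= l < N) v b l.
  rewrite big_distrr /= !big_nat; apply: ler_sum => l /andP[l1 l2]; rewrite mulrC ler_wpM2r //.
  by apply: hw; rewrite l2 (leq_trans c4 l1).
have b3 : \sum_(N - 2 * r <= l < N - r) v b l * u l <=
    Mx * (\sum_(N - 2 * r <= l < N - r) v b l - beta * om) + m * A.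
  have -> : beta * om = \sum_(N - 2 * r <= l < N - r) m.
    by rewrite sumr_const_nat card -(mulr_natr m r) /m divfK // gt_eqF.
  rewrite -sumrB /A !big_distrr /= -big_split /= !big_nat.
  apply: ler_sum => l /andP[l1 l2].
  have ml : m <= v b l by rewrite /m ler_pdivrMr // [v b l * _]mulrC; apply: hmin; rewrite l1.
  have ul : u l <= Mx by apply: hw; rewrite (leq_trans hN1 l1) (leq_trans l2).
  have : (v b l - m) * u l <= (v b l - m) * Mx by apply: ler_wpM2l => //; rewrite subr_ge0.
  lra.
rewrite (split (fun l => v b l * u l)).
apply: le_trans (lerD b1 (lerD b2 (lerD b3 b4))) _.
have omE := split (v b); rewrite -/om -/t in omE.
move: omE; set s2 := \sum_(N1 <= l < N - 2 * r) v b l; set s3 := \sum_(N - 2 * r <= l < N - r) v b l.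
set s4 := \sum_(N - r <= l < N) v b l => omE.
have t0 : 0 <= t by apply: sumr_ge0.
have mA : m * A = om * (beta * (A / r%:R)) by rewrite /m; field; rewrite gt_eqF.
have tM : t * (- Mx) <= t * M.
  by apply: ler_wpM2l => //; apply: le_trans (ler_norm _) _; rewrite normrN.
rewrite mA.
have -> : om * (beta * (A / r%:R) + (1 - beta) * Mx) = om * (beta * (A / r%:R)) + Mx * (t + (s2 + (s3 + s4))) - Mx * (beta * om).
  by rewrite -omE; ring.
lra.
Qed.

(** Strong induction on [b]. Weight below [N] is handled by [landing_bound], or is negligible;
    weight from [N] on by the induction hypothesis. The allowance [d (2 - 1 / (b+1))] grows by
    [d / (b (b+1))] per step, enough to absorb the errors [e b], and stays below [2 d]. *)
Lemma upper_step u v (N N1 r : nat) (beta M Mx d : R) (e : nat -> R) :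
  (0 < N)%N -> (0 < r)%N -> (N1 <= N - 2 * r)%N -> (2 * r <= N)%N -> 0 <= beta <= 1 ->
  (forall b l, 0 <= v b l) ->
  (forall b, (N <= b)%N -> u b = \sum_(0 <= l < b) v b l * u l) ->
  (forall l, `|u l| <= M) -> `|Mx| <= M ->
  (forall l, (N1 <= l < N)%N -> u l <= Mx) ->
  (forall b, (N <= b)%N -> `|\sum_(0 <= l < b) v b l - 1| <= e b) ->
  (forall b, (N <= b)%N ->
     (\sum_(0 <= l < N1) v b l <= e b /\
      forall l, (N - 2 * r <= l < N - r)%N ->
        beta * (\sum_(0 <= k < N) v b k) <= r%:R * v b l) \/
     \sum_(0 <= l < N) v b l <= e b) ->
  0 <= d -> 2 * d <= M ->
  (forall b, (N <= b)%N -> 4 * M * e b <= d * (b%:R * b.+1%:R)^-1) ->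
  forall b, (N <= b)%N ->
    u b <= beta * ((\sum_(N - 2 * r <= l < N - r) u l) / r%:R) + (1 - beta) * Mx
           + d * (2 - b.+1%:R^-1).
Proof.
move=> N0 r0 hN1 hr hbeta v0 hu hM hMx hw hS hl d0 dM he.
have /andP[beta0 beta1] := hbeta.
set A := _ / r%:R; set tau := beta * A + (1 - beta) * Mx.
have rr : 0 < (r%:R : R) by rewrite ltr0n.
have M0 : 0 <= M by apply: le_trans (normr_ge0 _) hMx.
have hA : `|A| <= M.
  rewrite /A normrM normfV (ger0_norm (ltW rr)) ler_pdivrMr //.
  apply: le_trans (ler_norm_sum _ _ _) _.
  apply: le_trans (_ : \sum_(N - 2 * r <= l < N - r) M <= _); first by apply: ler_sum => l _.
  rewrite sumr_const_nat -(mulr_natr M); apply: ler_wpM2l => //; rewrite ler_nat.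
  clear - hr; lia.
have htau : `|tau| <= M.
  have -> : M = beta * M + (1 - beta) * M by ring.
  apply: le_trans (ler_normD _ _) _; rewrite (normrM beta A) (normrM (1 - beta) Mx) (ger0_norm beta0) (ger0_norm (_ : 0 <= 1 - beta)) ?subr_ge0 //.
  by apply: lerD; apply: ler_wpM2l; rewrite ?subr_ge0.
elim/ltn_ind => b IH hb.
have b0 : (0 < b)%N by apply: leq_trans hb.
have bb : 0 < (b%:R : R) by rewrite ltr0n.
(* The largest allowance that the induction hypothesis grants to an index below [b]. *)
pose E : R := d * (2 - b%:R^-1).
have E0 : 0 <= E.
  rewrite mulr_ge0 // subr_ge0; apply: (@le_trans _ _ 1); last by rewrite ler1n.
  by rewrite invf_le1 // ler1n.
have EM : E <= M.
  apply: le_trans dM; rewrite /E mulrC ler_wpM2r // gerBl invr_ge0 ltW //.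
have eb0 : 0 <= e b by apply: le_trans (normr_ge0 _) (hS b hb).
have IH' l : (N <= l < b)%N -> u l <= tau + E.
  move=> /andP[l1 l2]; apply: le_trans (IH l l2 l1) _.
  rewrite lerD2l ler_wpM2l // lerD2l lerN2 lef_pV2 ?posrE ?ltr0n // ler_nat //.
have S2 : \sum_(N <= l < b) v b l * u l <= (tau + E) * \sum_(N <= l < b) v b l.
  rewrite big_distrr /= !big_nat; apply: ler_sum => l hlb; rewrite mulrC ler_wpM2r //.
  exact: IH'.
set om := \sum_(0 <= l < N) v b l.
set om' := \sum_(N <= l < b) v b l in S2.
have om0 : 0 <= om by apply: sumr_ge0.
have S1 : \sum_(0 <= l < N) v b l * u l <= om * tau + 2 * M * e b.
  case: (hl b hb) => [[h1 h2]|h1].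
    apply: le_trans (@landing_bound u v N N1 r b beta M Mx r0 hN1 hr beta0 (v0 b) hM hMx hw h2) _.
    by rewrite lerD2l; apply: ler_wpM2l => //; rewrite mulr_ge0.
  apply: le_trans (_ : om * M <= _).
    rewrite /om big_distrl /=; apply: ler_sum => l _; rewrite ler_wpM2l //.
    exact: le_trans (ler_norm _) (hM l).
  have q1 : om * M <= e b * M by apply: ler_wpM2r.
  have q2 : om * (- tau) <= om * M.
    by apply: ler_wpM2l => //; apply: le_trans (ler_norm _) _; rewrite normrN.
  lra.
have Ssum : om + om' = \sum_(0 <= l < b) v b l by rewrite [RHS](@big_cat_nat _ _ _ N).
have hSb := hS b hb; rewrite -Ssum in hSb.
rewrite hu // (@big_cat_nat _ _ _ N) //=.
apply: le_trans (lerD S1 S2) _.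
have q1 : (om + om' - 1) * tau <= e b * M.
  apply: le_trans (ler_norm _) _; rewrite normrM; apply: ler_pM => //.
have q2 : om' * E <= E + e b * M.
  have : om' <= 1 + e b by move: hSb; rewrite ler_norml => /andP[_ ?]; lra.
  move=> /(ler_wpM2r E0); rewrite mulrDl mul1r => q.
  have : e b * E <= e b * M by apply: ler_wpM2l.
  lra.
have q3 := he b hb.
have q4 : E + d * (b%:R * b.+1%:R)^-1 = d * (2 - b.+1%:R^-1).
  by rewrite -inv_succ_gap // /E; ring.
rewrite -q4.
have -> : om * tau + 2 * M * e b + (tau + E) * om' = tau + (om + om' - 1) * tau + om' * E + 2 * M * e b by ring.
move: q1 q2 q3; move: ((om + om' - 1) * tau) (om' * E) (d / _) => x1 x2 x3 q1 q2 q3.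
have -> : tau + x1 + x2 + 2 * M * e b = tau + (x1 + x2 + 2 * (M * e b)) by ring.
rewrite lerD2l; move: q1 q2 q3; rewrite (mulrC (e b)) -(mulrA 4).
by move: (M * e b) => y q1 q2 q3; lra.
Qed.

End Averaging.

Lemma nat_interval_argmax (R : realType) (u : nat -> R) (a b : nat) : (a < b)%N ->
  exists2 l, (a <= l < b)%N & forall l', (a <= l' < b)%N -> u l' <= u l.
Proof.
elim: b => // b IH; rewrite ltnS leq_eqVlt => /predU1P[->|ab].
  exists b; first by rewrite leqnn ltnSn.
  by move=> l' /andP[h1 h2]; have -> : l' = b by lia.
have [l hl hmax] := IH ab.
case: (lerP (u b) (u l)) => h.
  exists l; first by move: hl => /andP[-> /ltnW]; rewrite ltnS.
  move=> l' /andP[h1]; rewrite ltnS leq_eqVlt => /predU1P[-> //|h2].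
  by apply: hmax; rewrite h1.
exists b; first by rewrite ltnSn (ltnW ab).
move=> l' /andP[h1]; rewrite ltnS leq_eqVlt => /predU1P[-> //|h2].
by apply: le_trans (ltW h); apply: hmax; rewrite h1.
Qed.

Section Kappa.
Variable R : realType.
Implicit Types (n N K : nat).
Local Notation theta := (theta R).

(* [kappa n = n^(-1/8)].  Going back from [N] by [N kappa^2] loses a factor
   [1 + O(kappa^2)] in a bound [B kappa^K], while the averaging step gains a factor
   [1 - c kappa]: the true gain is [c / ln N], which [c kappa] underestimates. *)
Definition kappa n : R := Num.sqrt (theta n).

Lemma kappa_sqr n : kappa n ^+ 2 = theta n.
Proof. by rewrite sqr_sqrtr // invr_ge0 sqrtr_ge0. Qed.

Lemma kappa_pow8 n : kappa n ^+ 8 = n%:R^-1.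
Proof. by rewrite (exprM (kappa n) 2 4) kappa_sqr theta_pow4. Qed.

Lemma kappa_gt0 n : (0 < n)%N -> 0 < kappa n.
Proof. by move=> n0; rewrite sqrtr_gt0 theta_gt0. Qed.

Lemma kappa_ge0 n : 0 <= kappa n. Proof. exact: sqrtr_ge0. Qed.

Lemma kappa_antitone m n : (0 < m)%N -> (m <= n)%N -> kappa n <= kappa m.
Proof.
move=> m0 mn; have n0 : (0 < n)%N by apply: leq_trans mn.
rewrite -(@ler_pXn2r _ 8) ?nnegrE ?kappa_ge0 // !kappa_pow8.
by rewrite lef_pV2 ?posrE ?ltr0n // ler_nat.
Qed.

Lemma kappa_le1 n : (0 < n)%N -> kappa n <= 1.
Proof.
move=> n0; rewrite -(@ler_pXn2r _ 8) ?nnegrE ?kappa_ge0 // kappa_pow8 expr1n.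
by rewrite invf_le1 ?ler1n ?ltr0n.
Qed.

Lemma theta_le_kappa n : (0 < n)%N -> theta n <= kappa n.
Proof. by move=> n0; rewrite -kappa_sqr expr2 ler_piMl ?kappa_ge0 // kappa_le1. Qed.

Lemma theta_antitone m n : (0 < m)%N -> (m <= n)%N -> theta n <= theta m.
Proof.
move=> m0 mn; rewrite -!kappa_sqr; apply: lerXn2r; rewrite ?nnegrE ?kappa_ge0 //.
exact: kappa_antitone.
Qed.

Lemma kappa_small (e : R) : 0 < e -> exists2 N0 : nat, (3 < N0)%N & forall n, (N0 <= n)%N -> kappa n <= e.
Proof.
move=> e0; have e8 : 0 < e ^+ 8 by rewrite exprn_gt0.
exists (Num.trunc (e ^+ 8)^-1 + 4)%N; first by rewrite addnC.
move=> n hn; have n0 : (0 < n)%N by apply: leq_trans hn; rewrite addnC.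
rewrite -(@ler_pXn2r _ 8) ?nnegrE ?kappa_ge0 ?(ltW e0) // kappa_pow8.
rewrite -[X in _ <= X]invrK lef_pV2 ?posrE ?invr_gt0 ?ltr0n //.
have h : (e ^+ 8)^-1 < (Num.trunc (e ^+ 8)^-1).+1%:R by rewrite truncnS_gt // invr_ge0 ltW.
apply: le_trans (ltW h) _; rewrite ler_nat; apply: leq_trans hn.
by rewrite -addn1 leq_add2l.
Qed.

(** With [x = 1 - 2 theta N]: [1 / N1 <= 1 / (N x) <= 1 / (N x^8)], and eighth roots are taken. *)
Lemma kappa_window N N1 K : (0 < N1)%N -> theta N <= 4^-1 -> (N1 <= N)%N ->
  N%:R * (1 - 2 * theta N) <= N1%:R ->
  kappa N1 ^+ K <= kappa N ^+ K * (1 - 2 * theta N) ^- K.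
Proof.
move=> N10 th N1N hN; have N0 : (0 < N)%N by apply: leq_trans N1N.
have t0 := theta_gt0 R N0; set x := 1 - 2 * theta N in hN *.
have x0 : 0 < x by rewrite /x; lra.
have x1 : x <= 1 by rewrite /x; lra.
rewrite -exprVn -exprMn; apply: lerXn2r; rewrite ?nnegrE ?kappa_ge0 //.
  by rewrite divr_ge0 ?kappa_ge0 // ltW.
rewrite -(@ler_pXn2r _ 8) ?nnegrE ?kappa_ge0 ?divr_ge0 ?kappa_ge0 ?(ltW x0) //.
rewrite expr_div_n !kappa_pow8 -invfM lef_pV2 ?posrE ?mulr_gt0 ?exprn_gt0 ?ltr0n //.
apply: le_trans hN; rewrite ler_wpM2l // exprSr ler_piMl ?(ltW x0) //.
by rewrite exprn_ile1 // ltW.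
Qed.

End Kappa.

(** * Contraction of the oscillation *)

Section Decay.
Variable R : realType.
Local Notation theta := (theta R).
Local Notation kappa := (kappa R).
Variables (u : nat -> R) (v : nat -> nat -> R) (M c : R) (rho : nat -> nat).
Hypothesis v_ge0 : forall b l, 0 <= v b l.
Hypothesis u_rec : forall b, (0 < b)%N -> u b = \sum_(0 <= l < b) v b l * u l.
Hypothesis u_bound : forall l, `|u l| <= M.
Hypothesis v_sum : forall K, exists2 C, 0 <= C & forall b, (3 < b)%N ->
  `|\sum_(0 <= l < b) v b l - 1| <= C * theta b ^+ K.
Hypothesis v_tail : forall K, exists2 C, 0 <= C & forall b L, (3 < b)%N -> (L <= b)%N ->
  b%:R * theta b <= 2 * (b - L)%:R -> \sum_(0 <= l < L) v b l <= C * theta b ^+ K.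
Hypothesis rho_spec : forall N, (3 < N)%N -> [/\ (0 < rho N)%N, (rho N * rho N <= N)%N & (2 * rho N <= N)%N].
Hypothesis c_bounds : 0 < c <= 1.
Hypothesis v_min : exists N0, forall N, (N0 <= N)%N -> forall b l,
  (N <= b <= 2 * N)%N -> (N - 2 * rho N <= l < N - rho N)%N ->
  c * kappa N * (\sum_(0 <= k < N) v b k) <= (rho N)%:R * v b l.

(** The window has length about [N theta N = N^(3/4)]: the mass below it is negligible, and stepping
    back to [N1] costs only [1 + O(theta)]. Applied to [u] and [- u], [upper_step] pulls maximum and
    minimum towards the same block mean, which cancels in [u a - u b]. *)
Lemma window_contraction K :
  exists2 C : R, 0 <= C & exists2 N0 : nat, (3 < N0)%N & forall N, (N0 <= N)%N ->
   exists N1, [/\ (0 < N1)%N, (N1 < N)%N,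
     kappa N1 ^+ K <= kappa N ^+ K * (1 - 2 * theta N) ^- K &
     forall D, (forall a b, (N1 <= a)%N -> (N1 <= b)%N -> u a - u b <= D) ->
       forall a b, (N <= a)%N -> (N <= b)%N ->
         u a - u b <= (1 - c * kappa N) * D + C * kappa N ^+ K.+2].
Proof.
(* Ten more orders: eight because [theta b ^+ 8 = b^-2] absorbs the factor [b (b+1)] of
   [upper_step], two for the [kappa N ^+ K.+2] of the conclusion. *)
have [C1 C10 h1] := v_sum (K + 10); have [C2 C20 h2] := v_tail (K + 10).
have [Nm hm] := v_min.
have M0 : 0 <= M by apply: le_trans (normr_ge0 _) (u_bound 0).
have /andP[c0 c1] := c_bounds.
pose C := C1 + C2; have C0 : 0 <= C by rewrite addr_ge0.
(* Gives both [kappa N <= 1/4] and [16 C kappa N <= 1]; the latter yields [2 d <= M]. *)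
have e0 : 0 < (16 * C + 4)^-1 by rewrite invr_gt0; lra.
have [Nk Nk3 hk] := kappa_small e0.
exists (32 * M * C); first by rewrite !mulr_ge0.
exists (maxn Nm Nk); first by rewrite leq_max Nk3 orbT.
move=> N; rewrite geq_max => /andP[hNm hNk].
have N3 : (3 < N)%N by apply: leq_trans hNk.
have N0 : (0 < N)%N by apply: ltn_trans N3.
have kN := hk N hNk; have k0 := kappa_gt0 R N0; have k1 := kappa_le1 R N0.
have t0 := theta_gt0 R N0; have tk := theta_le_kappa R N0.
have k4 : kappa N <= 4^-1.
  by apply: le_trans kN _; rewrite lef_pV2 ?posrE //; lra.
have t4 : theta N <= 4^-1 by apply: le_trans k4.
have kC : 16 * C * kappa N <= 1.
  have : kappa N * (16 * C + 4) <= 1 by rewrite -ler_pdivlMr ?div1r //; lra.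
  by rewrite mulrDr; lra.
have [r0 rN r2] := rho_spec N3; set r := rho N in r0 rN r2 *.
have NR : 0 < (N%:R : R) by rewrite ltr0n.
have rR : (r%:R : R) <= N%:R * theta N ^+ 2.
  rewrite -(@ler_pXn2r _ 2) ?nnegrE ?mulr_ge0 ?exprn_ge0 ?(ltW t0) //.
  rewrite exprMn -exprM theta_pow4 expr2 -natrM expr2 mulfK ?gt_eqF //.
  by rewrite ler_nat.
have Nt1 : 1 <= N%:R * theta N.
  have : 1 <= N%:R * theta N ^+ 4 by rewrite theta_pow4 mulfV ?gt_eqF.
  move=> /le_trans; apply; rewrite ler_pM2l // (exprS _ 3) ler_piMr ?(ltW t0) //.
  by rewrite exprn_ile1 ?(ltW t0) //; lra.
(* An integer between [N theta N] and twice that number. *)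
pose W := (Num.trunc (N%:R * theta N)).+1.
have Wlo : N%:R * theta N <= W%:R.
  by apply/ltW; rewrite /W truncnS_gt // mulr_ge0 // ltW.
have Whi : W%:R <= 2 * (N%:R * theta N).
  rewrite /W -natr1; apply: le_trans (_ : N%:R * theta N + 1 <= _); last by lra.
  by rewrite lerD2r truncn_le // mulr_ge0 // ltW.
have WN : (2 * W <= N)%N.
  rewrite -(ler_nat R) natrM; apply: le_trans (_ : 2 * (2 * (N%:R * theta N)) <= _); first by rewrite ler_pM2l.
  have : N%:R * theta N <= N%:R * 4^-1 by rewrite ler_pM2l.
  lra.
have Wr : (2 * r <= W)%N.
  rewrite -(ler_nat R) natrM; apply: le_trans Wlo; apply: le_trans (_ : 2 * (N%:R * theta N ^+ 2) <= _); first by rewrite ler_pM2l.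
  have -> : 2 * (N%:R * theta N ^+ 2) = N%:R * theta N * (2 * theta N) by ring.
  rewrite ler_piMr ?mulr_ge0 ?(ltW t0) //; lra.
have W0 : (0 < W)%N by [].
clearbody W.
pose N1 := (N - W)%N.
have [q1 q2 q3 q4 q5] : [/\ (0 < N1)%N, (N1 < N)%N, (N1 <= N - 2 * r)%N, (W <= N)%N & (N1 <= N)%N].
  by rewrite /N1; clear - WN Wr W0 N3; split; lia.
have N1R : (N1%:R : R) = N%:R - W%:R by rewrite natrB.
exists N1; split => //.
  by apply: kappa_window => //; rewrite N1R; lra.
move=> D hD.
have bin b : (N <= b)%N -> [/\ (0 < b)%N, (3 < b)%N & 0 < theta b <= 1].
  move=> hb; have b3 : (3 < b)%N by apply: leq_trans hb.
  have b0 : (0 < b)%N by apply: ltn_trans b3.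
  by split => //; rewrite theta_gt0 // theta_le1.
pose e b := C * theta b ^+ (K + 10).
have tp b p : (N <= b)%N -> 0 <= theta b ^+ p.
  by move=> /bin[_ _ /andP[h _]]; rewrite exprn_ge0 // ltW.
have hS b : (N <= b)%N -> `|\sum_(0 <= l < b) v b l - 1| <= e b.
  move=> hb; have [b0 b3 _] := bin b hb; apply: le_trans (h1 b b3) _.
  by rewrite /e ler_wpM2r ?tp // /C lerDl.
have eC2 b : (N <= b)%N -> C2 * theta b ^+ (K + 10) <= e b.
  by move=> hb; rewrite /e ler_wpM2r ?tp // /C lerDr.
have hl b : (N <= b)%N ->
     (\sum_(0 <= l < N1) v b l <= e b /\
      forall l, (N - 2 * r <= l < N - r)%N ->
        c * kappa N * (\sum_(0 <= k < N) v b k) <= r%:R * v b l) \/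
     \sum_(0 <= l < N) v b l <= e b.
  move=> hb; have [b0 b3 /andP[tb0 tb1]] := bin b hb.
  (* Up to [2 N] the block receives its share of the mass; beyond, everything below [N] already
     belongs to the tail. *)
  case: (leqP b (2 * N)) => hb2; [left|right].
    split; last by move=> l hlr; apply: hm => //; rewrite hb.
    apply: le_trans (eC2 b hb); apply: h2 => //; first by apply: leq_trans hb.
    apply: le_trans (_ : (2 * N)%:R * theta N <= _).
      apply: ler_pM => //; [exact: ltW | by rewrite ler_nat | exact: theta_antitone].
    rewrite natrM -mulrA ler_pM2l //; apply: le_trans Wlo _; rewrite ler_nat /N1.
    by clear - hb q4; lia.
  apply: le_trans (eC2 b hb); apply: h2 => //.
  apply: le_trans (_ : b%:R <= _); first by rewrite ler_piMr.
  by rewrite -natrM ler_nat; clear - hb2; lia.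
pose d := 8 * M * C * kappa N ^+ K.+2.
have kK : 0 <= kappa N ^+ K.+2 by rewrite exprn_ge0 // ltW.
have d0 : 0 <= d by rewrite mulr_ge0 // !mulr_ge0.
have dM : 2 * d <= M.
  have -> : 2 * d = M * (16 * C * kappa N * kappa N ^+ K.+1) by rewrite /d exprS; ring.
  rewrite ler_piMr // -[X in _ <= X]mulr1; apply: ler_pM => //; rewrite ?exprn_ge0 ?(ltW k0) //.
    by rewrite !mulr_ge0 // ltW.
  by rewrite exprn_ile1 // ltW.
have he b : (N <= b)%N -> 4 * M * e b <= d * (b%:R * b.+1%:R)^-1.
  move=> hb; have [b0 b3 /andP[tb0 tb1]] := bin b hb.
  have bR : 0 < (b%:R : R) by rewrite ltr0n.
  rewrite ler_pdivlMr ?mulr_gt0 //.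
  have b1 : b%:R * b.+1%:R <= 2 * b%:R ^+ 2 :> R.
    rewrite expr2 mulrCA ler_pM2l // -natrM ler_nat; clear - b0; lia.
  have tb8 : theta b ^+ 8 * b%:R ^+ 2 = 1.
    by rewrite (exprM (theta b) 4 2) theta_pow4 -exprMn mulVf ?expr1n // gt_eqF.
  apply: le_trans (_ : 4 * M * e b * (2 * b%:R ^+ 2) <= _).
    by apply: ler_wpM2l => //; rewrite /e !mulr_ge0 // ltW ?exprn_gt0.
  have -> : 4 * M * e b * (2 * b%:R ^+ 2) = 8 * M * C * theta b ^+ K.+2 * (theta b ^+ 8 * b%:R ^+ 2).
    by rewrite /e (_ : (K + 10 = K.+2 + 8)%N) ?exprD; [ring | rewrite -[K.+2]addn2 -addnA].
  rewrite tb8 mulr1 /d; apply: ler_wpM2l; first by rewrite !mulr_ge0.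
  apply: lerXn2r; rewrite ?nnegrE ?(ltW tb0) ?(ltW k0) //.
  apply: le_trans (theta_le_kappa R b0) _; exact: kappa_antitone.
have hbeta : 0 <= c * kappa N <= 1.
  by rewrite mulr_ge0 ?(ltW c0) ?(ltW k0) //= -[X in _ <= X]mulr1; apply: ler_pM => //; exact: ltW.
have [la hla la_max] := nat_interval_argmax u q2.
have [lb hlb lb_min] := nat_interval_argmax (fun l => - u l) q2.
have up := @upper_step R u v N N1 r (c * kappa N) M (u la) d e N0 r0 q3 r2 hbeta v_ge0
  (fun b hb => u_rec (leq_trans N0 hb)) u_bound (u_bound la) la_max hS hl d0 dM he.
have u_rec' b : (N <= b)%N -> - u b = \sum_(0 <= l < b) v b l * (- u l).
  move=> hb; rewrite u_rec ?(leq_trans N0) // -sumrN; apply: eq_bigr => l _; ring.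
have u_bound' l : `|- u l| <= M by rewrite normrN.
have dn := @upper_step R (fun l => - u l) v N N1 r (c * kappa N) M (- u lb) d e N0 r0 q3 r2 hbeta v_ge0
  u_rec' u_bound' (u_bound' lb) lb_min hS hl d0 dM he.
move=> a b ha hb; have A1 := up a ha; have A2 := dn b hb.
have D1 : u la - u lb <= D by move: hla hlb => /andP[x1 _] /andP[y1 _]; apply: hD.
have inv0 n : 0 <= d * (n.+1%:R^-1 : R) by rewrite mulr_ge0.
have I1 := inv0 a; have I2 := inv0 b.
have D2 : (1 - c * kappa N) * (u la - u lb) <= (1 - c * kappa N) * D.
  by apply: ler_wpM2l => //; rewrite subr_ge0; move: hbeta => /andP[].
(* Each of the two one-sided bounds spends at most [2 d]. *)
have -> : 32 * M * C * kappa N ^+ K.+2 = 4 * d by rewrite /d; ring.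
move: A1 A2 I1 I2 D2; rewrite sumrN.
set X := (\sum_(N - 2 * r <= l < N - r) u l) / r%:R.
have -> : (- \sum_(N - 2 * r <= l < N - r) u l) / r%:R = - X by rewrite mulNr.
set Y := 1 - c * kappa N; rewrite !mulrBr !mulrN.
move: (c * kappa N * X) (Y * u la) (Y * u lb) (Y * D) (d / a.+1%:R) (d / b.+1%:R).
clearbody d; move: (u a) (u b) => ua ub x1 x2 x3 x4 x5 x6 A1 A2 I1 I2 D2.
lra.
Qed.

Lemma u_cauchy K : exists2 B, 0 <= B & forall N a b, (0 < N)%N -> (N <= a)%N -> (N <= b)%N ->
  u a - u b <= B * kappa N ^+ K.
Proof.
have [C C0 [N0 N03 hW]] := window_contraction K.
have [D D0 hD] := inv_pow_taylor R K.
have M0 : 0 <= M by apply: le_trans (normr_ge0 _) (u_bound 0).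
have /andP[c0 c1] := c_bounds.
(* With [x = 2 theta] the window loses [(1 - x)^-K <= 1 + (K + D) x] and the additive error amounts
   to at most [theta], together [F theta = F kappa^2]. The gain [c kappa] exceeds this once
   [kappa <= c / F]; the [4] added to [F] below also gives [kappa <= 1/4]. *)
pose F := 2 * K%:R + 2 * D + 1.
have F0 : 0 < F by have := mulr_ge0 (ler0n R 2) (ler0n R K); rewrite /F; lra.
have e0 : 0 < c / (F + 4) by rewrite divr_gt0 //; lra.
have [Nk Nk3 hk] := kappa_small e0.
pose N2 := maxn N0 Nk.
have N20 : (0 < N2)%N by rewrite leq_max (ltn_trans _ N03).
have k20 : 0 < kappa N2 ^+ K by rewrite exprn_gt0 // kappa_gt0.
(* The second summand covers [N < N2] by the trivial bound [2 M]; the first ensures [C <= B]. *)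
pose B := C + 2 * M / kappa N2 ^+ K.
have B0 : 0 <= B by rewrite addr_ge0 // divr_ge0 ?mulr_ge0 // ltW.
exists B => // N; elim/ltn_ind: N => N IH a b Npos ha hb.
have k0 := kappa_gt0 R Npos; have k1 := kappa_le1 R Npos.
case: (leqP N2 N) => hN; last first.
  apply: le_trans (_ : 2 * M <= _).
    by have := u_bound a; have := u_bound b; rewrite !ler_norml => /andP[? ?] /andP[? ?]; lra.
  apply: le_trans (_ : B * kappa N2 ^+ K <= _).
    have -> : B * kappa N2 ^+ K = C * kappa N2 ^+ K + 2 * M by rewrite /B; field; rewrite gt_eqF.
    by rewrite lerDr mulr_ge0 // ltW.
  apply: ler_wpM2l => //; apply: lerXn2r; rewrite ?nnegrE ?kappa_ge0 //.
  by apply: kappa_antitone => //; exact: ltnW.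
have [hN0 hNk] : (N0 <= N)%N /\ (Nk <= N)%N by apply/andP; rewrite -geq_max.
have [N1 [N10 N1N kw step]] := hW N hN0.
have kN := hk N hNk.
have kF : kappa N * (F + 4) <= c by rewrite -ler_pdivlMr //; lra.
have IHD a' b' : (N1 <= a')%N -> (N1 <= b')%N -> u a' - u b' <= B * kappa N1 ^+ K.
  by move=> h1 h2; apply: IH.
apply: le_trans (step _ IHD a b ha hb) _.
have kK : 0 < kappa N ^+ K by rewrite exprn_gt0.
have tE := kappa_sqr R N.
set x := 2 * theta N.
have k4 : kappa N <= 4^-1.
  have : kappa N * 4 <= 1 by apply: le_trans c1; apply: le_trans kF; rewrite ler_pM2l //; lra.
  lra.
have x01 : 0 <= x <= 2^-1.
  rewrite /x -tE; apply/andP; split; first by rewrite mulr_ge0 // exprn_ge0 // ltW.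
  have : kappa N ^+ 2 <= kappa N by rewrite expr2 ler_piMl // ltW.
  lra.
have T := hD x x01.
have x2 : x ^+ 2 <= x by move: x01 => /andP[? ?]; rewrite expr2 ler_piMl //; lra.
have inv : (1 - x) ^- K <= 1 + (K%:R + D) * x.
  move: T; rewrite ler_norml => /andP[_ T].
  have := ler_wpM2l D0 x2; rewrite mulrDl; lra.
have cf : 0 <= 1 - c * kappa N.
  by rewrite subr_ge0 -[X in _ <= X]mulr1; apply: ler_pM => //; exact: ltW.
apply: le_trans (_ : (1 - c * kappa N) * (B * (kappa N ^+ K * (1 + (K%:R + D) * x))) + C * kappa N ^+ K.+2 <= _).
  rewrite lerD2r; apply: ler_wpM2l => //; apply: ler_wpM2l => //.
  by apply: le_trans kw _; rewrite ler_pM2l.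
have -> : C * kappa N ^+ K.+2 = kappa N ^+ K * (C * theta N) by rewrite -tE -[K.+2]addn2 exprD; ring.
have -> : (1 - c * kappa N) * (B * (kappa N ^+ K * (1 + (K%:R + D) * x))) =
  kappa N ^+ K * (B * ((1 - c * kappa N) * (1 + (K%:R + D) * x))) by ring.
rewrite -mulrDr [X in _ <= X]mulrC ler_pM2l //.
have t0 : 0 <= theta N by rewrite -tE exprn_ge0 // ltW.
have CB : C * theta N <= B * theta N.
  by apply: ler_wpM2r => //; rewrite /B lerDl divr_ge0 ?mulr_ge0 // ltW.
apply: le_trans (lerD (lexx _) CB) _; rewrite -mulrDr -[X in _ <= X]mulr1; apply: ler_wpM2l => //.
have KD : 0 <= (K%:R + D) * x by move: x01 => /andP[x0 _]; rewrite mulr_ge0 // addr_ge0.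
have q1 : (1 - c * kappa N) * (1 + (K%:R + D) * x) <= 1 - c * kappa N + (K%:R + D) * x.
  have : 0 <= c * kappa N * ((K%:R + D) * x) by rewrite mulr_ge0 // mulr_ge0 // ltW.
  by rewrite mulrDr mulr1 !mulrBl mul1r; lra.
apply: le_trans (lerD q1 (lexx _)) _.
have q2 : F * theta N <= c * kappa N.
  rewrite -tE expr2 mulrA ler_pM2r // mulrC; apply: le_trans kF; rewrite ler_pM2l //; lra.
have q3 : F * theta N = (K%:R + D) * x + theta N by rewrite /F /x; ring.
lra.
Qed.

End Decay.

(** * Two-sided bounds for solutions of an approximate averaging recurrence *)

Section Boundedness.
Variable R : realType.
Local Notation theta := (theta R).
Variables (u : nat -> R) (v : nat -> nat -> R).
Hypothesis v_ge0 : forall b l, 0 <= v b l.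
Hypothesis u_rec : forall b, (0 < b)%N -> u b = \sum_(0 <= l < b) v b l * u l.
Hypothesis u_gt0 : forall l, 0 < u l.
Hypothesis v_sum : forall K, exists2 C, 0 <= C & forall b, (3 < b)%N ->
  `|\sum_(0 <= l < b) v b l - 1| <= C * theta b ^+ K.

(** The defects of the total weights are dominated by the increments of the telescoping sequence
    [1 / b]; eight of the twelve orders are spent on [b (b+1)]. *)
Lemma v_sum_gap : exists2 N0 : nat, (3 < N0)%N & forall b, (N0 <= b)%N ->
  2 * `|\sum_(0 <= l < b) v b l - 1| <= (b%:R * b.+1%:R)^-1.
Proof.
have [C C0 hC] := v_sum 12.
have e0 : 0 < (4 * C + 4)^-1 by rewrite invr_gt0; lra.
have [N0 N03 hk] := kappa_small e0.
exists N0 => // b hb; have b3 : (3 < b)%N by apply: leq_trans hb.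
have b0 : (0 < b)%N by apply: ltn_trans b3.
have bR : 0 < (b%:R : R) by rewrite ltr0n.
have t0 := theta_gt0 R b0; have t1 := theta_le1 R b0.
have tk := le_trans (theta_le_kappa R b0) (hk b hb).
have tC : 4 * C * theta b <= 1.
  have : theta b * (4 * C + 4) <= 1 by rewrite -ler_pdivlMr ?div1r //; lra.
  by rewrite mulrDr; lra.
apply: le_trans (_ : 2 * (C * theta b ^+ 12) <= _); first by rewrite ler_pM2l // hC.
rewrite -[_^-1]mul1r ler_pdivlMr ?mulr_gt0 //.
have b1 : b%:R * b.+1%:R <= 2 * b%:R ^+ 2 :> R.
  rewrite expr2 mulrCA ler_pM2l // -natrM ler_nat; clear - b0; lia.
have tb8 : theta b ^+ 8 * b%:R ^+ 2 = 1.
  by rewrite (exprM (theta b) 4 2) theta_pow4 -exprMn mulVf ?expr1n // gt_eqF.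
have t12 : 0 <= 2 * (C * theta b ^+ 12) by rewrite mulr_ge0 // mulr_ge0 // exprn_ge0 // ltW.
apply: le_trans (ler_wpM2l t12 b1) _.
have -> : 2 * (C * theta b ^+ 12) * (2 * b%:R ^+ 2) = 4 * C * theta b * theta b ^+ 3 * (theta b ^+ 8 * b%:R ^+ 2) by ring.
rewrite tb8 mulr1 -[X in _ <= X]mulr1; apply: ler_pM => //.
- by rewrite !mulr_ge0 // ltW.
- by rewrite exprn_ge0 // ltW.
- by rewrite exprn_ile1 // ltW.
Qed.

(** The inductive bound [B (2 - 1 / (b+1))] grows by [B / (b (b+1))] per step, which pays for the
    defect of the total weight. *)
Lemma u_upper : exists M, forall l, u l <= M.
Proof.
have [N0 N03 hN] := v_sum_gap.
pose B := \sum_(0 <= l < N0) u l.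
have B0 : 0 <= B by apply: sumr_ge0 => l _; exact: ltW.
exists (2 * B).
suff h b : u b <= B * (2 - b.+1%:R^-1).
  move=> l; apply: le_trans (h l) _; rewrite mulrC ler_wpM2r // gerBl invr_ge0 //.
elim/ltn_ind: b => b IH.
case: (ltnP b N0) => hb.
  apply: le_trans (_ : B <= _).
    rewrite /B big_mkord (bigD1 (Ordinal hb)) //= lerDl sumr_ge0 // => l _; exact: ltW.
  rewrite ler_peMr //; have : (b.+1%:R : R)^-1 <= 1 by rewrite invf_le1 ?ler1n.
  by move: (_^-1) => z hz; rewrite lerBrDr; lra.
have b0 : (0 < b)%N by apply: leq_trans hb; apply: ltn_trans N03.
have bR : 0 < (b%:R : R) by rewrite ltr0n.
have gap := hN b hb; have inv := inv_succ_gap R b0.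
set S := \sum_(0 <= l < b) v b l in gap.
have i0 : 0 < (b%:R : R)^-1 by rewrite invr_gt0.
rewrite u_rec //; apply: le_trans (_ : S * (B * (2 - b%:R^-1)) <= _).
  rewrite /S big_distrl /= !big_nat; apply: ler_sum => l /andP[_ lb]; apply: ler_wpM2l => //.
  apply: le_trans (IH l lb) _; rewrite ler_wpM2l // lerD2l lerN2 lef_pV2 ?posrE ?ltr0n // ler_nat //.
have sS : S <= 1 + `|S - 1| by have := ler_norm (S - 1); lra.
rewrite mulrCA; apply: ler_wpM2l => //.
have b1 : (b%:R : R)^-1 <= 1 by rewrite invf_le1 ?ler1n.
have b2 : 0 <= 2 - (b%:R : R)^-1 by lra.
apply: le_trans (ler_wpM2r b2 sS) _.
have n0 : 0 <= `|S - 1| * (b%:R : R)^-1 by rewrite mulr_ge0 // ltW.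
move: gap inv n0; move: (_ * _)^-1 (b%:R^-1) (b.+1%:R^-1) (`|_|) => p q r a gap inv n0.
by rewrite mulrDl mul1r mulrBr; lra.
Qed.

(** As for [u_upper], with a bound [m (1 + 1 / (b+1))] that decreases to [m]; the minimum over the
    initial values is [2 m]. *)
Lemma u_lower : exists2 m : R, 0 < m & forall l, m <= u l.
Proof.
have [N0 N03 hN] := v_sum_gap.
have [la hla la_max] := @nat_interval_argmax R (fun l => - u l) 0 N0 (ltn_trans (isT : 0 < 3)%N N03).
pose m := u la / 2; have m0 : 0 < m by rewrite divr_gt0.
exists m => //.
suff h b : m * (1 + b.+1%:R^-1) <= u b.
  move=> l; apply: le_trans (h l); rewrite ler_peMr ?(ltW m0) // lerDl invr_ge0 //.
elim/ltn_ind: b => b IH.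
case: (ltnP b N0) => hb.
  apply: le_trans (_ : u la <= _); last by have := la_max b hb; rewrite lerN2.
  have : (b.+1%:R : R)^-1 <= 1 by rewrite invf_le1 ?ler1n.
  have um : u la = m + m by rewrite /m; field.
  move: (_^-1) => z /(ler_wpM2l (ltW m0)); rewrite um mulrDr !mulr1; lra.
have b0 : (0 < b)%N by apply: leq_trans hb; apply: ltn_trans N03.
have bR : 0 < (b%:R : R) by rewrite ltr0n.
have gap := hN b hb; have inv := inv_succ_gap R b0.
set S := \sum_(0 <= l < b) v b l in gap.
have i0 : 0 < (b%:R : R)^-1 by rewrite invr_gt0.
rewrite u_rec //; apply: le_trans (_ : S * (m * (1 + b%:R^-1)) <= _); last first.
  rewrite /S big_distrl /= !big_nat; apply: ler_sum => l /andP[_ lb]; apply: ler_wpM2l => //.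
  apply: le_trans (IH l lb); rewrite ler_wpM2l ?(ltW m0) // lerD2l lef_pV2 ?posrE ?ltr0n // ler_nat //.
have sS : 1 - `|S - 1| <= S by have := ler_norm (1 - S); rewrite distrC; lra.
rewrite mulrCA; apply: ler_wpM2l; first exact: ltW.
have b1 : (b%:R : R)^-1 <= 1 by rewrite invf_le1 ?ler1n.
have b2 : 0 <= 1 + (b%:R : R)^-1 by lra.
apply: le_trans (ler_wpM2r b2 sS).
have n0 : `|S - 1| * (b%:R : R)^-1 <= `|S - 1| by rewrite ler_piMr.
move: gap inv n0; move: (_ * _)^-1 (b%:R^-1) (b.+1%:R^-1) (`|_|) => p q r a gap inv n0.
by rewrite mulrBl mul1r mulrDr; lra.
Qed.

End Boundedness.

(** * The weights of the overpartition recurrence *)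

Section Instance.
Variable R : realType.
Local Notation theta := (theta R).
Local Notation kappa := (kappa R).
Local Notation rt := (rt R).
Local Notation rate := (rate R).
Local Notation growth := (growth R).
Local Notation model := (model R).
Local Notation codiv := (codiv R).

Definition model_ratio (n : nat) : R := (overpartition_count n)%:R / model n.
Definition weight (b l : nat) : R := codiv (b - l) * model l / (b%:R * model b).

Lemma codiv0 : codiv 0 = 0.
Proof.
by apply/eqP; rewrite eq_le codiv_ge0 andbT; have := codiv_le R 0; rewrite expr0n mulr0.
Qed.

Lemma sum_reverse (f : nat -> R) b :
  \sum_(k < b.+1) codiv k * f (b - k)%N = \sum_(0 <= l < b) codiv (b - l) * f l.
Proof.
rewrite (reindex_inj rev_ord_inj) /= big_ord_recr /= subnn codiv0 mul0r addr0 big_mkord.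
apply: eq_bigr => k _; rewrite subSS; congr (_ * f _).
by rewrite subKn // ltnW.
Qed.

Lemma mul_model_gt0 b : (0 < b)%N -> 0 < b%:R * model b.
Proof. by move=> b0; rewrite mulr_gt0 ?ltr0n // model_gt0. Qed.

Lemma weight_ge0 b l : 0 <= weight b l.
Proof.
by rewrite divr_ge0 // mulr_ge0 ?codiv_ge0 // ltW // model_gt0.
Qed.

Lemma model_ratio_gt0 n : 0 < model_ratio n.
Proof. by rewrite divr_gt0 ?model_gt0 // ltr0n overpartition_count_gt0. Qed.

Lemma model_ratio_rec b : (0 < b)%N -> model_ratio b = \sum_(0 <= l < b) weight b l * model_ratio l.
Proof.
move=> b0; have m0 := model_gt0 R.
have := congr1 (fun n : nat => n%:R : R) (overpartition_rec b).
rewrite natrM natr_sum (eq_bigr (fun k : 'I_b.+1 => codiv k * (overpartition_count (b - k))%:R)); last first.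
  by move=> k _; rewrite natrM.
rewrite (sum_reverse (fun n => (overpartition_count n)%:R)) => h.
have bn : b%:R != 0 :> R by rewrite pnatr_eq0 -lt0n.
have -> : model_ratio b = (b%:R * (overpartition_count b)%:R) / (b%:R * model b).
  by rewrite /model_ratio; field; rewrite bn gt_eqF.
rewrite h big_distrl /=; apply: eq_bigr => l _; rewrite /weight /model_ratio; field.
by rewrite bn !gt_eqF.
Qed.

Lemma weight_sum K : exists2 C, 0 <= C & forall b, (3 < b)%N ->
  `|\sum_(0 <= l < b) weight b l - 1| <= C * theta b ^+ K.
Proof.
have [C C0 hC] := model_recurrence R K; exists C => // b b3.
have b0 : (0 < b)%N by apply: ltn_trans b3.
have mm := mul_model_gt0 b0.
have -> : \sum_(0 <= l < b) weight b l - 1 =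
  (\sum_(k < b.+1) codiv k * model (b - k) - b%:R * model b) / (b%:R * model b).
  by rewrite (sum_reverse model) mulrBl divff ?gt_eqF // big_distrl /=.
rewrite normrM normfV (gtr0_norm mm) ler_pdivrMr //; exact: hC.
Qed.

(** The tail at distance [b theta / 2]: half of the rate is at least [theta^2 / 2], and
    [b theta^3 / 4 = 1 / (4 theta)]. *)
Lemma exp_inv_theta_small p : exists2 C, 0 <= C & forall n, (0 < n)%N ->
  expR (- (4 * theta n)^-1) <= C * theta n ^+ p.
Proof.
exists (p`!%:R * 4 ^+ p); first by rewrite mulr_ge0 // exprn_ge0.
move=> n n0; have t0 := theta_gt0 R n0.
have i0 : 0 < (4 * theta n)^-1 by rewrite invr_gt0 mulr_gt0.
have h := @pow_le_exp R p _ (ltW i0).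
rewrite expRN -[X in X <= _]mul1r ler_pdivrMr ?expR_gt0 //.
move: h; rewrite exprVn -[X in X <= _]mulr1 ler_pdivrMl ?exprn_gt0 ?mulr_gt0 // exprMn => h.
apply: le_trans h _.
by rewrite le_eqVlt; apply/orP; left; apply/eqP; ring.
Qed.

Lemma weight_le b l : (0 < b)%N -> (l <= b)%N ->
  weight b l <= pi * (codiv (b - l) * expR (- ((b - l)%:R * rate b))).
Proof.
move=> b0 lb; have mm := mul_model_gt0 b0; have g0 := growth_gt0 R b.
rewrite /weight ler_pdivrMr //.
have h := @model_decay R b (b - l) b0 (leq_subr _ _); rewrite subKn // in h.
apply: le_trans (ler_wpM2l (codiv_ge0 _ _) h) _.
have -> : pi * (codiv (b - l) * expR (- ((b - l)%:R * rate b))) * (b%:R * model b) =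
  codiv (b - l) * (pi * ((b%:R * model b) * expR (- ((b - l)%:R * rate b)))) by ring.
apply: ler_wpM2l; first exact: codiv_ge0.
apply: ler_wpM2l; first exact: pi_ge0.
by apply: ler_wpM2r; [exact: expR_ge0 | exact: growth_le_mul_model].
Qed.

(** The lags decay exponentially at scale [sqrt b], so a distance of order [b theta = b^(3/4)] is
    beyond all orders. *)
Lemma weight_tail K : exists2 C, 0 <= C & forall b L, (3 < b)%N -> (L <= b)%N ->
  b%:R * theta b <= 2 * (b - L)%:R -> \sum_(0 <= l < L) weight b l <= C * theta b ^+ K.
Proof.
have [C C0 hC] := codiv_moment_bound R 0.
(* Six more orders repay the crude bound [z^-3] for the moment. *)
have [E E0 hE] := exp_inv_theta_small (K + 6).
have p0 := pi_ge0 R.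
exists (pi * (E * (C * 8))); first by rewrite mulr_ge0 // mulr_ge0 // mulr_ge0.
move=> b L b3 Lb hL; have b0 : (0 < b)%N by apply: ltn_trans b3.
have hz := rate_bounds R b3; have /andP[z0 z1] := hz.
have hz2 : 0 < rate b / 2 <= 1 by apply/andP; split; lra.
have t0 := theta_gt0 R b0; have t1 := theta_le1 R b0.
pose X := (b - L)%N.
apply: le_trans (_ : pi * (codiv_moment_sum 0 (rate b) b.+1 - codiv_moment_sum 0 (rate b) X.+1) <= _).
  rewrite /codiv_moment_sum -!(big_mkord xpredT (fun k => codiv k * k%:R ^+ 0 * expR (- (k%:R * rate b)))).
  rewrite (@big_cat_nat _ _ _ X.+1 0 b.+1) //=; last by rewrite ltnS leq_subr.
  rewrite addrAC subrr add0r big_distrr /=.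
  rewrite (@big_addn _ _ _ 0 b.+1 X.+1) big_nat_rev /= add0n.
  rewrite (_ : b.+1 - X.+1 = L)%N; last by rewrite subSS /X subKn.
  rewrite !big_nat; apply: ler_sum => l /andP[_ lL].
  have -> : (l + X.+1 = b - (L - l.+1))%N by rewrite /X; clear - lL Lb; lia.
  rewrite expr0 mulr1; apply: weight_le => //; exact: leq_trans (leq_subr _ _) Lb.
rewrite -mulrA; apply: ler_wpM2l => //.
apply: le_trans (_ : codiv_moment 0 (rate b) - codiv_moment_sum 0 (rate b) X.+1 <= _).
  by rewrite lerD2r codiv_moment_sum_le.
apply: le_trans (moment_tail 0 X.+1 hz) _.
have G : codiv_moment 0 (rate b / 2) <= C * 8 / theta b ^+ 6.
  apply: le_trans (hC _ hz2) _; rewrite expr_div_n invf_div -!mulrA; apply: ler_wpM2l => //.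
  have -> : 2 * (2 * (2 / rate b ^+ 3)) = 8 / rate b ^+ 3 by ring.
  by apply: ler_wpM2l => //; apply: (@inv_rate_pow_le R b 3).
have Ex : expR (- (X.+1%:R * (rate b / 2))) <= E * theta b ^+ (K + 6).
  apply: le_trans (hE b b0); rewrite ler_expR lerN2.
  apply: le_trans (_ : X%:R * (theta b ^+ 2 / 2) <= _); last first.
    apply: ler_pM => //; first by rewrite divr_ge0 // exprn_ge0 // ltW.
      by rewrite ler_nat.
    by rewrite ler_pM2r ?invr_gt0 // theta_le_rate.
  have bt : b%:R * theta b ^+ 4 = 1 by rewrite theta_pow4 mulfV // pnatr_eq0 -lt0n.
  have -> : (4 * theta b)^-1 = (b%:R * theta b ^+ 4) * (4 * theta b)^-1 by rewrite bt mul1r.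
  have -> : b%:R * theta b ^+ 4 * (4 * theta b)^-1 = (b%:R * theta b) * (theta b ^+ 2 / 4).
    by field; rewrite gt_eqF.
  have -> : X%:R * (theta b ^+ 2 / 2) = (2 * X%:R) * (theta b ^+ 2 / 4) by field.
  by apply: ler_wpM2r => //; rewrite divr_ge0 // exprn_ge0 // ltW.
apply: le_trans (ler_pM (expR_ge0 _) (codiv_moment_ge0 _ hz2) Ex G) _.
rewrite exprD le_eqVlt; apply/orP; left; apply/eqP; field.
by rewrite gt_eqF // exprn_gt0.
Qed.

End Instance.

(** * Harmonic sums against [kappa] *)

Section HarmonicLog.
Variable R : realType.
Local Notation kappa := (kappa R).

Lemma harmonic_sum_le_ln X : harmonic_sum R X.+1 <= 1 + ln X.+1%:R.
Proof.
elim: X => [|X IH]; first by rewrite /harmonic_sum big_ord1 ln1 addr0 invr1.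
rewrite /harmonic_sum big_ord_recr /=; apply: le_trans (lerD IH (lexx _)) _.
have x0 : 0 < (X.+1%:R : R) by rewrite ltr0n.
have y0 : 0 < (X.+2%:R : R) by rewrite ltr0n.
rewrite -addrA lerD2l -lerBrDl -lerN2 opprB -ln_div ?posrE //.
have -> : X.+1%:R = X.+2%:R - 1 :> R by rewrite -[X.+2%:R]natr1 addrK.
rewrite mulrBl divff ?gt_eqF // mul1r.
by apply: le_ln1Dx; rewrite ltrN2 invf_lt1 // ltr1n.
Qed.

(** [ln N = 8 ln (1 / kappa) <= 8 / kappa], and the remaining terms are at most 2. *)
Lemma kappa_harmonic_sum N : (0 < N)%N -> kappa N * harmonic_sum R (2 * N) <= 10.
Proof.
move=> N0; have k0 := kappa_gt0 R N0; have k1 := kappa_le1 R N0.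
have NR : 0 < (N%:R : R) by rewrite ltr0n.
have ik0 : 0 < (kappa N)^-1 by rewrite invr_gt0.
have lnN : ln (N%:R : R) <= 8 * (kappa N)^-1.
  have -> : (N%:R : R) = (kappa N)^-1 ^+ 8 by rewrite exprVn kappa_pow8 invrK.
  by rewrite lnXn // [X in _ <= X]mulr_natl lerMn2r /= ltW // ln_sublinear.
have ln2 : ln (2 : R) <= 1 by have := @le_ln1Dx R 1; rewrite (_ : 1 + 1 = 2) //; apply; lra.
have h : harmonic_sum R (2 * N) <= 2 + 8 * (kappa N)^-1.
  have e : (2 * N = (2 * N).-1.+1)%N by rewrite prednK // muln_gt0.
  rewrite e; apply: le_trans (harmonic_sum_le_ln _) _; rewrite -e natrM lnM ?posrE //; lra.
apply: le_trans (ler_wpM2l (ltW k0) h) _.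
rewrite mulrDr mulrCA divff ?gt_eqF //; lra.
Qed.

Lemma harmonic_sum_homo X Y : (X <= Y)%N -> harmonic_sum R X <= harmonic_sum R Y.
Proof.
move=> h; rewrite /harmonic_sum -!(big_mkord xpredT (fun r => (r.+1%:R : R)^-1)).
by rewrite (@big_cat_nat _ _ _ X 0 Y) //= lerDl sumr_ge0.
Qed.

End HarmonicLog.

(** * Lower bound for the mass landing in a block *)

Section Minorization.
Variable R : realType.
Local Notation theta := (theta R).
Local Notation kappa := (kappa R).
Local Notation rt := (rt R).
Local Notation rate := (rate R).
Local Notation growth := (growth R).
Local Notation model := (model R).
Local Notation codiv := (codiv R).

(** The block length [r]: over [2 r] indices below [N], [pi sqrt x] changes by a bounded amount, so
    [growth] stays comparable. *)
Definition root_floor (N : nat) : nat := Num.trunc (rt N).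

Lemma root_floor_spec N : (3 < N)%N ->
  [/\ (0 < root_floor N)%N, (root_floor N * root_floor N <= N)%N & (2 * root_floor N <= N)%N].
Proof.
move=> N3; have N0 : (0 < N)%N by apply: ltn_trans N3.
have r1 := rt_ge1 R N0.
have hr : (root_floor N)%:R <= rt N by rewrite truncn_le //; lra.
have p0 : (0 < root_floor N)%N by rewrite /root_floor truncn_gt0.
have sq : (root_floor N * root_floor N <= N)%N.
  rewrite -(ler_nat R) natrM -(rt_sqr R N) expr2; apply: ler_pM => //.
split=> //.
by move: (root_floor N) p0 sq => r p0 sq; clear - sq N3; nia.
Qed.

Lemma root_floor_ge N : (0 < N)%N -> rt N <= 2 * (root_floor N)%:R.
Proof.
move=> N0; have r1 := rt_ge1 R N0.
have h : rt N < (root_floor N).+1%:R by rewrite truncnS_gt //; lra.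
have p0 : (1 <= root_floor N)%N by rewrite /root_floor truncn_gt0.
move: p0; rewrite -(ler_nat R) => p0; move: h; rewrite -natr1; lra.
Qed.

(** For [s <= N / 2] the factor [N] is comparable with [N - s] and disappears through [mul_model];
    beyond, half of the exponential absorbs it. *)
Lemma model_half_decay : exists2 D, 0 < D & forall N s, (3 < N)%N -> (s <= N)%N ->
  N%:R * model (N - s) <= D * (growth N * expR (- (s%:R * (rate N / 2)))).
Proof.
have a0 : (0 : R) < pi / 8 by rewrite divr_gt0 // pi_gt0.
have [C C0 hC] := theta_exp_small 4 a0.
have p0 := pi_gt0 R.
exists (2 * pi + pi * C); first by rewrite ltr_pwDl ?mulr_gt0 // mulr_ge0 // ltW.
move=> N s N3 sN; have N0 : (0 < N)%N by apply: ltn_trans N3.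
have NR : 0 < (N%:R : R) by rewrite ltr0n.
have g0 := growth_gt0 R N; have z0 := rate_gt0 R N0.
set E := expR (- (s%:R * (rate N / 2))).
have E0 : 0 < E by exact: expR_gt0.
have EE : expR (- (s%:R * rate N)) = E * E by rewrite /E -expRD; congr expR; field.
have E1 : E <= 1 by rewrite /E -expR0 ler_expR oppr_le0 mulr_ge0 // divr_ge0 // ltW.
case: (leqP (2 * s) N) => hs.
  have m0 : (0 < N - s)%N by rewrite subn_gt0; clear - hs N0; lia.
  have mR : 0 < ((N - s)%:R : R) by rewrite ltr0n.
  have NM : (N%:R : R) <= 2 * (N - s)%:R by rewrite -natrM ler_nat; clear - hs; lia.
  apply: le_trans (_ : 2 * ((N - s)%:R * model (N - s)) <= _).
    by rewrite mulrA; apply: ler_wpM2r => //; exact/ltW/model_gt0.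
  rewrite mul_model //.
  apply: le_trans (_ : 2 * ((growth N * (E * E)) * pi) <= _).
    apply: ler_wpM2l => //; apply: ler_pM => //.
    - by rewrite ltW // growth_gt0.
    - have t0 := theta_gt0 R m0; have t1 := theta_le1 R m0; have := pi_ge2 R.
      have : theta (N - s) ^+ 2 <= 1 by rewrite exprn_ile1 // ltW.
      lra.
    - by rewrite -EE growth_decay.
    - by rewrite gerBl exprn_even_ge0.
  have -> : 2 * (growth N * (E * E) * pi) = 2 * pi * (growth N * E) * E by ring.
  apply: le_trans (_ : 2 * pi * (growth N * E) <= _).
    by rewrite ler_piMr // !mulr_ge0 // ltW.
  by rewrite ler_pM2r ?mulr_gt0 // lerDl mulr_ge0 // ltW.
have h := @model_decay R N s N0 sN; rewrite EE in h.
have EC : E <= C / N%:R.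
  apply: le_trans (_ : C * theta N ^+ 4 <= _); last by rewrite theta_pow4.
  apply: le_trans (hC N N0); rewrite ler_expR lerN2 /rate theta_sqr.
  have r0 := rt_gt0 R N0.
  rewrite -(ler_pM2r r0).
  have -> : s%:R * (pi / 2 * (rt N)^-1 / 2) * rt N = pi / 8 * (2 * s%:R) by field; rewrite gt_eqF.
  have -> : pi / 8 * rt N * rt N = pi / 8 * rt N ^+ 2 by ring.
  by rewrite ler_pM2l // rt_sqr -natrM ler_nat ltnW.
apply: le_trans (ler_wpM2l (ltW NR) h) _.
apply: le_trans (_ : N%:R * (pi * (growth N * (E * (C / N%:R)))) <= _).
  by rewrite !ler_pM2l.
have -> : N%:R * (pi * (growth N * (E * (C / N%:R)))) = pi * C * (growth N * E) by field; rewrite gt_eqF.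
by apply: ler_wpM2r; [rewrite mulr_ge0 // ltW | rewrite lerDr mulr_ge0 // ltW].
Qed.

(** The distance is split as [(b - N) + s] with [s = N - k]; against the exponential weights, 1 sums
    to [O(sqrt N)] and [s] to [O(N)]. *)
Lemma below_mass : exists2 D, 0 < D & forall N b, (3 < N)%N -> (N <= b)%N ->
  N%:R * \sum_(0 <= k < N) (b - k)%:R * model k <= D * (growth N * ((b - N)%:R * rt N + N%:R)).
Proof.
have [D D0 hD] := model_half_decay; have [C C0 hC] := exp_moment_bound R 1.
exists (D * (4 + 4 * C)); first by rewrite mulr_gt0 // ltr_wpDr // mulr_ge0.
move=> N b N3 Nb; have N0 : (0 < N)%N by apply: ltn_trans N3.
have g0 := growth_gt0 R N; have r0 := rt_gt0 R N0; have r1 := rt_ge1 R N0.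
set z := rate N / 2; set d : R := (b - N)%:R.
have d0 : 0 <= d by rewrite /d.
have /andP[q0 q1] := rate_bounds R N3.
have z0 : 0 < z by rewrite /z divr_gt0.
have z1 : z <= 1 by rewrite /z; lra.
have iz : z^-1 <= 2 * rt N.
  rewrite -[X in _ <= X]invrK lef_pV2 ?posrE // ?invr_gt0 ?mulr_gt0 //.
  rewrite /z invfM mulrC -theta_sqr ler_pM2r ?invr_gt0 //; exact: theta_le_rate.
apply: le_trans (_ : D * growth N * (\sum_(0 <= s < N.+1) (d + s%:R) * expR (- (s%:R * z))) <= _).
  rewrite big_nat_recl //= big_nat_rev /= add0n.
  rewrite mulrDr big_distrr /= big_distrr /=.
  apply: ler_wpDl; first by rewrite !mulr_ge0 ?addr_ge0 ?expR_ge0 // ltW.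
  rewrite !big_nat; apply: ler_sum => s /andP[_ sN].
  have -> : (b - (N - s.+1))%:R = d + s.+1%:R :> R.
    by rewrite /d -natrD; congr _%:R; clear - sN Nb; lia.
  rewrite mulrCA [D * _ * _]mulrCA ler_wpM2l ?addr_ge0 // -mulrA.
  exact: hD.
rewrite -mulrA [X in _ <= X](_ : _ = D * (growth N * ((4 + 4 * C) * (d * rt N + N%:R)))); last ring.
rewrite !ler_pM2l // big_mkord.
rewrite (eq_bigr (fun s : 'I_N.+1 => d * expR (- (s%:R * z)) + s%:R ^+ 1 * expR (- (s%:R * z)))); last first.
  by move=> s _; rewrite expr1 mulrDl.
rewrite big_split /= -big_distrr /=.
have g := @geometric_exp_sum R z N.+1 z0.
have m := hC z N.+1 (introT andP (conj z0 z1)).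
have A1 : d * \sum_(i < N.+1) expR (- (i%:R * z)) <= d * (4 * rt N).
  apply: ler_wpM2l => //; lra.
have A2 : C / z ^+ 2 <= C * (4 * N%:R).
  apply: ler_wpM2l => //; rewrite -exprVn -(rt_sqr R N).
  have -> : 4 * rt N ^+ 2 = (2 * rt N) ^+ 2 by ring.
  by apply: lerXn2r; rewrite ?nnegrE ?mulr_ge0 ?invr_ge0 // ltW.
have X0 : 0 <= C * (d * rt N) by rewrite !mulr_ge0 // ltW.
have NR : 0 <= (N%:R : R) by [].
apply: le_trans (lerD A1 (le_trans m A2)) _.
rewrite [X in _ <= X](_ : _ = d * (4 * rt N) + C * (4 * N%:R) + (4 * N%:R + 4 * (C * (d * rt N)))); last ring.
by rewrite lerDl addr_ge0 // mulr_ge0.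
Qed.

(** On the block [sqrt l >= sqrt N - 2], whence [e^(-2 pi)]; and [r c(b - l) >= 2 r (b - N + r)]
    matches the shape of [below_mass] since [r >= sqrt N / 2]. *)
Lemma landing_lower N b l : (3 < N)%N -> (N <= b)%N ->
  (N - 2 * root_floor N <= l < N - root_floor N)%N ->
  growth N * ((b - N)%:R * rt N + N%:R) * (expR (- (2 * pi)) / 2) <=
   N%:R * ((root_floor N)%:R * (codiv (b - l) * model l)).
Proof.
move=> N3 Nb /andP[l1 l2]; have N0 : (0 < N)%N by apply: ltn_trans N3.
have r0 := rt_gt0 R N0; have rf := root_floor_ge N0.
have [_ sq rN] := root_floor_spec N3.
have rle : (root_floor N)%:R <= rt N by rewrite truncn_le // ltW.
set r := root_floor N in l1 l2 rf sq rN rle *.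
have NR : 0 < (N%:R : R) by rewrite ltr0n.
set d : R := (b - N)%:R; have d0 : 0 <= d by rewrite /d.
have bl : d + r%:R <= (b - l)%:R by rewrite /d -natrD ler_nat; clear - l2 Nb; lia.
have rt2 : 2 <= rt N.
  rewrite -[X in X <= _](@ger0_norm R) // -sqrtr_sqr ler_sqrt // -natrX ler_nat //.
have lR : N%:R - 2 * r%:R <= (l%:R : R).
  by rewrite lerBlDr -natrM -natrD ler_nat; clear - l1; lia.
have rtl : rt N - 2 <= rt l.
  rewrite -(@ler_pXn2r _ 2) ?nnegrE ?subr_ge0 ?sqrtr_ge0 // rt_sqr sqrrB rt_sqr; lra.
have gl : growth N * expR (- (2 * pi)) <= growth l.
  rewrite /growth -expRD ler_expR (_ : _ + _ = pi * (rt N - 2)); last by move: (pi : R) => c; ring.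
  by rewrite ler_pM2l // pi_gt0.
have ml : growth l <= N%:R * model l.
  case: (posnP l) => [l0|l0].
    rewrite l0 growth0 /model eqxx mulr1 ler1n //.
  apply: le_trans (growth_le_mul_model R l0) _.
  rewrite ler_wpM2r ?(ltW (model_gt0 _ _)) // ler_nat; clear - l2; lia.
have M1 : growth N * expR (- (2 * pi)) <= N%:R * model l by apply: le_trans ml.
have M2 : (d * rt N + N%:R) / 2 <= r%:R * codiv (b - l).
  apply: le_trans (_ : r%:R * (2 * (d + r%:R)) <= _); last first.
    apply: ler_wpM2l => //; apply: le_trans (codiv_ge R _); rewrite ler_pM2l //.
  have h1 : rt N * d <= (2 * r%:R) * d by rewrite ler_wpM2r.
  have h2 : rt N * rt N <= (2 * r%:R) * (2 * r%:R) by apply: ler_pM => //; exact: ltW.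
  move: h2; rewrite -expr2 rt_sqr => h2.
  have h3 : 0 <= rt N * d by rewrite mulr_ge0 // ltW.
  move: (r%:R) (rt N) h1 h2 h3 => x y h1 h2 h3; nra.
have G0 : 0 <= growth N * expR (- (2 * pi)) by rewrite mulr_ge0 ?expR_ge0 // ltW // growth_gt0.
have Q0 : 0 <= (d * rt N + N%:R) / 2 by rewrite divr_ge0 // addr_ge0 // mulr_ge0 // ltW.
have := ler_pM G0 Q0 M1 M2.
rewrite [X in X <= _ -> _](_ : _ = growth N * (d * rt N + N%:R) * (expR (- (2 * pi)) / 2)); last ring.
by rewrite [X in _ <= X -> _](_ : _ = N%:R * (r%:R * (codiv (b - l) * model l))); last ring.
Qed.

(** Compares [landing_lower] with [below_mass]; up to constants the loss is the logarithm of
    [codiv_le_harmonic]. *)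
Lemma weight_min : exists2 c, 0 < c <= 1 & forall N, (4 <= N)%N -> forall b l,
  (N <= b <= 2 * N)%N -> (N - 2 * root_floor N <= l < N - root_floor N)%N ->
  c * kappa N * (\sum_(0 <= k < N) weight R b k) <= (root_floor N)%:R * weight R b l.
Proof.
have [D D0 hD] := below_mass.
pose e : R := expR (- (2 * pi)) / 2; have e0 : 0 < e by rewrite divr_gt0 ?expR_gt0.
have e1 : e <= 1.
  have : expR (- (2 * pi)) <= 1 :> R by rewrite -expR0 ler_expR oppr_le0 mulr_ge0 // pi_ge0.
  by have := expR_ge0 (- (2 * pi) : R); rewrite /e; lra.
(* [20 = 2 * 10], from [codiv_le_harmonic] and [kappa_harmonic_sum]; the summand 1 keeps the
   constant at most 1. *)
exists (e / (20 * D + 1)).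
  by rewrite divr_gt0 //=; [rewrite ler_pdivrMr; lra | lra].
move=> N N3 b l /andP[Nb b2] hl; have N0 : (0 < N)%N by apply: ltn_trans N3.
have NR : 0 < (N%:R : R) by rewrite ltr0n.
have b0 : (0 < b)%N by apply: leq_trans Nb.
have mm := mul_model_gt0 R b0.
have k0 := kappa_gt0 R N0.
have low := landing_lower N3 Nb hl.
rewrite -/e in low.
have f0 : 0 < e / (20 * D + 1) by rewrite divr_gt0 //; lra.
have fD : e / (20 * D + 1) * (20 * D) <= e.
  by rewrite mulrAC ler_pdivrMr ?ler_pM2l //; lra.
move: (e / _) f0 fD => f f0 fD.
clearbody e.
rewrite /weight -big_distrl /= !mulrA ler_pM2r ?invr_gt0 // -!mulrA.
rewrite -(ler_pM2l NR).
apply: le_trans low.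
have S0 : \sum_(0 <= k < N) codiv (b - k) * model k <=
  2 * harmonic_sum R (2 * N) * \sum_(0 <= k < N) (b - k)%:R * model k.
  rewrite big_distrr /= !big_nat; apply: ler_sum => k /andP[_ kN].
  rewrite mulrA; apply: ler_wpM2r; first exact/ltW/model_gt0.
  apply: le_trans (codiv_le_harmonic R _) _.
  rewrite [X in _ <= X]mulrAC; apply: ler_wpM2l; first by rewrite mulr_ge0.
  by apply: harmonic_sum_homo; apply: leq_trans (leq_subr _ _) b2.
set X := \sum_(0 <= k < N) (b - k)%:R * model k in S0.
have X0 : 0 <= X by apply: sumr_ge0 => k _; rewrite mulr_ge0 // ltW // model_gt0.
have kh := kappa_harmonic_sum R N0.
have hX := hD N b N3 Nb; rewrite -/X in hX.
set G := growth N * _ in hX *.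
have G0 : 0 <= G.
  by rewrite mulr_ge0 ?(ltW (growth_gt0 _ _)) // addr_ge0 // mulr_ge0 // sqrtr_ge0.
apply: le_trans (_ : N%:R * (f * (kappa N * (2 * harmonic_sum R (2 * N) * X))) <= _).
  by rewrite !ler_pM2l.
apply: le_trans (_ : f * (20 * (N%:R * X)) <= _).
  have -> : N%:R * (f * (kappa N * (2 * harmonic_sum R (2 * N) * X))) =
    f * (2 * (kappa N * harmonic_sum R (2 * N)) * (N%:R * X)) by ring.
  rewrite ler_pM2l //; apply: ler_wpM2r; first by rewrite mulr_ge0 // ltW.
  lra.
apply: le_trans (_ : f * (20 * (D * G)) <= _); first by rewrite ler_pM2l // ler_pM2l.
have -> : f * (20 * (D * G)) = G * (f * (20 * D)) by ring.
exact: ler_wpM2l.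
Qed.

Lemma model_ratio_bounds : exists2 m : R, 0 < m & exists M, forall l, m <= model_ratio R l <= M.
Proof.
have [M hM] := u_upper (@weight_ge0 R) (@model_ratio_rec R) (@model_ratio_gt0 R) (@weight_sum R).
have [m m0 hm] := u_lower (@weight_ge0 R) (@model_ratio_rec R) (@model_ratio_gt0 R) (@weight_sum R).
by exists m => //; exists M => l; rewrite hm hM.
Qed.

Lemma model_ratio_cauchy K : exists2 B, 0 <= B & forall N a b, (0 < N)%N -> (N <= a)%N -> (N <= b)%N ->
  model_ratio R a - model_ratio R b <= B * kappa N ^+ K.
Proof.
have [m m0 [M hM]] := model_ratio_bounds.
have [c hc hmin] := weight_min.
apply: (@u_cauchy R (model_ratio R) (weight R) M c root_floor) => //.
- exact: weight_ge0.
- exact: model_ratio_rec.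
- by move=> l; have /andP[_ h] := hM l; rewrite gtr0_norm // model_ratio_gt0.
- exact: weight_sum.
- exact: weight_tail.
- exact: root_floor_spec.
- by exists 4%N.
Qed.

End Minorization.

(** * From logarithmic expansions to Hermite-Jensen limits *)

Section FiniteDifferences.
Variable R : comNzRingType.
Implicit Types (f g : nat -> R) (r i k : nat).

Fixpoint fdiff r f i : R :=
  if r is r'.+1 then fdiff r' f i.+1 - fdiff r' f i else f i.

Lemma eq_fdiff f g r i : f =1 g -> fdiff r f i = fdiff r g i.
Proof. by move=> h; elim: r i => [|r IH] i /=; rewrite ?h ?IH. Qed.

Lemma fdiffD f g r i : fdiff r (fun j => f j + g j) i = fdiff r f i + fdiff r g i.
Proof. by elim: r i => //= r IH i; rewrite !IH; ring. Qed.

Lemma fdiffZ a f r i : fdiff r (fun j => a * f j) i = a * fdiff r f i.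
Proof. by elim: r i => //= r IH i; rewrite !IH mulrBr. Qed.

Lemma fdiff_sum (n : nat) (F : 'I_n -> nat -> R) r i :
  fdiff r (fun j => \sum_(k < n) F k j) i = \sum_(k < n) fdiff r (F k) i.
Proof. by elim: r i => //= r IH i; rewrite !IH sumrB. Qed.

Lemma fdiff_shift f r i : fdiff r.+1 f i = fdiff r (fun j => f j.+1 - f j) i.
Proof. by elim: r i => //= r IH i; rewrite -!IH. Qed.

Lemma fdiffE f r i : fdiff r f i = \sum_(l < r.+1) 'C(r, l)%:R * (-1) ^+ (r - l) * f (i + l)%N.
Proof.
elim: r f => [|r IH] f; first by rewrite big_ord1 /= bin0 expr0 !mul1r addn0.
rewrite fdiff_shift IH [RHS]big_ord_recl /= bin0 mul1r subn0 addn0.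
rewrite [X in _ = _ + X](eq_bigr (fun l : 'I_r.+1 =>
   'C(r, l.+1)%:R * (-1) ^+ (r - l) * f (i + l.+1)%N + 'C(r, l)%:R * (-1) ^+ (r - l) * f (i + l.+1)%N)); last first.
  by move=> l _; rewrite /bump /= add1n binS natrD subSS; ring.
rewrite big_split /= addrA.
rewrite [X in _ = _ + X + _]big_ord_recr /= bin_small // !mul0r addr0.
under eq_bigr do rewrite mulrBr -addnS.
rewrite sumrB addrC; congr (_ + _).
rewrite big_ord_recl /= bin0 mul1r subn0 addn0 opprD exprS mulN1r mulNr; congr (_ + _).
rewrite -sumrN; apply: eq_bigr => l _; rewrite /bump /= add1n -(@subnSK l r) // exprS; ring.
Qed.

Lemma fdiff_pow r k i : (k <= r)%N -> fdiff r (fun j => j%:R ^+ k) i = r`!%:R *+ (k == r).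
Proof.
elim: r k => [|r IH] k; first by rewrite leqn0 => /eqP->.
move=> kr; rewrite fdiff_shift.
have -> : fdiff r (fun j => j.+1%:R ^+ k - j%:R ^+ k) i =
   fdiff r (fun j => \sum_(l < k) 'C(k, l)%:R * j%:R ^+ l) i.
  apply: eq_fdiff => j; rewrite -natr1 [_ + 1]addrC exprDn big_ord_recr /= subnn expr0 mul1r binn mulr1n.
  rewrite addrK; apply: eq_bigr => l _.
  by rewrite expr1n mul1r mulr_natl.
rewrite (@fdiff_sum k (fun l j => 'C(k, l)%:R * j%:R ^+ l)).
rewrite (eq_bigr (fun l : 'I_k => 'C(k, l)%:R * (r`!%:R *+ (l == r :> nat)))); last first.
  move=> l _; rewrite fdiffZ IH //; rewrite -ltnS; exact: leq_trans kr.
case: (ltngtP k r.+1) kr => // [kr|->] _.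
  rewrite big1 // => l _; rewrite (_ : (l == r :> nat) = false) ?mulr0 //.
  by apply/negbTE; rewrite neq_ltn (leq_trans (ltn_ord l)).
rewrite big_ord_recr /= eqxx big1 ?add0r => [|l _]; last first.
  by rewrite (ltn_eqF (ltn_ord l)) mulr0.
by rewrite binSn !mulr1n -natrM factS.
Qed.

End FiniteDifferences.

(** * Coefficients of the rescaled Jensen polynomials *)

Section JensenCoefficients.
Variable R : realType.
Implicit Types (alpha A delta : nat -> R) (d n i : nat).

Definition rescaled alpha A n j : R := alpha (n + j)%N / alpha n / expR (A n) ^+ j.

Lemma coef_affine_pow (s : R) j i : ((s *: 'X - 1) ^+ j)`_i = 'C(j, i)%:R * s ^+ i * (-1) ^+ (j - i).
Proof.
rewrite exprDn coef_sum.
have h (k : 'I_j.+1) : true -> ((s *: 'X) ^+ (j - k) * (- 1) ^+ k *+ 'C(j, k))`_i =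
   'C(j, k)%:R * s ^+ (j - k) * (-1) ^+ k * (i == j - k)%N%:R.
  move=> _; rewrite coefMn exprZn -[(-1 : {poly R})]polyCN -polyC_exp coefMC coefZ coefXn.
  by rewrite -mulr_natl; ring.
rewrite (eq_bigr _ h); case: (leqP i j) => ij.
  rewrite (bigD1 (Ordinal (leq_subr i j : j - i < j.+1)%N)) //= subKn // eqxx mulr1 bin_sub //.
  rewrite big1 ?addr0 // => k kn; rewrite (_ : (i == j - k)%N = false) ?mulr0 //.
  apply/negbTE; apply: contraNneq kn => ->; apply/eqP/val_inj => /=; rewrite subKn // -ltnS //.
rewrite bin_small // !mul0r big1 // => k _; rewrite (_ : (i == j - k)%N = false) ?mulr0 //.
by apply/negbTE; rewrite neq_ltn orbC (leq_ltn_trans (leq_subr _ _)).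
Qed.

Lemma signr_subn l m : (l <= m)%N -> (-1) ^+ l = (-1) ^+ m * (-1) ^+ (m - l) :> R.
Proof.
move=> lm; rewrite -{1}(subnKC lm) exprD -mulrA -exprD addnn -[X in _ * X]signr_odd.
by rewrite odd_double expr0 mulr1.
Qed.

Lemma bin_mul_bin d j i : (i <= j <= d)%N ->
  ('C(d, j) * 'C(j, i) = 'C(d, i) * 'C(d - i, j - i))%N.
Proof.
move=> /andP[ij jd]; have id := leq_trans ij jd.
have p : (0 < i`! * (j - i)`! * (d - j)`!)%N by rewrite !muln_gt0 !fact_gt0.
apply/eqP; rewrite -(eqn_pmul2r p); apply/eqP.
have e1 := bin_fact jd; have e2 := bin_fact ij; have e3 := bin_fact id.
have e4 := @bin_fact (d - i) (j - i) (leq_sub2r i jd).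
have e5 : (d - i - (j - i) = d - j)%N by rewrite subnBA // subnK.
rewrite e5 in e4.
transitivity (d`!).
  by rewrite -e1 -e2; ring.
by rewrite -e3 -e4; ring.
Qed.

Section Coef.
Variables (alpha A delta : nat -> R) (d n : nat).
Hypothesis alpha_gt0 : forall k, 0 < alpha k.
Hypothesis delta_neq0 : delta n != 0.

(** Expanding [(delta X - 1)^j] and using [C(d, j) C(j, i) = C(d, i) C(d - i, j - i)] leaves an
    alternating binomial sum, a finite difference of order [d - i]. *)
Lemma coef_jensenJ i :
  ((delta n ^- d / alpha n) *:
     (jensenJ alpha d n \Po ((expR (A n))^-1 *: (delta n *: 'X - 1))))`_i =
  if (i <= d)%N then 'C(d, i)%:R * (-1) ^+ (d - i) *
    (fdiff (d - i) (rescaled alpha A n) i / delta n ^+ (d - i)) else 0.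
Proof.
have a0 : alpha n != 0 by rewrite gt_eqF.
rewrite coefZ /jensenJ raddf_sum /= coef_sum big_distrr /=.
have h (j : 'I_d.+1) : true -> delta n ^- d / alpha n *
    (('C(d, j)%:R * alpha (n + j)%N *: 'X^j) \Po ((expR (A n))^-1 *: (delta n *: 'X - 1)))`_i =
    delta n ^- d * (rescaled alpha A n j * ('C(d, j)%:R * 'C(j, i)%:R * delta n ^+ i * (-1) ^+ (j - i))).
  move=> _; rewrite comp_polyZ comp_Xn_poly exprZn !coefZ coef_affine_pow /rescaled exprVn.
  by ring.
rewrite (eq_bigr _ h) -big_distrr /=; case: (leqP i d) => id; last first.
  rewrite big1 ?mulr0 // => j _; rewrite (@bin_small j i) ?mulr0 ?mul0r ?mulr0 //.
  by apply: leq_ltn_trans id; rewrite -ltnS.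
rewrite fdiffE mulr_suml [RHS]big_distrr /=.
rewrite -(big_mkord xpredT (fun j => rescaled alpha A n j * ('C(d, j)%:R * 'C(j, i)%:R * delta n ^+ i * (-1) ^+ (j - i)))).
rewrite (@big_cat_nat _ _ _ i) //=; last exact: leqW.
rewrite big_nat big1 ?add0r; last first.
  by move=> j /andP[_ ji]; rewrite (@bin_small j i) // mulr0 !mul0r mulr0.
rewrite -{1}[i]add0n big_addn subSn // big_mkord big_distrr /=; apply: eq_bigr => l _.
have ld : (l <= d - i)%N by rewrite -ltnS.
have -> : 'C(d, l + i)%:R * 'C(l + i, i)%:R = 'C(d, i)%:R * 'C(d - i, l)%:R :> R.
  rewrite -!natrM bin_mul_bin ?addnK // leq_addl /=.
  by rewrite addnC -leq_subRL.
rewrite addnK [(l + i)%N]addnC.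
have -> : (-1) ^+ l = (-1) ^+ (d - i) * (-1) ^+ (d - i - l) :> R.
  exact: signr_subn.
have -> : delta n ^- d = (delta n ^+ i)^-1 * (delta n ^+ (d - i))^-1.
  by rewrite -invfM -exprD subnKC.
field.
by rewrite !expf_neq0.
Qed.

(** Reversing the exponents moves the base point of the difference from [i] to 0 and removes the
    sign. *)
Lemma coef_jensenK i :
  (((expR (A n) * delta n) ^- d / alpha n) *:
     (jensenK alpha d n \Po (expR (A n) *: (delta n *: 'X - 1))))`_i =
  if (i <= d)%N then 'C(d, i)%:R *
    (fdiff (d - i) (rescaled alpha A n) 0 / delta n ^+ (d - i)) else 0.
Proof.
have a0 : alpha n != 0 by rewrite gt_eqF.
have e0 : expR (A n) != 0 by rewrite gt_eqF ?expR_gt0.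
rewrite coefZ /jensenK raddf_sum /= coef_sum big_distrr /=.
have h (j : 'I_d.+1) : true -> (expR (A n) * delta n) ^- d / alpha n *
    (('C(d, j)%:R * alpha (n + j)%N *: 'X^(d - j)) \Po (expR (A n) *: (delta n *: 'X - 1)))`_i =
    delta n ^- d * (rescaled alpha A n j * ('C(d, j)%:R * 'C(d - j, i)%:R * delta n ^+ i * (-1) ^+ (d - j - i))).
  move=> _; rewrite exprMn comp_polyZ comp_Xn_poly exprZn !coefZ coef_affine_pow /rescaled.
  have -> : expR (A n) ^+ d = expR (A n) ^+ j * expR (A n) ^+ (d - j).
    by rewrite -exprD subnKC // -ltnS.
  by field; rewrite a0 !expf_neq0.
rewrite (eq_bigr _ h) -big_distrr /=; case: (leqP i d) => id; last first.
  rewrite big1 ?mulr0 // => j _; rewrite (@bin_small (d - j) i) ?mulr0 ?mul0r ?mulr0 //.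
  by apply: leq_ltn_trans id; rewrite leq_subr.
rewrite fdiffE mulr_suml [RHS]big_distrr /=.
rewrite -(big_mkord xpredT (fun j => rescaled alpha A n j * ('C(d, j)%:R * 'C(d - j, i)%:R * delta n ^+ i * (-1) ^+ (d - j - i)))).
rewrite (@big_cat_nat _ _ _ (d - i).+1) //=; last by rewrite ltnS leq_subr.
rewrite [X in _ * (_ + X)]big_nat [X in _ * (_ + X)]big1 ?addr0; last first.
  move=> j /andP[dj jd]; rewrite (@bin_small (d - j) i) ?mulr0 ?mul0r ?mulr0 //.
  by clear - dj id jd; lia.
rewrite big_mkord big_distrr /=; apply: eq_bigr => l _.
have ld : (l <= d - i)%N by rewrite -ltnS.
have -> : 'C(d, l)%:R * 'C(d - l, i)%:R = 'C(d, i)%:R * 'C(d - i, l)%:R :> R.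
  have ll : (l <= d)%N by apply: leq_trans ld (leq_subr _ _).
  rewrite -!natrM -(bin_sub ll) bin_mul_bin; first by rewrite subnAC bin_sub.
  by rewrite leq_subr andbT leq_subRL // addnC -leq_subRL.
rewrite add0n (_ : (d - l - i = d - i - l)%N); last by rewrite subnAC.
have -> : delta n ^- d = (delta n ^+ i)^-1 * (delta n ^+ (d - i))^-1.
  by rewrite -invfM -exprD subnKC.
field.
by rewrite !expf_neq0.
Qed.

End Coef.
End JensenCoefficients.

(** * Limits of sequences and truncated exponentials *)

Section SequenceLimits.
Variable R : realType.
Implicit Types (u v : nat -> R) (a b : R).

Lemma cvg_seq_near u v a : (\forall n \near \oo, u n = v n) ->
  u @ \oo --> a -> v @ \oo --> a.
Proof. by move=> h; apply: cvg_trans; apply: near_eq_cvg. Qed.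

Lemma cvg_seq_cst a : (fun _ : nat => a) @ \oo --> a.
Proof. exact: cvg_cst. Qed.

Lemma cvg_seqM u v a b : u @ \oo --> a -> v @ \oo --> b -> (fun n => u n * v n) @ \oo --> a * b.
Proof. by move=> hu hv; exact: (cvgM hu hv). Qed.

Lemma cvg_seqD u v a b : u @ \oo --> a -> v @ \oo --> b -> (fun n => u n + v n) @ \oo --> a + b.
Proof. by move=> hu hv; exact: (cvgD hu hv). Qed.

Lemma cvg_seqB u v a b : u @ \oo --> a -> v @ \oo --> b -> (fun n => u n - v n) @ \oo --> a - b.
Proof. by move=> hu hv; exact: (cvgB hu hv). Qed.

Lemma cvg_seqZ c u a : u @ \oo --> a -> (fun n => c * u n) @ \oo --> c * a.
Proof. by move=> hu; apply: cvg_seqM hu; exact: cvg_cst. Qed.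

Lemma cvg_seqX u a k : u @ \oo --> a -> (fun n => u n ^+ k) @ \oo --> a ^+ k.
Proof.
move=> hu; elim: k => [|k IH]; first exact: (@cvg_cst _ (1 : R)).
rewrite exprS; apply: cvg_seq_near (cvg_seqM hu IH).
by apply: nearW => n; rewrite exprS.
Qed.

Lemma cvg_seq_sum (k : nat) (F : 'I_k -> nat -> R) (l : 'I_k -> R) :
  (forall i, F i @ \oo --> l i) -> (fun n => \sum_(i < k) F i n) @ \oo --> \sum_(i < k) l i.
Proof.
elim: k F l => [|k IH] F l h.
  rewrite big_ord0; apply: cvg_seq_near (@cvg_cst _ (0 : R) _ \oo _).
  by apply: nearW => n; rewrite big_ord0.
rewrite big_ord_recr /=; apply: cvg_seq_near (cvg_seqD (IH _ _ (fun i => h (widen_ord (leqnSn k) i))) (h ord_max)).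
by apply: nearW => n; rewrite big_ord_recr.
Qed.

Lemma cvg_seq_fdiff (f : nat -> nat -> R) (l : nat -> R) r i :
  (forall j, (j <= i + r)%N -> f j @ \oo --> l j) ->
  (fun n => fdiff r (fun j => f j n) i) @ \oo --> fdiff r l i.
Proof.
elim: r i => [|r IH] i h /=; first by apply: h; rewrite addn0.
apply: cvg_seqB; apply: IH => j hj; apply: h; first by rewrite -addSnnS.
by apply: leq_trans hj _; rewrite leq_add2l.
Qed.

Lemma cvg_seq_squeeze0 u v : (\forall n \near \oo, `|u n| <= v n) ->
  v @ \oo --> 0 -> u @ \oo --> 0.
Proof.
move=> h hv; apply: (@squeeze_cvgr _ _ _ _ (fun n => - v n) v).
- by near=> n; rewrite -ler_norml; near: n.
- by rewrite -(oppr0 R); exact: (cvgN hv).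
- exact: hv.
Unshelve. all: by end_near. Qed.

Lemma exp_taylor (y : R) m : `|y| <= 1 ->
  `|expR y - \sum_(q < m) y ^+ q / q`!%:R| <= expR 1 * `|y| ^+ m.
Proof.
move=> y1; have := @taylor_bound R m (fun=> @expR R) 0 y (expR 1).
rewrite add0r expR0 (eq_bigr (fun q : 'I_m => y ^+ q / q`!%:R)); last by move=> q _; rewrite mul1r mulrC.
move=> h; apply: le_trans (h _ _) _.
- move=> z; rewrite subr0 => hz; rewrite ger0_norm ?expR_ge0 //.
  by rewrite ler_expR; apply: le_trans (ler_norm _) (le_trans hz y1).
rewrite ler_pdivrMr ?ltr0n ?fact_gt0 // ler_peMr ?ler1n ?fact_gt0 //.
Qed.

Arguments cvg_seqX {u a} k _.
Arguments cvg_seqZ c {u a} _.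

Definition coef_cvg (p : nat -> {poly R}) (q : {poly R}) := forall k, (fun n => (p n)`_k) @ \oo --> q`_k.

Lemma coef_cvgM p p' q q' : coef_cvg p q -> coef_cvg p' q' -> coef_cvg (fun n => p n * p' n) (q * q').
Proof.
move=> h h' k; rewrite coefM; apply: cvg_seq_near (cvg_seq_sum (fun i : 'I_k.+1 => cvg_seqM (h i) (h' (k - i)%N))).
by apply: nearW => n; rewrite coefM.
Qed.

Lemma coef_cvgX p q k : coef_cvg p q -> coef_cvg (fun n => p n ^+ k) (q ^+ k).
Proof.
move=> h; elim: k => [|k IH] i; first exact: (@cvg_cst _ ((1 : {poly R})`_i)).
have hk : coef_cvg _ _ := coef_cvgM h IH.
rewrite exprS; apply: cvg_seq_near (hk i).
by apply: nearW => n; rewrite exprS.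
Qed.

(** A truncated exponential stays polynomial, so finite differences act on it power by power. *)
Definition exp_poly (m : nat) (p : {poly R}) : {poly R} := \sum_(q < m.+1) (q`!%:R)^-1 *: p ^+ q.

Lemma coef_cvg_exp m p q : coef_cvg p q -> coef_cvg (fun n => exp_poly m (p n)) (exp_poly m q).
Proof.
move=> h i; have hj j : coef_cvg _ _ := @coef_cvgX p q j h.
have e (r : {poly R}) : (exp_poly m r)`_i = \sum_(j < m.+1) (j`!%:R)^-1 * (r ^+ j)`_i.
  by rewrite coef_sum; apply: eq_bigr => j _; rewrite coefZ.
have hs : (fun n => \sum_(j < m.+1) (j`!%:R)^-1 * (p n ^+ j)`_i) @ \oo --> \sum_(j < m.+1) (j`!%:R)^-1 * (q ^+ j)`_i.
  apply: cvg_seq_sum => j; apply: cvg_seqZ; exact: hj.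
rewrite e; apply: cvg_seq_near hs.
by apply: nearW => n; rewrite e.
Qed.

Lemma horner_exp_poly m p x : (exp_poly m p).[x] = \sum_(q < m.+1) p.[x] ^+ q / q`!%:R.
Proof. by rewrite horner_sum; apply: eq_bigr => q _; rewrite hornerZ horner_exp mulrC. Qed.

Lemma size_exp_poly m (p : {poly R}) : (size p <= m.+1)%N -> (size (exp_poly m p) <= (m * m).+1)%N.
Proof.
move=> hp; apply: leq_trans (size_sum _ _ _) _; apply/bigmax_leqP => q _.
apply: leq_trans (size_scale_leq _ _) _; apply: leq_trans (size_poly_exp_leq _ _) _.
rewrite ltnS; apply: leq_mul; last by rewrite -ltnS.
by rewrite -ltnS; case: (size p) hp.
Qed.

(** The bounds on [r] and [m] give [r./2 <= m], so the relevant power of [- X^2] is within the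
    truncation. *)
Lemma coef_exp_poly_sqr m r : (r <= m.+1)%N -> (0 < m)%N ->
  (exp_poly m (- 'X^2))`_r = if odd r then 0 else (-1) ^+ r./2 / (r./2)`!%:R.
Proof.
move=> rm m0; rewrite coef_sum.
have h (q : 'I_m.+1) : true -> ((q`!%:R)^-1 *: (- 'X^2) ^+ q : {poly R})`_r =
   (q`!%:R)^-1 * (-1) ^+ q * (r == 2 * q)%N%:R.
  by move=> _; rewrite -scaleN1r exprZn !coefZ -exprM coefXn mulrA.
rewrite (eq_bigr _ h); case: ifP => hr.
  rewrite big1 // => q _; rewrite (_ : (r == 2 * q)%N = false) ?mulr0 //.
  by apply/negP => /eqP e; move: hr; rewrite e mul2n odd_double.
have rE : r = (2 * r./2)%N by rewrite mul2n -[LHS]odd_double_half hr.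
have km : (r./2 < m.+1)%N by clear - rE rm m0; lia.
rewrite (bigD1 (Ordinal km)) //= -rE eqxx mulr1 mulrC big1 ?addr0 // => q qn.
rewrite (_ : (r == 2 * q)%N = false) ?mulr0 //; apply/negP => /eqP e; move/eqP: qn; apply.
by apply/val_inj => /=; rewrite e mul2n doubleK.
Qed.

End SequenceLimits.
Arguments cvg_seqX {R u a} k _.
Arguments cvg_seqZ {R} c {u a} _.

(** * Limits of finite differences under a logarithmic expansion *)

Section HermiteJensen.
Variable R : realType.
Variables (alpha A delta : nat -> R) (g : nat -> nat -> R) (m : nat).
Hypothesis alpha_gt0 : forall n, 0 < alpha n.
Hypothesis delta_gt0 : \forall n \near \oo, 0 < delta n.
Hypothesis delta_cvg : delta @ \oo --> 0.
Hypothesis m_ge2 : (2 <= m)%N.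
Hypothesis g_small : forall k, (1 <= k <= m)%N -> (fun n => g k n / delta n ^+ k) @ \oo --> 0.
Hypothesis log_expansion : forall j, (1 <= j <= m.+1)%N ->
  (fun n => (ln (alpha (n + j)%N / alpha n) - (A n * j%:R - delta n ^+ 2 * j%:R ^+ 2
      + \sum_(1 <= k < m.+1) g k n * j%:R ^+ k)) / delta n ^+ m.+1) @ \oo --> 0.

(** Coefficients of the exponent in the variable [x = delta j]; they tend to those of [- x^2]. *)
Let coef (k n : nat) : R := if k == 0%N then 0 else g k n / delta n ^+ k - (k == 2%N)%:R.
Let expo n : {poly R} := \poly_(k < m.+1) coef k n.
Let logr j n : R := ln (alpha (n + j)%N / alpha n) - A n * j%:R.
Let expr j n : R := (expo n).[delta n * j%:R].

Lemma expo_cvg : coef_cvg expo (- 'X^2).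
Proof.
move=> k; rewrite coefN coefXn.
have [km|km] := ltnP k m.+1; last first.
  rewrite gtn_eqF ?oppr0; last by apply: leq_trans km.
  by apply: cvg_seq_near (@cvg_seq_cst R (0)); apply: nearW => n; rewrite coef_poly ltnNge km.
have e : (fun n => coef k n) @ \oo --> (- (k == 2%N)%:R : R).
  rewrite /coef; case: (posnP k) => [->|k0]; first by rewrite oppr0; exact: (@cvg_cst _ (0 : R)).
  rewrite -[X in _ --> X]add0r; apply: cvg_seqB; last exact: cvg_cst.
  by apply: g_small; rewrite k0.
by apply: cvg_seq_near e; apply: nearW => n; rewrite coef_poly km.
Qed.

Lemma size_expo n : (size (expo n) <= m.+1)%N.
Proof. exact: size_poly. Qed.

Lemma exprE j : \forall n \near \oo,
  expr j n = - delta n ^+ 2 * j%:R ^+ 2 + \sum_(1 <= k < m.+1) g k n * j%:R ^+ k.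
Proof.
near=> n; have d0 : 0 < delta n by near: n.
rewrite /expr horner_poly -(big_mkord xpredT (fun k => coef k n * (delta n * j%:R) ^+ k)).
rewrite big_ltn // /coef eqxx mul0r add0r.
rewrite (eq_big_nat _ _ (F2 := fun k => g k n * j%:R ^+ k + - (k == 2%N)%:R * (delta n * j%:R) ^+ k)); last first.
  move=> k /andP[k0 _]; rewrite gtn_eqF // mulrDl exprMn; congr (_ + _).
  by field; rewrite expf_neq0 // gt_eqF.
rewrite big_split /= addrC; congr (_ + _).
rewrite (bigD1_seq 2%N) ?mem_index_iota ?iota_uniq //= big1 ?addr0.
  by rewrite mulN1r exprMn mulNr.
by move=> k /negbTE ->; rewrite oppr0 mul0r.
Unshelve. all: by end_near. Qed.

Lemma logr_cvg j : (j <= m.+1)%N -> (fun n => (logr j n - expr j n) / delta n ^+ m.+1) @ \oo --> 0.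
Proof.
move=> jm; case: (posnP j) => [->|j0].
  apply: cvg_seq_near (@cvg_seq_cst R (0)); apply: nearW => n.
  rewrite /logr /expr addn0 divff ?gt_eqF // ln1 mulr0 subr0 mulr0 horner_coef0 coef_poly /= /coef eqxx.
  by rewrite subrr mul0r.
have h := log_expansion (introT andP (conj j0 jm)).
apply: cvg_seq_near h; near=> n; congr (_ / _); rewrite (near (exprE j) n) // /logr; ring.
Unshelve. all: by end_near. Qed.

Lemma expr_div_cvg j : (fun n => expr j n / delta n) @ \oo --> 0.
Proof.
have h : (fun n => \sum_(k < m) coef k.+1 n * delta n ^+ k * j%:R ^+ k.+1) @ \oo --> \sum_(k < m) (0 : R).
  apply: cvg_seq_sum => k.
  have ec : coef_cvg _ _ := expo_cvg; have c := ec k.+1; rewrite coefN coefXn in c.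
  have c' : (fun n => coef k.+1 n) @ \oo --> (- (k.+1 == 2%N)%:R : R).
    by apply: cvg_seq_near c; apply: nearW => n; rewrite coef_poly ltnS ltn_ord.
  have := cvg_seqM (cvg_seqM c' (cvg_seqX k delta_cvg)) (@cvg_seq_cst R (j%:R ^+ k.+1)).
  rewrite expr0n; case: (k : nat) => [|k']; first by rewrite oppr0 !mul0r.
  by rewrite mulr0 mul0r.
rewrite big1 // in h; apply: cvg_seq_near h; near=> n.
have d0 : 0 < delta n by near: n.
have c0 : coef 0 n = 0 by [].
rewrite /expr horner_poly big_ord_recl c0 mul0r add0r mulr_suml.
apply: eq_bigr => k _; rewrite lift0 exprMn [delta n ^+ k.+1]exprS.
by field; rewrite gt_eqF.
Unshelve. all: by end_near. Qed.

Lemma delta_pow_cvg k : (0 < k)%N -> (fun n => delta n ^+ k) @ \oo --> 0.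
Proof. by move=> k0; have := cvg_seqX k delta_cvg; rewrite expr0n gtn_eqF. Qed.

Lemma logr_div_cvg j : (j <= m.+1)%N -> (fun n => logr j n / delta n) @ \oo --> 0.
Proof.
move=> jm; have h := cvg_seqD (cvg_seqM (logr_cvg jm) (delta_pow_cvg (ltnW m_ge2))) (expr_div_cvg j).
rewrite mul0r add0r in h; apply: cvg_seq_near h; near=> n.
have d0 : 0 < delta n by near: n.
have dn : delta n != 0 by rewrite gt_eqF.
have dm : delta n ^+ m != 0 by rewrite expf_neq0.
by rewrite exprS; field; rewrite dn.
Unshelve. all: by end_near. Qed.

Lemma cvg0_mul_delta (u : nat -> R) : (fun n => u n / delta n) @ \oo --> 0 -> u @ \oo --> 0.
Proof.
move=> h; have := cvg_seqM h delta_cvg; rewrite mul0r; apply: cvg_seq_near.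
near=> n; have d0 : 0 < delta n by near: n.
by rewrite divfK // gt_eqF.
Unshelve. all: by end_near. Qed.

Lemma rescaled_expr j n : rescaled alpha A n j = expR (logr j n).
Proof.
rewrite /rescaled /logr expRD lnK ?posrE ?divr_gt0 //; congr (_ * _).
by rewrite expRN mulrC expRM_natl.
Qed.

(** [logr] is [o(delta)], so the Taylor remainder of order [m.+1] is [o(delta^(m+1))]. *)
Lemma exp_remainder j : (j <= m.+1)%N ->
  (fun n => (expR (logr j n) - \sum_(q < m.+1) logr j n ^+ q / q`!%:R) / delta n ^+ m.+1) @ \oo --> 0.
Proof.
move=> jm; have hd := logr_div_cvg jm; have h0 := cvg0_mul_delta hd.
have hn : \forall n \near \oo, `|logr j n| <= 1.
  by apply: (@cvgr_norm_le _ _ _ \oo _ _ _ h0); rewrite normr0.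
apply: (@cvg_seq_squeeze0 _ _ (fun n => expR 1 * `|logr j n / delta n| ^+ m.+1)); last first.
  have n0 : (fun n => `|logr j n / delta n|) @ \oo --> 0.
    by rewrite -(normr0 R); apply: cvg_norm.
  by have := cvg_seqZ (expR 1) (cvg_seqX m.+1 n0); rewrite expr0n /= mulr0.
near=> n; have d0 : 0 < delta n by near: n.
have l1 : `|logr j n| <= 1 by near: n; exact: hn.
rewrite !normrM normfV [`|delta n ^+ _|]gtr0_norm ?exprn_gt0 // [`|_^-1|]gtr0_norm ?invr_gt0 //.
rewrite exprMn exprVn mulrA ler_pM2r ?invr_gt0 ?exprn_gt0 //; exact: exp_taylor.
Unshelve. all: by end_near. Qed.

Lemma pow_remainder j q : (j <= m.+1)%N ->
  (fun n => (logr j n ^+ q - expr j n ^+ q) / delta n ^+ m.+1) @ \oo --> 0.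
Proof.
move=> jm; have hl := cvg0_mul_delta (logr_div_cvg jm); have he := cvg0_mul_delta (expr_div_cvg j).
have hs : (fun n => \sum_(i < q) logr j n ^+ (q.-1 - i) * expr j n ^+ i) @ \oo --> \sum_(i < q) (0 : R) ^+ (q.-1 - i) * 0 ^+ i.
  by apply: cvg_seq_sum => i; apply: cvg_seqM; apply: cvg_seqX.
have := cvg_seqM (logr_cvg jm) hs; rewrite mul0r; apply: cvg_seq_near.
by apply: nearW => n; rewrite subrXX mulrAC.
Qed.

Lemma rescaled_remainder j : (j <= m.+1)%N ->
  (fun n => (rescaled alpha A n j - (exp_poly m (expo n)).[delta n * j%:R]) / delta n ^+ m.+1) @ \oo --> 0.
Proof.
move=> jm.
have hs : (fun n => \sum_(q < m.+1) (q`!%:R)^-1 * ((logr j n ^+ q - expr j n ^+ q) / delta n ^+ m.+1)) @ \oo -->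
   \sum_(q < m.+1) (q`!%:R)^-1 * (0 : R).
  by apply: cvg_seq_sum => q; apply: cvg_seqZ; exact: pow_remainder.
rewrite big1 in hs; last by move=> q _; rewrite mulr0.
have := cvg_seqD (exp_remainder jm) hs; rewrite addr0; apply: cvg_seq_near.
apply: nearW => n; rewrite rescaled_expr horner_exp_poly.
rewrite [X in _ + X](_ : _ = (\sum_(q < m.+1) logr j n ^+ q / q`!%:R - \sum_(q < m.+1) expr j n ^+ q / q`!%:R) / delta n ^+ m.+1).
  by rewrite -mulrDl; congr (_ / _); rewrite addrA subrK.
rewrite -sumrB mulr_suml; apply: eq_bigr => q _; ring.
Qed.

(** The error [o(delta^(m+1))] survives division by [delta^r] because [r <= m.+1]; in the polynomial
    part, degrees above [r] keep a positive power of [delta]. *)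
Lemma fdiff_rescaled_cvg r i : (i + r <= m.+1)%N ->
  (fun n => fdiff r (rescaled alpha A n) i / delta n ^+ r) @ \oo --> r`!%:R * (exp_poly m (- 'X^2))`_r.
Proof.
move=> irm; pose rem j n := (rescaled alpha A n j - (exp_poly m (expo n)).[delta n * j%:R]) / delta n ^+ m.+1.
have hrem : (fun n => fdiff r (fun j => rem j n) i) @ \oo --> fdiff r (fun=> (0 : R)) i.
  by apply: cvg_seq_fdiff => j hj; apply: rescaled_remainder; exact: leq_trans irm.
have z : fdiff r (fun=> (0 : R)) i = 0.
  by rewrite -(@eq_fdiff _ (fun=> 0 * 0)) ?fdiffZ ?mul0r // => j; rewrite mul0r.
rewrite z in hrem.
(* Exceeds both the degree of the truncated exponential, at most [m^2], and every [r <= m.+1]. *)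
pose s := (m * m).+2.
have rs : (r < s)%N.
  apply: leq_ltn_trans (leq_trans (leq_addl _ _) irm) _; rewrite /s; clear - m_ge2; nia.
have hec : coef_cvg (fun n => exp_poly m (expo n)) (exp_poly m (- 'X^2)) by apply: coef_cvg_exp; exact: expo_cvg.
have hmain : (fun n => \sum_(k < s) (exp_poly m (expo n))`_k * (delta n ^+ k / delta n ^+ r * fdiff r (fun j => j%:R ^+ k) i)) @ \oo -->
    \sum_(k < s) (exp_poly m (- 'X^2))`_k * (if k == r :> nat then r`!%:R else 0).
  apply: cvg_seq_sum => k; apply: cvg_seqM; first exact: hec.
  case: (ltngtP k r) => kr.
  - apply: cvg_seq_near (@cvg_seq_cst R (0)); apply: nearW => n.
    by rewrite fdiff_pow ?(ltnW kr) // (ltn_eqF kr) mulr0.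
  - have := cvg_seqM (delta_pow_cvg (_ : 0 < k - r)%N) (@cvg_seq_cst R (fdiff r (fun j => j%:R ^+ k) i)).
    rewrite subn_gt0 mul0r => /(_ kr); apply: cvg_seq_near; near=> n.
    have d0 : 0 < delta n by near: n.
    by rewrite -[X in delta n ^+ X / _](subnK (ltnW kr)) exprD mulfK // expf_neq0 // gt_eqF.
  - apply: cvg_seq_near (@cvg_seq_cst R (r`!%:R)); near=> n.
    have d0 : 0 < delta n by near: n.
    by rewrite -kr fdiff_pow // eqxx divff ?mul1r // expf_neq0 // gt_eqF.
rewrite (bigD1 (Ordinal rs)) //= eqxx big1 ?addr0 in hmain; last first.
  by move=> k kr; rewrite (_ : (k == r :> nat) = false) ?mulr0 //; exact/negbTE.
rewrite mulrC.
have hp := cvg_seqX (m.+1 - r) delta_cvg.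
have := cvg_seqD (cvg_seqM hrem hp) hmain; rewrite mul0r add0r; apply: cvg_seq_near; near=> n.
have d0 : 0 < delta n by near: n.
have dr k : delta n ^+ k != 0 by rewrite expf_neq0 // gt_eqF.
have rm : (r <= m.+1)%N by apply: leq_trans irm; exact: leq_addl.
have e j : rescaled alpha A n j = delta n ^+ m.+1 * rem j n +
    \sum_(k < s) ((exp_poly m (expo n))`_k * delta n ^+ k) * j%:R ^+ k.
  rewrite /rem mulrC divfK // -{1}[LHS](subrK (exp_poly m (expo n)).[delta n * j%:R]); congr (_ + _).
  rewrite (@horner_coef_wide _ s); last by rewrite /s ltnW // ltnS size_exp_poly // size_expo.
  by apply: eq_bigr => k _; rewrite exprMn mulrA.
rewrite (eq_fdiff r i e) fdiffD fdiffZ (@fdiff_sum _ s (fun k j => ((exp_poly m (expo n))`_k * delta n ^+ k) * j%:R ^+ k)).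
rewrite mulrDl mulr_suml; congr (_ + _).
  by rewrite -{2}(subnKC rm) exprD; field.
by apply: eq_bigr => k _; rewrite fdiffZ; field.
Unshelve. all: by end_near. Qed.

End HermiteJensen.

(** * Hermite coefficients and the passage to the limit *)

Section Hermite.
Variable R : realType.

Lemma coef_hermite_half d i : (hermite_half R d)`_i =
  if (i <= d)%N && ~~ odd (d - i) then
    'C(d, i)%:R * ((d - i)`!%:R * ((-1) ^+ (d - i)./2 / ((d - i)./2)`!%:R)) else 0.
Proof.
rewrite /hermite_half /hermite raddf_sum /= coef_sum.
have h (k : 'I_d./2.+1) : true ->
   (((-1) ^+ k * (d`!%:R / (k`! * (d - 2 * k)`!)%:R)) *: (2 *: 'X) ^+ (d - 2 * k) \Po (2^-1 *: 'X) : {poly R})`_i =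
   (-1) ^+ k * (d`!%:R / (k`! * (d - 2 * k)`!)%:R) * (i == d - 2 * k)%N%:R.
  move=> _; rewrite comp_polyZ coefZ rmorphXn /= comp_polyZ comp_polyX scalerA divff ?pnatr_eq0 // scale1r.
  by rewrite coefXn.
rewrite (eq_bigr _ h); case: ifP => [/andP[id hd]|hn]; last first.
  rewrite big1 // => k _; rewrite (_ : (i == d - 2 * k)%N = false) ?mulr0 //.
  apply/negP => /eqP e; move/negP: hn; apply; rewrite e leq_subr subKn ?mul2n ?odd_double //.
  by rewrite -geq_half_double -ltnS.
have dE : (d - i = 2 * (d - i)./2)%N by rewrite mul2n -[LHS]odd_double_half (negbTE hd).
have kd : ((d - i)./2 < d./2.+1)%N by rewrite ltnS half_leq // leq_subr.
rewrite (bigD1 (Ordinal kd)) //= -dE subKn // eqxx mulr1 big1 ?addr0.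
  rewrite -(bin_fact id) !natrM; field.
  by rewrite !pnatr_eq0 -!lt0n !fact_gt0.
move=> k kn; rewrite (_ : (i == d - 2 * k)%N = false) ?mulr0 //; apply/negP => /eqP e; move/eqP: kn; apply.
apply/val_inj => /=; rewrite e subKn ?mul2n ?doubleK //.
by rewrite -geq_half_double -ltnS.
Qed.

(** The differences of order [d - i], based at [i] or at 0, involve only [j <= d], and the expansion
    is available for [j <= m.+1]. *)
Lemma hermite_jensen_of_log_expansion (alpha A delta : nat -> R) (g : nat -> nat -> R) m d :
  (forall n, 0 < alpha n) -> (\forall n \near \oo, 0 < delta n) -> delta @ \oo --> 0 ->
  (2 <= m)%N -> (1 <= d <= m.+1)%N ->
  (forall k, (1 <= k <= m)%N -> (fun n => g k n / delta n ^+ k) @ \oo --> 0) ->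
  (forall j, (1 <= j <= m.+1)%N ->
    (fun n => (ln (alpha (n + j)%N / alpha n) - (A n * j%:R - delta n ^+ 2 * j%:R ^+ 2
      + \sum_(1 <= k < m.+1) g k n * j%:R ^+ k)) / delta n ^+ m.+1) @ \oo --> 0) ->
  hermite_jensen d alpha A (-1) delta.
Proof.
move=> a0 d0 dc m2 /andP[d1 dm] hg hL; split=> //; split; first by right.
split=> //; rewrite eqxx => H i; rewrite /H {H}.
have lim r j : (j + r <= m.+1)%N -> (fun n => fdiff r (rescaled alpha A n) j / delta n ^+ r) @ \oo -->
    (if odd r then 0 else r`!%:R * ((-1) ^+ r./2 / (r./2)`!%:R) : R).
  move=> jr; have := fdiff_rescaled_cvg a0 d0 dc m2 hg hL jr.
  rewrite coef_exp_poly_sqr; [|exact: leq_trans (leq_addl _ _) jr|exact: ltnW].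
  by case: ifP; rewrite ?mulr0.
rewrite coef_hermite_half; case: (leqP i d) => id /=; last first.
  split; apply: cvg_seq_near (@cvg_seq_cst R 0); near=> n.
    have dn : delta n != 0 by rewrite gt_eqF //; near: n.
    by rewrite coef_jensenJ // leqNgt id.
  have dn : delta n != 0 by rewrite gt_eqF //; near: n.
  by rewrite coef_jensenK // leqNgt id.
have -> : (if ~~ odd (d - i) then 'C(d, i)%:R * ((d - i)`!%:R * ((-1) ^+ (d - i)./2 / ((d - i)./2)`!%:R)) else 0) =
   'C(d, i)%:R * (if odd (d - i) then 0 else (d - i)`!%:R * ((-1) ^+ (d - i)./2 / ((d - i)./2)`!%:R)) :> R.
  by case: (odd _); rewrite ?mulr0.
split.
- have := cvg_seqZ ('C(d, i)%:R * (-1) ^+ (d - i)) (lim (d - i)%N i (leq_trans _ dm)).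
  rewrite subnKC // => /(_ (leqnn _)).
  (* The limit vanishes for odd [d - i], so the sign carried by the [J] coefficients disappears. *)
  have -> : 'C(d, i)%:R * (-1) ^+ (d - i) * (if odd (d - i) then 0 else (d - i)`!%:R * ((-1) ^+ (d - i)./2 / ((d - i)./2)`!%:R)) =
     'C(d, i)%:R * (if odd (d - i) then 0 else (d - i)`!%:R * ((-1) ^+ (d - i)./2 / ((d - i)./2)`!%:R)) :> R.
    by rewrite -signr_odd; case: (odd _); rewrite ?mulr0 // expr0 mulr1.
  apply: cvg_seq_near; near=> n.
  have dn : delta n != 0 by rewrite gt_eqF //; near: n.
  by rewrite coef_jensenJ // id.
- have := cvg_seqZ 'C(d, i)%:R (lim (d - i)%N 0%N (leq_trans _ dm)).
  rewrite add0n leq_subr => /(_ isT); apply: cvg_seq_near; near=> n.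
  have dn : delta n != 0 by rewrite gt_eqF //; near: n.
  by rewrite coef_jensenK // id.
Unshelve. all: by end_near. Qed.

End Hermite.

(** * Taylor expansion of the logarithm of the model *)

Section LogModel.
Variable R : realType.
Implicit Types (x t : R) (n m k : nat).
Local Notation theta := (theta R).
Local Notation model := (model R).
Local Notation rt := (rt R).

Definition inv_sqrt x : R := (Num.sqrt x)^-1.
Definition inv_gap x : R := (pi - inv_sqrt x)^-1.
Definition log_model x : R := pi * Num.sqrt x - ln x + ln (pi - inv_sqrt x).

(* A triple [(c, a, b)] stands for the function [c y^a w^b] of [x], with
   [y = 1 / sqrt x] and [w = 1 / (pi - y)]; then [y' = - y^3 / 2] and
   [w' = - y^3 w^2 / 2]. *)
Definition mono_eval x (u : R * nat * nat) : R := u.1.1 * inv_sqrt x ^+ u.1.2 * inv_gap x ^+ u.2.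
Definition mono_sum (s : seq (R * nat * nat)) x : R := \sum_(u <- s) mono_eval x u.
Definition mono_deriv (u : R * nat * nat) : seq (R * nat * nat) :=
  [:: (- (u.1.1 * u.1.2%:R / 2), u.1.2.+2, u.2); (- (u.1.1 * u.2%:R / 2), u.1.2.+3, u.2.+1)].
Definition seq_deriv (s : seq (R * nat * nat)) := flatten (map mono_deriv s).
(** [A] in terms of [y] and [w]: the direct derivative [pi y / 2 - y^2 + y^3 w / 2] takes this form
    through [pi w = 1 + y w]. *)
Definition log_model_deriv1 : seq (R * nat * nat) := [:: (pi ^+ 2 / 2, 1, 1); (- (3 / 2), 2, 0)]%N.
Definition log_model_deriv i x : R :=
  if i is i'.+1 then mono_sum (iter i' seq_deriv log_model_deriv1) x else log_model x.

Lemma inv_sqrt_bounds x : 1 <= x -> 0 < inv_sqrt x <= 1.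
Proof.
move=> x1; have s1 : 1 <= Num.sqrt x by rewrite -[X in X <= _]sqrtr1 ler_sqrt; lra.
by rewrite /inv_sqrt invr_gt0 invf_le1 ?s1 ?andbT; lra.
Qed.

Lemma gap_ge1 x : 1 <= x -> 1 <= pi - inv_sqrt x.
Proof. by move=> /inv_sqrt_bounds /andP[_ h]; have := pi_ge2 R; lra. Qed.

Lemma inv_gap_bounds x : 1 <= x -> 0 < inv_gap x <= 1.
Proof.
move=> x1; have h := gap_ge1 x1.
by rewrite /inv_gap invr_gt0 invf_le1 ?h ?andbT; lra.
Qed.

Lemma is_derive_inv_sqrt x : 1 <= x -> is_derive x 1 inv_sqrt (- (inv_sqrt x ^+ 3 / 2)).
Proof.
move=> x1; have x0 : 0 < x by lra.
have s0 : 0 < Num.sqrt x by rewrite sqrtr_gt0.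
have d2 := @is_deriveV R Num.sqrt x _ 1 (lt0r_neq0 s0) (is_derive1_sqrt x0).
apply: (@is_derive_eq _ _ _ inv_sqrt x 1 _ _ d2).
rewrite /inv_sqrt /GRing.scale /=; field; exact: lt0r_neq0.
Qed.

Lemma is_derive_gap x : 1 <= x -> is_derive x 1 (fun z => pi - inv_sqrt z) (inv_sqrt x ^+ 3 / 2).
Proof.
move=> x1; have d := is_derive_inv_sqrt x1.
have d2 := @is_derive1_comp R (fun y => pi + (-1) * y) inv_sqrt x _ _ (is_derive_affine _ _ _) d.
rewrite (_ : (fun z => pi - inv_sqrt z) = (fun y => pi + (-1) * y) \o inv_sqrt).
  by apply: (is_derive_eq d2); rewrite mulN1r opprK.
by apply/funext => z; rewrite /= mulN1r.
Qed.

Lemma is_derive_inv_gap x : 1 <= x ->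
  is_derive x 1 inv_gap (- (inv_sqrt x ^+ 3 * inv_gap x ^+ 2 / 2)).
Proof.
move=> x1; have g1 := gap_ge1 x1; have g0 : pi - inv_sqrt x != 0 by rewrite gt_eqF //; lra.
have d2 := @is_deriveV R (fun z => pi - inv_sqrt z) x _ 1 g0 (is_derive_gap x1).
apply: (@is_derive_eq _ _ _ inv_gap x 1 _ _ d2).
rewrite /inv_gap /GRing.scale /=; move: (inv_sqrt x) g0 => y g0.
by move: (pi - y) g0 => z z0; field.
Qed.

Lemma is_derive_pow (f : R -> R) x (df : R) k : is_derive x 1 f df ->
  is_derive x 1 (fun z => f z ^+ k) (k%:R * f x ^+ k.-1 * df).
Proof.
move=> h; have d := @is_deriveX R R f k x 1 df h.
rewrite (_ : (fun z => f z ^+ k) = f ^+ k) //.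
by apply/funext => z; elim: k {d} => [|k IH]; rewrite ?expr0 // !exprS IH.
Qed.

Lemma is_derive_mul (f g : R -> R) x (df dg : R) : is_derive x 1 f df -> is_derive x 1 g dg ->
  is_derive x 1 (fun z => f z * g z) (f x * dg + g x * df).
Proof. by move=> hf hg; exact: (@is_deriveM R R f g x 1 df dg hf hg). Qed.

Lemma is_derive_mono u x : 1 <= x -> is_derive x 1 (fun z => mono_eval z u) (mono_sum (mono_deriv u) x).
Proof.
move=> x1; case: u => [[c a] b]; rewrite /mono_eval /mono_sum /mono_deriv /= !big_cons big_nil /=.
have d1 := is_derive_pow a (is_derive_inv_sqrt x1).
have d2 := is_derive_pow b (is_derive_inv_gap x1).
have d3 := is_derive_mul (is_derive_mul (is_derive_cst c x 1) d1) d2.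
apply: (@is_derive_eq _ _ _ _ x 1 _ _ d3); rewrite /mono_eval /= addr0.
move: (inv_sqrt x) (inv_gap x) => y w.
have hp (z : R) k : k%:R * z ^+ k.-1 * z = k%:R * z ^+ k.
  by case: k => [|k]; rewrite ?mul0r // -mulrA -exprSr.
have ha : a%:R * y ^+ a.-1 * - (y ^+ 3 / 2) = - (a%:R * y ^+ a * y ^+ 2 / 2).
  by rewrite -hp; ring.
have hb : b%:R * w ^+ b.-1 * - (y ^+ 3 * w ^+ 2 / 2) = - (b%:R * w ^+ b * w * y ^+ 3 / 2).
  by rewrite -hp; ring.
rewrite ha hb !exprS; ring.
Qed.

Lemma is_derive_add (f g : R -> R) x (df dg : R) : is_derive x 1 f df -> is_derive x 1 g dg ->
  is_derive x 1 (fun z => f z + g z) (df + dg).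
Proof. by move=> hf hg; exact: (@is_deriveD R R R f g x 1 df dg hf hg). Qed.

Lemma mono_sum_cat s1 s2 x : mono_sum (s1 ++ s2) x = mono_sum s1 x + mono_sum s2 x.
Proof. by rewrite /mono_sum big_cat. Qed.

Lemma is_derive_mono_sum s x : 1 <= x -> is_derive x 1 (mono_sum s) (mono_sum (seq_deriv s) x).
Proof.
move=> x1; elim: s => [|u s IH].
  rewrite (_ : mono_sum [::] = cst 0); last by apply/funext => z; rewrite /mono_sum big_nil.
  exact: is_derive_cst.
rewrite (_ : seq_deriv (u :: s) = mono_deriv u ++ seq_deriv s) // mono_sum_cat.
rewrite (_ : mono_sum (u :: s) = fun z => mono_eval z u + mono_sum s z); last by apply/funext => z; rewrite /mono_sum big_cons.
by apply: is_derive_add => //; exact: is_derive_mono.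
Qed.

Lemma is_derive_log_model x : 1 <= x -> is_derive x 1 log_model (mono_sum log_model_deriv1 x).
Proof.
move=> x1; have x0 : 0 < x by lra.
have g1 := gap_ge1 x1; have g0 : 0 < pi - inv_sqrt x by lra.
have s0 : 0 < Num.sqrt x by rewrite sqrtr_gt0.
have d1 := is_derive_mul (is_derive_cst (pi : R) x 1) (is_derive1_sqrt x0).
have d2 := is_derive_mul (is_derive_cst (-1 : R) x 1) (is_derive1_ln x0).
have d3 := @is_derive1_comp R (@ln R) (fun z => pi - inv_sqrt z) x _ _ (is_derive1_ln g0) (is_derive_gap x1).
have d := is_derive_add (is_derive_add d1 d2) d3.
rewrite (_ : log_model = fun z => cst (pi : R) z * Num.sqrt z + cst (-1 : R) z * ln z + (@ln R \o (fun z => pi - inv_sqrt z)) z); last first.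
  by apply/funext => z; rewrite /= mulN1r.
apply: (@is_derive_eq _ _ _ _ x 1 _ _ d).
rewrite /mono_sum /log_model_deriv1 !big_cons big_nil /mono_eval /= /inv_gap.
have -> : x^-1 = inv_sqrt x ^+ 2 by rewrite /inv_sqrt exprVn sqr_sqrtr // ltW.
have -> : (2 * Num.sqrt x)^-1 = inv_sqrt x / 2 by rewrite invfM mulrC.
move: (inv_sqrt x) g0 => y g0; move: (pi : R) g0 => p g0.
by field; rewrite gt_eqF.
Qed.

Lemma is_derive_log_model_deriv i x : 1 <= x ->
  is_derive x 1 (log_model_deriv i) (log_model_deriv i.+1 x).
Proof.
case: i => [|i] x1 /=; first exact: is_derive_log_model.
exact: is_derive_mono_sum.
Qed.

Lemma mono_sum_bound s a x : 1 <= x -> (forall u, u \in s -> (a <= u.1.2)%N) ->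
  `|mono_sum s x| <= (\sum_(u <- s) `|u.1.1|) * inv_sqrt x ^+ a.
Proof.
move=> x1; have /andP[y0 y1] := inv_sqrt_bounds x1; have /andP[w0 w1] := inv_gap_bounds x1.
elim: s => [|u s IH] hs; first by rewrite /mono_sum !big_nil normr0 mul0r.
rewrite /mono_sum !big_cons mulrDl; apply: le_trans (ler_normD _ _) _; apply: lerD; last first.
  by apply: IH => v hv; apply: hs; rewrite in_cons hv orbT.
have au : (a <= u.1.2)%N by apply: hs; rewrite in_cons eqxx.
rewrite /mono_eval !normrM -mulrA ler_wpM2l // !ger0_norm ?exprn_ge0 ?(ltW y0) ?(ltW w0) //.
rewrite -(subnK au) exprD -[X in _ <= X]mulr1 -mulrA mulrCA ler_wpM2l ?exprn_ge0 ?(ltW y0) //.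
by rewrite -[X in _ <= X]mulr1; apply: ler_pM; rewrite ?exprn_ge0 ?exprn_ile1 // ltW.
Qed.

(** Each derivative raises the exponent of [y] by at least 2, so the derivative of order [i + 1] is
    [O(x^-(i + 1/2))]. *)
Lemma deriv_exponents i : forall u, u \in iter i seq_deriv log_model_deriv1 -> (2 * i + 1 <= u.1.2)%N.
Proof.
elim: i => [|i IH] u /=; first by rewrite !inE => /orP[] /eqP ->.
move=> /flattenP [s /mapP[v hv ->]]; have := IH v hv; rewrite !inE => h /orP[] /eqP -> /=; move: (v.1.2) h => a h; clear - h; lia.
Qed.

Lemma log_model_deriv_bound i : exists2 C, 0 <= C & forall x, 1 <= x ->
  `|log_model_deriv i.+1 x| <= C * inv_sqrt x ^+ (2 * i + 1).
Proof.
exists (\sum_(u <- iter i seq_deriv log_model_deriv1) `|u.1.1|); first by rewrite sumr_ge0.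
by move=> x x1; apply: mono_sum_bound => //; exact: deriv_exponents.
Qed.

Lemma inv_sqrt_nat n : inv_sqrt n%:R = theta n ^+ 2.
Proof. by rewrite theta_sqr. Qed.

Lemma ln_model n : (0 < n)%N -> ln (model n) = log_model n%:R.
Proof.
move=> n0; have n0R : 0 < (n%:R : R) by rewrite ltr0n.
have n1 : 1 <= (n%:R : R) by rewrite ler1n.
have g1 := gap_ge1 n1; have g0 : 0 < pi - inv_sqrt n%:R by lra.
have -> : model n = growth R n * n%:R^-1 * (pi - inv_sqrt n%:R).
  apply: (mulfI (lt0r_neq0 n0R)); rewrite mul_model // inv_sqrt_nat; field; exact: lt0r_neq0.
rewrite lnM ?posrE ?mulr_gt0 ?invr_gt0 ?growth_gt0 // lnM ?posrE ?invr_gt0 ?growth_gt0 //.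
by rewrite lnV ?posrE // /growth expRK.
Qed.

Lemma log_model_taylor m : exists2 C, 0 <= C & forall n j, (0 < n)%N -> (j <= m.+1)%N ->
  `|log_model (n + j)%:R - \sum_(i < m.+1) log_model_deriv i n%:R / i`!%:R * j%:R ^+ i|
    <= C * theta n ^+ (4 * m + 2).
Proof.
have [C C0 hC] := log_model_deriv_bound m.
exists (C * m.+1%:R ^+ m.+1); first by rewrite mulr_ge0 // exprn_ge0.
move=> n j n0 jm; have n1 : 1 <= (n%:R : R) by rewrite ler1n.
have t0 := theta_gt0 R n0.
have hx (z : R) : 0 <= z <= j%:R -> 1 <= n%:R + z by move=> /andP[z0 _]; lra.
have := @taylor_bound_right R m.+1 (fun i z => log_model_deriv i (n%:R + z)) j%:R (C * theta n ^+ (4 * m + 2)) (ler0n _ _).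
rewrite -natrD addr0 => h; apply: le_trans (h _ _) _.
- move=> i z _ hz; have d := is_derive_log_model_deriv i (hx z hz).
  have da := is_derive_affine (n%:R : R) 1 z.
  have e : (fun z => log_model_deriv i (n%:R + z)) = log_model_deriv i \o (fun z => n%:R + 1 * z).
    by apply/funext => t; rewrite /= mul1r.
  rewrite e -{1}[z]mul1r in d *.
  have dc := @is_derive1_comp R (log_model_deriv i) (fun y => n%:R + 1 * y) z _ _ d da.
  by apply: (is_derive_eq dc); rewrite mulr1.
- move=> z hz; apply: le_trans (hC _ (hx z hz)) _; rewrite ler_wpM2l //.
  have -> : theta n ^+ (4 * m + 2) = inv_sqrt n%:R ^+ (2 * m + 1).
    by rewrite inv_sqrt_nat -exprM; congr (_ ^+ _); lia.
  have /andP[y0 _] := inv_sqrt_bounds (hx z hz); have /andP[y0' _] := inv_sqrt_bounds n1.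
  apply: lerXn2r; rewrite ?nnegrE ?(ltW y0) ?(ltW y0') //.
  move: y0 y0'; rewrite /inv_sqrt !invr_gt0 => y0 y0'.
  by rewrite lef_pV2 ?posrE // ler_wsqrtr // lerDl; move: hz => /andP[].
rewrite ler_pdivrMr ?ltr0n ?fact_gt0 //.
have T0 : 0 <= C * theta n ^+ (4 * m + 2) by rewrite mulr_ge0 // exprn_ge0 // ltW.
apply: le_trans (_ : C * theta n ^+ (4 * m + 2) * m.+1%:R ^+ m.+1 <= _).
  by apply: ler_wpM2l => //; apply: lerXn2r; rewrite ?nnegrE // ler_nat.
rewrite [X in _ <= X * _]mulrAC ler_peMr ?ler1n ?fact_gt0 //.
by rewrite mulr_ge0 // exprn_ge0.
Qed.

End LogModel.

(** * Logarithmic expansion of overpartition ratios *)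

Section PbarExpansion.
Variable R : realType.
Implicit Types (n m k j K : nat).
Local Notation theta := (theta R).
Local Notation model := (model R).
Local Notation pbar := (@pbar R).

Lemma pbar_gt0 n : 0 < pbar n.
Proof. by rewrite /Defs.pbar ltr0n overpartition_count_gt0. Qed.

Lemma ln_sub_le (m a b : R) : 0 < m -> m <= a -> m <= b -> `|ln a - ln b| <= `|a - b| / m.
Proof.
move=> m0 ma mb; have a0 : 0 < a by exact: lt_le_trans ma.
have b0 : 0 < b by exact: lt_le_trans mb.
have h (x y : R) : 0 < x -> m <= y -> ln x - ln y <= `|x - y| / m.
  move=> x0 my; have y0 : 0 < y by exact: lt_le_trans my.
  rewrite -ln_div ?posrE // (_ : x / y = 1 + (x - y) / y); last by field; rewrite gt_eqF.
  apply: le_trans (le_ln1Dx _) _; first by rewrite -subr_gt0 opprK addrC mulrBl divff ?gt_eqF // addrC subrK divr_gt0.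
  apply: le_trans (_ : `|x - y| / y <= _); first by rewrite ler_pM2r ?invr_gt0 // ler_norm.
  by rewrite ler_wpM2l // lef_pV2 ?posrE.
by rewrite ler_norml h // andbT lerNl opprB distrC h.
Qed.

(** [ln p = ln (p / F) + ln F], and [ln] is Lipschitz on the range of [p / F], which is bounded away
    from 0. The order [2 K] reflects [kappa ^+ 2 = theta]. *)
Lemma ln_pbar_model K : exists2 C, 0 <= C & forall n j, (0 < n)%N ->
  `|ln (pbar (n + j)%N / pbar n) - (log_model (n + j)%:R - log_model n%:R)| <= C * theta n ^+ K.
Proof.
have [m m0 [M hM]] := model_ratio_bounds R; have [B B0 hB] := @model_ratio_cauchy R (2 * K).
exists (B / m); first by rewrite divr_ge0 // ltW.
move=> n j n0; have nj : (0 < n + j)%N by rewrite addn_gt0 n0.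
have e k : (0 < k)%N -> ln (pbar k) = ln (model_ratio R k) + log_model k%:R.
  move=> k0; rewrite -ln_model // -lnM ?posrE ?model_ratio_gt0 ?model_gt0 //.
  by rewrite /model_ratio divfK // gt_eqF ?model_gt0.
rewrite ln_div ?posrE ?pbar_gt0 // !e //.
rewrite (_ : _ - _ = ln (model_ratio R (n + j)) - ln (model_ratio R n)); last by ring.
have lo k : m <= model_ratio R k by have /andP[] := hM k.
apply: le_trans (ln_sub_le m0 (lo _) (lo _)) _.
rewrite mulrAC ler_pM2r ?invr_gt0 // -kappa_sqr -exprM.
have h1 := hB n (n + j)%N n n0 (leq_addr _ _) (leqnn _).
have h2 := hB n n (n + j)%N n0 (leqnn _) (leq_addr _ _).
by rewrite ler_norml h1 andbT lerNl opprB.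
Qed.

Definition log_coef k n : R := log_model_deriv k n%:R / k`!%:R.

Lemma log_coef_bound k : exists2 C, 0 <= C & forall n, (0 < n)%N ->
  `|log_coef k.+1 n| <= C * theta n ^+ (4 * k + 2).
Proof.
have [C C0 hC] := log_model_deriv_bound R k; exists C => // n n0.
have n1 : 1 <= (n%:R : R) by rewrite ler1n.
rewrite /log_coef normrM normfV normr_nat ler_pdivrMr ?ltr0n ?fact_gt0 //.
apply: le_trans (hC _ n1) _; rewrite inv_sqrt_nat -exprM.
rewrite (_ : 2 * (2 * k + 1) = 4 * k + 2)%N; last lia.
by rewrite ler_peMr ?ler1n ?fact_gt0 // mulr_ge0 // exprn_ge0 // ltW // theta_gt0.
Qed.

(** The exponent makes the error [o(delta^(m+1))]; the Taylor error suffices since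
    [4 m + 2 >= 3 (m + 1) + 1] from [m = 2] on. *)
Lemma pbar_log_expansion m : (2 <= m)%N -> exists2 C, 0 <= C & forall n j, (0 < n)%N -> (j <= m.+1)%N ->
  `|ln (pbar (n + j)%N / pbar n) - \sum_(1 <= k < m.+1) log_coef k n * j%:R ^+ k|
     <= C * theta n ^+ (3 * m.+1 + 1).
Proof.
move=> m2; have [C C0 hC] := ln_pbar_model (3 * m.+1 + 1); have [D D0 hD] := log_model_taylor R m.
exists (C + D); first by rewrite addr_ge0.
move=> n j n0 jm; have t0 := theta_gt0 R n0; have t1 := theta_le1 R n0.
have h1 := hC n j n0; have h2 := hD n j n0 jm.
rewrite -(big_mkord xpredT (fun i => log_model_deriv i n%:R / i`!%:R * j%:R ^+ i)) big_ltn // in h2.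
rewrite /= expr0 mulr1 divr1 in h2.
have h3 : D * theta n ^+ (4 * m + 2) <= D * theta n ^+ (3 * m.+1 + 1).
  rewrite ler_wpM2l // ler_wiXn2l ?(ltW t0) //; lia.
rewrite (_ : _ - _ = (ln (pbar (n + j)%N / pbar n) - (log_model (n + j)%:R - log_model n%:R)) +
   (log_model (n + j)%:R - (log_model n%:R + \sum_(1 <= k < m.+1) log_coef k n * j%:R ^+ k))); last by ring.
by rewrite mulrDl; apply: le_trans (ler_normD _ _) (lerD h1 (le_trans h2 h3)).
Qed.

Lemma S_inv n : (0 < n)%N -> S_ n = pi / theta n ^+ 2.
Proof. by move=> n0; rewrite theta_sqr invrK. Qed.

Lemma log_coef1 n : (0 < n)%N -> log_coef 1 n = A_op n.
Proof.
move=> n0; have t0 := theta_gt0 R n0.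
have n1 : 1 <= (n%:R : R) by rewrite ler1n.
have g1 := gap_ge1 n1; have p0 := pi_gt0 R.
rewrite /log_coef /= divr1 /mono_sum /log_model_deriv1 !big_cons big_nil /mono_eval /= /inv_gap /A_op S_inv //.
move: g1; rewrite inv_sqrt_nat; move: (pi : R) p0 => p p0 g1.
field; rewrite !gt_eqF // ?subr_gt0 //; lra.
Qed.

(** Minus half of [(ln F)''] at [n]. *)
Definition delta_sqr n : R :=
  pi ^+ 3 * theta n ^+ 6 * inv_gap (n%:R : R) ^+ 2 / 8 - 3 * theta n ^+ 8 / 4.

Lemma log_coef2 n : (0 < n)%N -> log_coef 2 n = - delta_sqr n.
Proof.
move=> n0; have n1 : 1 <= (n%:R : R) by rewrite ler1n.
have g1 := gap_ge1 n1; have g0 : pi - theta n ^+ 2 != 0 by rewrite -inv_sqrt_nat gt_eqF //; lra.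
rewrite /log_coef /= /mono_sum /seq_deriv /log_model_deriv1 /= !big_cons big_nil /mono_eval /= /inv_gap /delta_sqr.
rewrite inv_sqrt_nat /inv_gap inv_sqrt_nat (_ : 2`!%:R = 2) //.
by move: (pi : R) g0 => p g0; field.
Qed.

(** For [theta <= 1/4] the positive term dominates. The sign matters: [Num.sqrt] is 0 on negative
    numbers, so only then is [delta_op ^+ 2] equal to [delta_sqr]. *)
Lemma delta_sqr_bounds n : (0 < n)%N -> theta n <= 4^-1 ->
  theta n ^+ 6 / 9 <= delta_sqr n <= 8 * theta n ^+ 6.
Proof.
move=> n0 t4; have t0 := theta_gt0 R n0.
have n1 : 1 <= (n%:R : R) by rewrite ler1n.
have /andP[w0 w1] := inv_gap_bounds n1; have p2 := pi_ge2 R; have p4 := @pihalf_lt2 R.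
have pw : 1 <= pi * inv_gap (n%:R : R).
  have := gap_ge1 n1; have /andP[/ltW y0 _] := inv_sqrt_bounds n1 => g1.
  by rewrite /inv_gap ler_pdivlMr ?mul1r; lra.
have t6 : 0 <= theta n ^+ 6 by rewrite exprn_ge0 // ltW.
have t2 : theta n ^+ 2 <= 16^-1.
  have : theta n * theta n <= 4^-1 * 4^-1 by apply: ler_pM => //; exact: ltW.
  rewrite expr2; lra.
have -> : delta_sqr n = theta n ^+ 6 * (pi * (pi * inv_gap (n%:R : R)) ^+ 2 / 8 - 3 * theta n ^+ 2 / 4).
  by rewrite /delta_sqr; move: (pi : R) => p; ring.
rewrite [8 * _]mulrC !ler_wpM2l //.
  have t20 : 0 <= theta n ^+ 2 by rewrite exprn_ge0 // ltW.
  have pw4 : pi * inv_gap (n%:R : R) <= 4 * 1 by apply: ler_pM => //; [lra | exact: ltW | lra].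
  have : (pi * inv_gap (n%:R : R)) ^+ 2 <= 16.
    rewrite (_ : 16 = 4 ^+ 2); last by ring.
    by apply: lerXn2r; rewrite ?nnegrE //; lra.
  move=> h; have : pi * (pi * inv_gap (n%:R : R)) ^+ 2 <= 4 * 16 by apply: ler_pM => //; [lra | exact: exprn_even_ge0 | lra].
  move: (pi * _ ^+ 2) (theta n ^+ 2) t20 => a b; lra.
have h : 1 <= (pi * inv_gap (n%:R : R)) ^+ 2 by exact: exprn_ege1.
have : 2 * 1 <= pi * (pi * inv_gap (n%:R : R)) ^+ 2 by apply: ler_pM.
move: (pi * _ ^+ 2) (theta n ^+ 2) t2 => a b; lra.
Qed.

Lemma delta_op_sqr n : (0 < n)%N -> theta n <= 4^-1 -> delta_op n ^+ 2 = delta_sqr n.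
Proof.
move=> n0 t4; have /andP[d0 _] := delta_sqr_bounds n0 t4.
have t0 := theta_gt0 R n0; have p0 := pi_gt0 R.
have n1 : 1 <= (n%:R : R) by rewrite ler1n.
have g1 := gap_ge1 n1; rewrite inv_sqrt_nat in g1.
have e : (2 * S_ n * (S_ n - 1) ^+ 2)^-1 - 3 / S_ n ^+ 4 = delta_sqr n / (pi ^+ 2 / 2) ^+ 2 :> R.
  rewrite S_inv // /delta_sqr /inv_gap inv_sqrt_nat.
  move: (pi : R) p0 g1 => p p0 g1; field.
  by rewrite !gt_eqF // ?subr_gt0 //; lra.
have q0 : 0 < (pi ^+ 2 / 2 : R) by rewrite divr_gt0 // exprn_gt0.
have D0 : 0 <= delta_sqr n by apply: le_trans d0; rewrite divr_ge0 // exprn_ge0 // ltW.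
rewrite /delta_op e exprMn sqr_sqrtr; last by rewrite divr_ge0 // exprn_ge0 // ltW.
by rewrite mulrC divfK // expf_neq0 // gt_eqF.
Qed.

Lemma root_bounds (d t : R) : 0 <= d -> 0 < t -> t ^+ 6 / 9 <= d ^+ 2 <= 8 * t ^+ 6 ->
  t ^+ 3 / 3 <= d <= 3 * t ^+ 3.
Proof.
move=> d0 t0 /andP[h1 h2]; have t3 : 0 < t ^+ 3 by rewrite exprn_gt0.
have t6 : t ^+ 6 = (t ^+ 3) ^+ 2 by rewrite -exprM.
have a0 : 0 <= t ^+ 3 / 3 by rewrite divr_ge0 // ltW.
have b0 : 0 <= 3 * t ^+ 3 by rewrite pmulr_rge0 // ltW.
have n9 : 3 ^+ 2 = 9 :> R by ring.
apply/andP; split; rewrite -(@ler_pXn2r _ 2) ?nnegrE //.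
  by rewrite expr_div_n -t6 n9.
rewrite exprMn -t6; apply: le_trans h2 _; rewrite ler_wpM2r ?exprn_ge0 ?(ltW t0) //.
by rewrite n9; lra.
Qed.

Lemma delta_op_bounds n : (0 < n)%N -> theta n <= 4^-1 ->
  theta n ^+ 3 / 3 <= delta_op n <= 3 * theta n ^+ 3.
Proof.
move=> n0 t4; apply: root_bounds; rewrite ?theta_gt0 // ?delta_op_sqr ?delta_sqr_bounds //.
by rewrite mulr_ge0 ?sqrtr_ge0 // divr_ge0 // exprn_even_ge0.
Qed.

Lemma deltastar_opE n : (0 < n)%N -> deltastar_op n ^+ 2 = pi / 8 * theta n ^+ 6 /\ 0 <= deltastar_op n :> R.
Proof.
move=> n0; have t0 := theta_gt0 R n0; have p0 := pi_gt0 R.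
have e : (n%:R `^ (3 / 4) : R) = (theta n ^+ 3)^-1.
  have -> : (n%:R : R) = (theta n)^-1 ^+ 4 by rewrite exprVn theta_pow4 invrK.
  rewrite -[X in X `^ _]powR_mulrn ?invr_ge0 ?(ltW t0) // -powRrM.
  rewrite (_ : 4%:R * (3 / 4) = 3%:R); last by field.
  by rewrite powR_mulrn ?invr_ge0 ?(ltW t0) // exprVn.
rewrite /deltastar_op e; split; last first.
  by rewrite divr_ge0 ?mulr_ge0 ?sqrtr_ge0 // invr_ge0 exprn_ge0 // ltW.
rewrite expr_div_n exprMn !sqr_sqrtr ?(ltW p0) //.
move: (pi : R) => p; field; exact: lt0r_neq0.
Qed.

Lemma deltastar_op_bounds n : (0 < n)%N ->
  theta n ^+ 3 / 3 <= deltastar_op n <= 3 * theta n ^+ 3.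
Proof.
move=> n0; have [e d0] := deltastar_opE n0; have t0 := theta_gt0 R n0.
apply: root_bounds => //; rewrite e; have t6 : 0 < theta n ^+ 6 by rewrite exprn_gt0.
have := pi_ge2 R; have := @pihalf_lt2 R => h1 h2.
by rewrite [_ / 9]mulrC !ler_pM2r //; apply/andP; split; lra.
Qed.

(** [O(theta^4) = o(delta)]: the difference is admissible as a correction of degree 1. *)
Lemma A_op_sub n : (0 < n)%N -> `|A_op n - Astar_op n : R| <= 2 * theta n ^+ 4.
Proof.
move=> n0; have t0 := theta_gt0 R n0; have t1 := theta_le1 R n0; have p0 := pi_gt0 R.
have n1 : 1 <= (n%:R : R) by rewrite ler1n.
have g1 := gap_ge1 n1; rewrite inv_sqrt_nat in g1.
have -> : A_op n - Astar_op n = theta n ^+ 4 * (theta n ^+ 2 / (2 * (pi - theta n ^+ 2)) - 1) :> R.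
  rewrite /A_op S_inv // /Astar_op -/(rt R n) (_ : rt R n = (theta n ^+ 2)^-1); last by rewrite theta_sqr invrK.
  move: (pi : R) p0 g1 => p p0 g1; field.
  by rewrite !gt_eqF // ?subr_gt0 //; lra.
rewrite normrM ger0_norm ?exprn_ge0 ?(ltW t0) // mulrC ler_wpM2r ?exprn_ge0 ?(ltW t0) //.
have : 0 <= theta n ^+ 2 <= 1 by rewrite exprn_ge0 ?exprn_ile1 // ltW.
move: (theta n ^+ 2) g1 => a g1 /andP[a0 a1].
have q0 : 0 < 2 * (pi - a) by lra.
have h0 : 0 <= a / (2 * (pi - a)) by rewrite divr_ge0 // ltW.
have h1 : a / (2 * (pi - a)) <= 1 by rewrite ler_pdivrMr //; lra.
by rewrite ler_norml; apply/andP; split; lra.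
Qed.

(** [O(theta^8)] against [delta^2] of size [theta^6]: admissible as a correction of degree 2. *)
Lemma delta_sqr_sub n : (0 < n)%N -> `|deltastar_op n ^+ 2 - delta_sqr n| <= 100 * theta n ^+ 8.
Proof.
move=> n0; have t0 := theta_gt0 R n0; have t1 := theta_le1 R n0; have p0 := pi_gt0 R.
have n1 : 1 <= (n%:R : R) by rewrite ler1n.
have g1 := gap_ge1 n1; have /andP[w0 w1] := inv_gap_bounds n1; rewrite inv_sqrt_nat in g1.
have [-> _] := deltastar_opE n0.
have -> : pi / 8 * theta n ^+ 6 - delta_sqr n =
   theta n ^+ 8 * (3 / 4 - pi / 8 * (inv_gap (n%:R : R) * (pi * inv_gap (n%:R : R) + 1))).
  rewrite /delta_sqr /inv_gap inv_sqrt_nat.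
  by move: (pi : R) p0 g1 => p p0 g1; field; rewrite gt_eqF //; lra.
rewrite normrM ger0_norm ?exprn_ge0 ?(ltW t0) // mulrC ler_wpM2r ?exprn_ge0 ?(ltW t0) //.
have p4 := @pihalf_lt2 R.
have a1 : pi * inv_gap (n%:R : R) <= 4 * 1 by apply: ler_pM => //; [lra | exact: ltW | lra].
have a0 : 0 <= pi * inv_gap (n%:R : R) by rewrite mulr_ge0 // ltW.
have b1 : inv_gap (n%:R : R) * (pi * inv_gap (n%:R : R) + 1) <= 1 * 5 by apply: ler_pM => //; [exact: ltW | lra | lra].
have b0 : 0 <= inv_gap (n%:R : R) * (pi * inv_gap (n%:R : R) + 1) by rewrite mulr_ge0 ?(ltW w0) //; lra.
have c1 : pi / 8 * (inv_gap (n%:R : R) * (pi * inv_gap (n%:R : R) + 1)) <= 1 * (1 * 5) by apply: ler_pM => //; lra.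
have c0 : 0 <= pi / 8 * (inv_gap (n%:R : R) * (pi * inv_gap (n%:R : R) + 1)) by rewrite mulr_ge0 //; lra.
move: (pi / 8 * _) c0 c1 => x c0 c1.
by rewrite ler_norml; apply/andP; split; lra.
Qed.

End PbarExpansion.

(** * Log-polynomiality and Hermite-Jensen limits of overpartitions *)

Section Asymptotics.
Variable R : realType.
Implicit Types (n m k j K : nat).
Local Notation theta := (theta R).
Local Notation pbar := (@pbar R).

Lemma near_theta_le (e : R) : 0 < e -> \forall n \near \oo, (0 < n)%N /\ theta n <= e.
Proof.
move=> e0; have [N N3 hN] := kappa_small e0; exists N => // n /= Nn.
have n0 : (0 < n)%N by apply: leq_trans Nn; apply: ltn_trans N3.
by split=> //; apply: le_trans (theta_le_kappa R n0) (hN n Nn).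
Qed.

Lemma near_theta : \forall n \near \oo, (0 < n)%N /\ theta n <= 4^-1.
Proof. by apply: near_theta_le; rewrite invr_gt0. Qed.

Lemma theta_cvg : theta @ \oo --> 0.
Proof.
apply/cvgr0Pnorm_le => e e0; near=> n.
have [n0 h] : (0 < n)%N /\ theta n <= e by near: n; exact: near_theta_le.
by rewrite ger0_norm // ltW // theta_gt0.
Unshelve. all: by end_near. Qed.

Section Scale.
Variable delta : nat -> R.
Hypothesis delta_bounds : \forall n \near \oo, theta n ^+ 3 / 3 <= delta n <= 3 * theta n ^+ 3.

Lemma delta_eventually_gt0 : \forall n \near \oo, 0 < delta n.
Proof.
near=> n; have [n0 _] : (0 < n)%N /\ theta n <= 4^-1 by near: n; exact: near_theta.
have /andP[h _] : theta n ^+ 3 / 3 <= delta n <= 3 * theta n ^+ 3 by near: n.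
by apply: lt_le_trans h; rewrite divr_gt0 // exprn_gt0 // theta_gt0.
Unshelve. all: by end_near. Qed.

Lemma delta_cvg0 : delta @ \oo --> 0.
Proof.
apply: (@cvg_seq_squeeze0 _ _ (fun n => 3 * theta n ^+ 3)); last first.
  by have := cvg_seqZ 3 (cvg_seqX 3 theta_cvg); rewrite expr0n mulr0.
near=> n; have d0 : 0 < delta n by near: n; exact: delta_eventually_gt0.
have /andP[_ h] : theta n ^+ 3 / 3 <= delta n <= 3 * theta n ^+ 3 by near: n.
by rewrite gtr0_norm.
Unshelve. all: by end_near. Qed.

Lemma small_quotient (u : nat -> R) C k :
  (\forall n \near \oo, `|u n| <= C * theta n ^+ (3 * k + 1)) ->
  (fun n => u n / delta n ^+ k) @ \oo --> 0.
Proof.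
move=> hu; apply: (@cvg_seq_squeeze0 _ _ (fun n => C * 3 ^+ k * theta n)); last first.
  by have := cvg_seqZ (C * 3 ^+ k) theta_cvg; rewrite mulr0.
near=> n; have d0 : 0 < delta n by near: n; exact: delta_eventually_gt0.
have [n0 _] : (0 < n)%N /\ theta n <= 4^-1 by near: n; exact: near_theta.
have t0 := theta_gt0 R n0.
have /andP[h _] : theta n ^+ 3 / 3 <= delta n <= 3 * theta n ^+ 3 by near: n.
rewrite normrM normfV [`|delta n ^+ k|]gtr0_norm ?exprn_gt0 // ler_pdivrMr ?exprn_gt0 //.
have hn : `|u n| <= C * theta n ^+ (3 * k + 1) by near: n.
have C0 : 0 <= C.
  by rewrite -(pmulr_lge0 _ (_ : 0 < theta n ^+ (3 * k + 1))) ?exprn_gt0 //; exact: le_trans hn.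
apply: le_trans hn _.
have -> : C * theta n ^+ (3 * k + 1) = C * 3 ^+ k * theta n * (theta n ^+ 3 / 3) ^+ k.
  by rewrite exprD exprM expr_div_n; field; rewrite expf_neq0.
have t3 : 0 <= theta n ^+ 3 / 3 by rewrite divr_ge0 // exprn_ge0 // ltW.
apply: ler_wpM2l; first by rewrite mulr_ge0 ?(ltW t0) // mulr_ge0 // exprn_ge0.
by apply: lerXn2r; rewrite ?nnegrE // ltW.
Unshelve. all: by end_near. Qed.

End Scale.

(** The coefficient is [O(theta^(4k-2))], and [4 k - 2 >= 3 k + 1] from [k = 3] on. *)
Lemma log_coef_small k : (3 <= k)%N -> exists C, forall n, (0 < n)%N ->
  `|log_coef R k n| <= C * theta n ^+ (3 * k + 1).
Proof.
case: k => // k k2; have [C C0 hC] := log_coef_bound R k; exists C => n n0.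
apply: le_trans (hC n n0) _; rewrite ler_wpM2l // ler_wiXn2l ?theta_le1 ?(ltW (theta_gt0 R n0)) //.
by clear - k2; lia.
Qed.

(** A change of data moves [A_op - A] and [delta^2 - delta_sqr] into the corrections of degrees 1
    and 2, where they must be [o(delta)] and [o(delta^2)]. *)
Lemma hermite_jensen_pbar (A delta : nat -> R) C D d :
  (\forall n \near \oo, theta n ^+ 3 / 3 <= delta n <= 3 * theta n ^+ 3) ->
  (\forall n \near \oo, `|A_op n - A n| <= C * theta n ^+ 4) ->
  (\forall n \near \oo, `|delta n ^+ 2 - delta_sqr R n| <= D * theta n ^+ 7) ->
  (1 <= d)%N -> hermite_jensen d pbar A (-1) delta.
Proof.
move=> hd hA hs d1.
pose g k n := log_coef R k n - (k == 1%N)%:R * A n + (k == 2%N)%:R * delta n ^+ 2.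
(* The order [d.+1] is at least 2 for every [d >= 1]. *)
apply: (@hermite_jensen_of_log_expansion R pbar A delta g d.+1 d) => //.
- exact: pbar_gt0.
- exact: delta_eventually_gt0.
- exact: delta_cvg0.
- by rewrite d1 -addn2 leq_addr.
- move=> k /andP[k1 km].
  have [->|k1'] := eqVneq k 1%N.
    apply: (small_quotient hd (C := C)); near=> n.
    have [n0 _] : (0 < n)%N /\ theta n <= 4^-1 by near: n; exact: near_theta.
    by rewrite /g /= mul1r mul0r addr0 log_coef1 //; near: n.
  have [->|k2'] := eqVneq k 2%N.
    apply: (small_quotient hd (C := D)); near=> n.
    have [n0 _] : (0 < n)%N /\ theta n <= 4^-1 by near: n; exact: near_theta.
    by rewrite /g /= mul1r mul0r subr0 log_coef2 // addrC; near: n.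
  have k3 : (3 <= k)%N by clear - k1 k1' k2'; lia.
  have [E hE] := log_coef_small k3.
  apply: (small_quotient hd (C := E)); near=> n.
  have [n0 _] : (0 < n)%N /\ theta n <= 4^-1 by near: n; exact: near_theta.
  by rewrite /g (negbTE k1') (negbTE k2') !mul0r subr0 addr0 hE.
move=> j /andP[j1 jm]; have [E _ hE] := @pbar_log_expansion R d.+1 d1.
apply: (small_quotient hd (C := E)); near=> n.
have [n0 _] : (0 < n)%N /\ theta n <= 4^-1 by near: n; exact: near_theta.
have := hE n j n0 jm.
have -> : \sum_(1 <= k < d.+2) log_coef R k n * j%:R ^+ k =
   A n * j%:R - delta n ^+ 2 * j%:R ^+ 2 + \sum_(1 <= k < d.+2) g k n * j%:R ^+ k; last by [].
rewrite !(@big_ltn _ _ _ 1) // !(@big_ltn _ _ _ 2) //.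
rewrite [X in _ = _ + (_ + (_ + X))](eq_big_nat _ _ (F2 := fun k => log_coef R k n * j%:R ^+ k)); last first.
  move=> k /andP[k3 _]; rewrite /g !gtn_eqF ?mul0r ?subr0 ?addr0 //; exact: ltn_trans k3.
by rewrite /g /= !mul0r !mul1r; ring.
Unshelve. all: by end_near. Qed.

Lemma log_polynomial_pbar m : (2 <= m)%N -> log_polynomial m pbar A_op (-1) delta_op.
Proof.
move=> m2.
have hd : \forall n \near \oo, theta n ^+ 3 / 3 <= delta_op n <= 3 * theta n ^+ 3.
  near=> n; have [n0 t4] : (0 < n)%N /\ theta n <= 4^-1 by near: n; exact: near_theta.
  exact: delta_op_bounds.
split=> //; split; first by right.
split; first exact: pbar_gt0.
split; first exact: delta_eventually_gt0.
split; first exact: delta_cvg0.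
exists (log_coef R); split.
  move=> k /andP[k3 _]; have [E hE] := log_coef_small k3.
  apply: (small_quotient hd (C := E)); near=> n.
  have [n0 _] : (0 < n)%N /\ theta n <= 4^-1 by near: n; exact: near_theta.
  exact: hE.
move=> j /andP[j1 jm]; have [E _ hE] := @pbar_log_expansion R m m2.
apply: (small_quotient hd (C := E)); near=> n.
have [n0 t4] : (0 < n)%N /\ theta n <= 4^-1 by near: n; exact: near_theta.
have := hE n j n0 jm; rewrite (@big_ltn _ _ _ 1) ?(@big_ltn _ _ _ 2) //; last exact: ltnW.
by rewrite log_coef1 // log_coef2 // delta_op_sqr // expr1 mulN1r addrA.
Unshelve. all: by end_near. Qed.

End Asymptotics.

Theorem theorem7p2 (R : realType) :
  (forall m : nat, (2 <= m)%N ->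
     log_polynomial m (@pbar R) A_op (-1) delta_op) /\
  (forall d : nat, (1 <= d)%N ->
     hermite_jensen d (@pbar R) A_op (-1) delta_op) /\
  (forall d : nat, (1 <= d)%N ->
     hermite_jensen d (@pbar R) Astar_op (-1) deltastar_op).
Proof.
split; first exact: log_polynomial_pbar.
split=> d d1.
  apply: (@hermite_jensen_pbar R A_op delta_op 0 0) => //; near=> n;
    have [n0 t4] : (0 < n)%N /\ theta R n <= 4^-1 by near: n; exact: near_theta.
  - exact: delta_op_bounds.
  - by rewrite subrr normr0 mul0r.
  - by rewrite delta_op_sqr // subrr normr0 mul0r.
apply: (@hermite_jensen_pbar R Astar_op deltastar_op 2 100) => //; near=> n;
  have [n0 t4] : (0 < n)%N /\ theta R n <= 4^-1 by near: n; exact: near_theta.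
- exact: deltastar_op_bounds.
- exact: A_op_sub.
- apply: le_trans (delta_sqr_sub R n0) _; rewrite ler_wpM2l //.
  by rewrite ler_wiXn2l ?theta_le1 ?(ltW (theta_gt0 R n0)).
Unshelve. all: by end_near. Qed.
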